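(* Let $s\in(0,1)$ and $0<\lambda\le\Lambda$. Let $\{L_\gamma\}_{\gamma\in\Gamma}\subset\mathcal L_s(\lambda,\Lambda;2)$ be any family of operators, and let $u\in C(B_1)\cap L^\infty(\mathbb R^n)$ be any viscosity solution of $$\inf_{\gamma\in\Gamma}\{L_\gamma u\}=0\quad\text{in }B_1 .$$ Then, for all $e\in\mathbb S^{n-1}$, in the convexity sense, $$\partial^2_{ee}u\ \ge\ -C\|u\|_{L^\infty(\mathbb R^n)}\quad\text{in }B_{1/2},$$ where $C$ depends only on $n,s,\lambda,\Lambda$.
   Context: $B_r$ is the open ball of radius $r$ centered at $0$ in $\mathbb R^n$. Operators: $Lu(x)=\mathrm{p.v.}\int_{\mathbb R^n}(u(x)-u(y))K(x-y)\,dy$ with $K:\mathbb R^n\to[0,\infty]$ symmetric, $K(y)=K(-y)$. One writes $L\in\mathcal L_s(\lambda,\Lambda;2)$ if for all $y\neq0$: $\lambda|y|^{-n-2s}\le K(y)\le\Lambda|y|^{-n-2s}$, $|\nabla K(y)|\le\Lambda|y|^{-1}K(y)$, and $|D^2K(y)|\le\Lambda|y|^{-2}K(y)$. Convexity sense: ''$\partial^2_{ee}u\ge -C$ in a ball (in the convexity sense)'' means that $x\mapsto u(x)+\frac{C}{2n}|x|^2$ is convex there. Viscosity solution of $\mathcal I u=0$ in $B_1$ (with $\mathcal I u=\inf_\gamma L_\gamma u$): whenever $x_0\in B_1$, $N\subset B_1$ is a neighborhood of $x_0$, $\varphi\in C^2(N)$, $\varphi(x_0)=u(x_0)$, and $w:=\varphi$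 in $N$, $w:=u$ in $\mathbb R^n\setminus N$, one has $\mathcal I w(x_0)\le0$ if $\varphi\ge u$ in $N$, and $\mathcal I w(x_0)\ge0$ if $\varphi\le u$ in $N$. *)

(* Defs.v *)
From HB Require Import structures.
From mathcomp Require Import all_boot all_order all_algebra.
From mathcomp Require Import all_classical all_reals all_analysis.

Set Implicit Arguments.
Unset Strict Implicit.
Unset Printing Implicit Defensive.

Import Order.TTheory GRing.Theory Num.Theory.
Import numFieldNormedType.Exports.

Local Open Scope classical_set_scope.
Local Open Scope ring_scope.

Definition rV_display : measure_display -> measure_display.
Proof. exact. Qed.

Section rV_measurable.
Context {d} {T : sigmaRingType d} (n : nat).

Let coord (i : 'I_n) (x : 'rV[T]_n) : T := x ord0 i.

(* The product sigma-algebra; over the reals, the Borel sigma-algebra of R^n. *)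
Let rV_measurable := g_sigma_preimage coord.

Let rV_measurable0 : rV_measurable set0.
Proof. exact: sigma_algebra0. Qed.

Let rV_measurableC A : rV_measurable A -> rV_measurable (~` A).
Proof. exact: sigma_algebraC. Qed.

Let rV_measurable_bigcup (F : _^nat) : (forall i, rV_measurable (F i)) ->
  rV_measurable (\bigcup_i (F i)).
Proof. exact: sigma_algebra_bigcup. Qed.

HB.instance Definition _ := @isMeasurable.Build (rV_display d) 'rV[T]_n
  rV_measurable rV_measurable0 rV_measurableC rV_measurable_bigcup.

End rV_measurable.

Lemma measurable_coord_rV d (T : sigmaRingType d) n (i : 'I_n) :
  measurable_fun [set: 'rV[T]_n] (fun x : 'rV[T]_n => x ord0 i).
Proof.
move=> _ Y mY; rewrite setTI; apply: sub_sigma_algebra => /=.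
rewrite -bigcup_seq/=; exists i => /=; first by rewrite mem_index_enum.
by exists Y => //; rewrite setTI.
Qed.

Lemma measurable_fun_rVP d1 d2 (T1 : measurableType d1) (T2 : measurableType d2)
    n (f : T1 -> 'rV[T2]_n) :
  (forall i, measurable_fun [set: T1] (fun x => f x ord0 i)) ->
  measurable_fun [set: T1] f.
Proof.
move=> mf _ A mA; rewrite setTI.
have : preimage_set_system [set: T1] f
    (g_sigma_preimage (fun (i : 'I_n) (x : 'rV[T2]_n) => x ord0 i))
    (f @^-1` A) by exists A => //; rewrite setTI.
rewrite -(g_sigma_preimage_comp (fun (i : 'I_n) (x : 'rV[T2]_n) => x ord0 i) f).
apply: smallest_sub; first exact: sigma_algebra_measurable.
rewrite -bigcup_seq => B [i _] [C mC <-].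
by have := mf i measurableT _ mC.
Qed.

Section lebesgue_rV.
Context {R : realType}.
Local Open Scope ereal_scope.

Definition cons_rV n (p : measurableTypeR R * 'rV[R]_n) : 'rV[R]_n.+1 :=
  \row_i if unlift ord0 i is Some j then p.2 ord0 j else p.1.

Definition uncons_rV n (x : 'rV[R]_n.+1) : measurableTypeR R * 'rV[R]_n :=
  (x ord0 ord0, \row_j x ord0 (lift ord0 j)).

Lemma cons_rVK n : cancel (@cons_rV n) (@uncons_rV n).
Proof.
move=> [a v]; rewrite /uncons_rV !mxE unlift_none; congr (_, _).
by apply/rowP => j; rewrite !mxE liftK.
Qed.

Lemma uncons_rVK n : cancel (@uncons_rV n) (@cons_rV n).
Proof.
by move=> x; apply/rowP => i; rewrite mxE; case: unliftP => [j|] -> //=; rewrite mxE.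
Qed.

Lemma measurable_cons_rV n : measurable_fun setT (@cons_rV n).
Proof.
apply: measurable_fun_rVP => i; rewrite /cons_rV.
under eq_fun do rewrite mxE.
case: (unlift ord0 i) => [j|]; last exact: measurable_fst.
apply: (@measurableT_comp _ _ _ _ _ _ (fun x : 'rV[R]_n => x ord0 j)) => //.
exact: measurable_coord_rV.
Qed.

Lemma measurable_uncons_rV n : measurable_fun setT (@uncons_rV n).
Proof.
apply: measurable_fun_pair; first exact: measurable_coord_rV.
apply: measurable_fun_rVP => j; under eq_fun do rewrite mxE.
exact: measurable_coord_rV.
Qed.

Section step.
Variables (n : nat) (mu : {sigma_finite_measure set 'rV[R]_n -> \bar R}).

Definition lebesgue_rV_step : set 'rV[R]_n.+1 -> \bar R :=
  pushforward (@lebesgue_measure R \x mu) (@cons_rV n).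

Let step0 : lebesgue_rV_step set0 = 0.
Proof. by rewrite /lebesgue_rV_step /pushforward preimage_set0 measure0. Qed.

Let step_ge0 A : 0 <= lebesgue_rV_step A.
Proof. by rewrite /lebesgue_rV_step /pushforward. Qed.

Let step_sigma_additive : semi_sigma_additive lebesgue_rV_step.
Proof.
move=> F mF tF mUF; rewrite /lebesgue_rV_step /pushforward preimage_bigcup.
apply: measure_semi_sigma_additive.
- by move=> k; rewrite -[X in measurable X]setTI; exact: measurable_cons_rV.
- apply/trivIsetP => /= i j _ _ ij; rewrite -preimage_setI.
  by move/trivIsetP : tF => /(_ _ _ _ _ ij) ->//; rewrite preimage_set0.
- rewrite -preimage_bigcup -[X in measurable X]setTI.
  exact: measurable_cons_rV.
Qed.

HB.instance Definition _ := isMeasure.Build _ _ _ lebesgue_rV_step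
  step0 step_ge0 step_sigma_additive.

Let step_sigma_finite : sigma_finite setT lebesgue_rV_step.
Proof.
have /sigma_finiteP[F [TF ndF Foo]] := sigma_finiteT (@lebesgue_measure R).
have /sigma_finiteP[G [TG ndG Goo]] := sigma_finiteT mu.
exists (fun k => @uncons_rV n @^-1` (F k `*` G k)).
  rewrite -preimage_bigcup (_ : \bigcup_k (F k `*` G k) = setT) ?preimage_setT//.
  rewrite -setXTT TF TG predeqE => -[x y]; split.
    by move=> [k _ []/= ? ?]; split; exists k.
  move=> [/= [k _ Fkx] [l _ Gly]]; exists (maxn k l) => //; split.
  - by move: x Fkx; exact/subsetPset/ndF/leq_maxl.
  - by move: y Gly; exact/subsetPset/ndG/leq_maxr.
move=> k; have [mFk Fkoo] := Foo k; have [mGk Gkoo] := Goo k.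
split.
  rewrite -[X in measurable X]setTI; apply: measurable_uncons_rV => //.
  exact: measurableX.
rewrite /lebesgue_rV_step /pushforward -comp_preimage.
rewrite (_ : _ \o _ = id) ?preimage_id; last first.
  by apply/funext => p /=; rewrite cons_rVK.
by rewrite product_measure1E// lte_mul_pinfty// ge0_fin_numE.
Qed.

HB.instance Definition _ :=
  Measure_isSigmaFinite.Build _ _ _ lebesgue_rV_step step_sigma_finite.

End step.

(* Lebesgue measure on R^n, as an n-fold product of [lebesgue_measure]. *)
Fixpoint lebesgue_rV n : {sigma_finite_measure set 'rV[R]_n -> \bar R} :=
  match n with
  | 0 => \d_(0%R : 'rV[R]_0)
  | n'.+1 => lebesgue_rV_step (lebesgue_rV n')
  end.

Lemma lebesgue_rV_box n (A : 'I_n -> set R) : (forall i, measurable (A i)) ->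
  lebesgue_rV n [set x | forall i, A i (x ord0 i)] =
  \prod_(i < n) lebesgue_measure (A i).
Proof.
elim: n A => [|n IH] A mA /=.
  by rewrite big_ord0 diracE mem_set// => -[].
rewrite big_ord_recl -IH//= /lebesgue_rV_step /pushforward.
rewrite -product_measure1E//.
  congr ((_ \x _) _); apply/seteqP; split => -[a v]/=; rewrite /cons_rV.
    move=> H; split => [|i]; first by have := H ord0; rewrite mxE unlift_none.
    by have := H (lift ord0 i); rewrite mxE liftK.
  by move=> [H0 H] i; rewrite mxE; case: unliftP => [j|] ->.
  exact: mA.
rewrite (_ : (fun _ => _) = \bigcap_(i in setT)
    ((fun x : 'rV[R]_n => x ord0 i) @^-1` A (lift ord0 i))); last first.
  by apply/seteqP; split => x /= H i; [move=> _|]; exact: H.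
apply: fin_bigcap_measurable => // i _.
by rewrite -[X in measurable X]setTI; exact: measurable_coord_rV.
Qed.

End lebesgue_rV.

Section euclidean.
Context {R : realType}.

(* The library norm on matrices is the sup norm; this is the Euclidean norm on
   row vectors and the Frobenius norm on Hessians. *)
Definition enorm m n (A : 'M[R]_(m, n)) : R :=
  Num.sqrt (\sum_i \sum_j A i j ^+ 2).

Definition eball n (r : R) : set 'rV[R]_n := [set x | enorm x < r].

Definition grad n (f : 'rV[R]_n -> R) (x : 'rV[R]_n) : 'rV[R]_n :=
  \row_i 'D_(delta_mx ord0 i) f x.

Definition hess n (f : 'rV[R]_n -> R) (x : 'rV[R]_n) : 'M[R]_n :=
  \matrix_(i, j) 'D_(delta_mx ord0 i) ('D_(delta_mx ord0 j) f) x.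

Definition twice_differentiable n (f : 'rV[R]_n -> R) (x : 'rV[R]_n) :=
  differentiable f x /\ differentiable (grad f) x.

Definition C2_on n (N : set 'rV[R]_n) (f : 'rV[R]_n -> R) :=
  forall x, N x -> twice_differentiable f x /\ {for x, continuous (hess f)}.

(* [convex_function D f] does not depend on [e]: this is the stated meaning of
   d^2_{ee} u >= - C in the convexity sense. *)
Definition dee_geN n (D : set 'rV[R]_n) (e : 'rV[R]_n) (u : 'rV[R]_n -> R)
    (C : R) :=
  convex_function D (fun x => u x + C / (2 * n%:R) * enorm x ^+ 2).

(* Lebesgue measurable means equal a.e. to a Borel measurable function, whereas
   membership in [Lfun] asks for Borel measurability. *)
Definition Linfty n (u : 'rV[R]_n -> R) :=
  exists2 v : 'rV[R]_n -> R,
    v \in Lfun (lebesgue_rV n) +oo%E & u = v %[ae lebesgue_rV n].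

Definition Linfty_norm n (u : 'rV[R]_n -> R) : R :=
  fine ('N[lebesgue_rV n]_+oo [EFin \o u])%E.

End euclidean.

Section nonlocal.
Context {R : realType} {n : nat}.
Implicit Types (K : 'rV[R]_n -> \bar R) (u phi : 'rV[R]_n -> R).

(* The class L_s(lam, Lam; 2); the bounds make K finite away from the origin, so
   that derivatives are taken of [fine \o K] there. *)
Record kernel_class (s lam Lam : R) K : Prop := KernelClass {
  kernel_ge0 : forall y : 'rV[R]_n, (0 <= K y)%E ;
  kernel_sym : forall y : 'rV[R]_n, K (- y) = K y ;
  kernel_lower : forall y : 'rV[R]_n, y != 0 ->
    ((lam * enorm y `^ (- n%:R - 2 * s))%:E <= K y)%E ;
  kernel_upper : forall y : 'rV[R]_n, y != 0 ->
    (K y <= (Lam * enorm y `^ (- n%:R - 2 * s))%:E)%E ;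
  kernel_diff : forall y : 'rV[R]_n, y != 0 -> twice_differentiable (fine \o K) y ;
  kernel_grad : forall y : 'rV[R]_n, y != 0 ->
    enorm (grad (fine \o K) y) <= Lam * (enorm y)^-1 * fine (K y) ;
  kernel_hess : forall y : 'rV[R]_n, y != 0 ->
    enorm (hess (fine \o K) y) <= Lam * (enorm y) ^- 2 * fine (K y) }.

Definition pv_op K u (x : 'rV[R]_n) : \bar R :=
  lim ((\int[lebesgue_rV n]_(y in [set y | (eps < enorm (x - y))%R])
          ((u x - u y)%:E * K (x - y)%R))%E @[eps --> 0^'+]).

Definition inf_op (Gamma : Type) (K : Gamma -> 'rV[R]_n -> \bar R) u
    (x : 'rV[R]_n) : \bar R :=
  ereal_inf [set pv_op (K g) u x | g in [set: Gamma]].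

Definition viscosity_solution (I : ('rV[R]_n -> R) -> 'rV[R]_n -> \bar R)
    (D : set 'rV[R]_n) u :=
  forall (x0 : 'rV[R]_n) (N : set 'rV[R]_n) phi,
    D x0 -> open N -> N x0 -> N `<=` D -> C2_on N phi -> phi x0 = u x0 ->
    ((forall y, N y -> u y <= phi y) -> (I (patch u N phi) x0 <= 0)%E) /\
    ((forall y, N y -> phi y <= u y) -> (0 <= I (patch u N phi) x0)%E).

End nonlocal.

(* Main.v *)
From HB Require Import structures.
Require Import Defs.
From mathcomp Require Import all_boot all_order all_algebra.
From mathcomp Require Import all_classical all_reals all_analysis.
From mathcomp Require Import measurable_realfun ess_sup_inf.
From mathcomp Require Import ring lra.

Set Implicit Arguments.
Unset Strict Implicit.
Unset Printing Implicit Defensive.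

Import Order.TTheory GRing.Theory Num.Theory.
Import numFieldNormedType.Exports.

Local Open Scope classical_set_scope.
Local Open Scope ring_scope.

(** Suppose the symmetric second difference [u (z0 + h) + u (z0 - h) - 2 u z0]
    were very negative.  Double the variables: minimise
    [u x + u y - 2 u z + kap (|x - z - h|^2 + |y - z + h|^2) + w weight(z)^-2],
    where the last term blows up at the boundary of a ball.  At the minimum,
    [u] is touched from below at [x] and [y] and from above at [z] by paraboloids,
    so that concavity of the infimum yields a single kernel [K] of the family for
    which [D v = u (x - v) + u (y - v) - 2 u (z - v)] satisfies
    [int (D 0 - D v) K v dv >= - small].  On the other hand, translating the three
    points leaves the penalty unchanged, so near [v = 0], [D] is bounded below by
    [D 0] plus a linear term and a quadratic error from the weight.  Cut [K]
    radially at the scale [r = eps weight(z)].  The singular part only sees the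
    quadratic error, and for the part supported away from [0] the second
    difference in [D] is moved onto the kernel, which costs
    [|h|^2 r^(-2-2s) sup |u|] by the second order regularity of [K].  The term
    [D 0 < 0] then dominates, a contradiction.  The resulting lower bound on second
    differences gives convexity of [u + C |x|^2] along segments. *)

(** The constants come from scaling. With [t] the weight at the minimising [z] and
    [w = m^2 U |h|^2], negativity of the minimum gives [D 0 <= - w / t^2]. At radius [r = eps t] the
    quadratic error of the weight is of order [w r^2 / t^4 = eps^2 w / t^2], absorbed by a small
    [eps]. Moving the second difference onto the kernel costs [U |h|^2 / r^2]; the weight enters
    with the power [-2] precisely so that this has the same order in [t] as [w / t^2], and a large
    [m] beats it. Every term carries the factor [r^(-2s)], so [eps] is chosen before [m], both
    independent of [u]. The bound [w / t^2 < 4U] also forces [m |h| < 2t], hence [16 |h| <= r]: seen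
    from distance [r], the kernel is smooth at scale [|h|]. The three points are not exactly
    symmetric. Their asymmetry costs a first difference of the kernel, so it has to be of order
    [|h|^2]; this is the reason for [kap = 4U / |h|^4]. The touching paraboloids are then very
    steep, but their opening only enters through a ball of radius [rho], which is shrunk once the
    minimum is fixed, while all other bounds are uniform in [rho]. *)

Section euclidean_norm.
Context {R : realType} {n : nat}.
Implicit Types (x y z v w : 'rV[R]_n) (a b c r : R).

Definition dot x y : R := \sum_i x ord0 i * y ord0 i.

Lemma dotC x y : dot x y = dot y x.
Proof. by apply: eq_bigr => i _; rewrite mulrC. Qed.

Lemma dotDl x y z : dot (x + y) z = dot x z + dot y z.
Proof. by rewrite -big_split; apply: eq_bigr => i _; rewrite mxE mulrDl. Qed.

Lemma dotZl a x y : dot (a *: x) y = a * dot x y.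
Proof. by rewrite mulr_sumr; apply: eq_bigr => i _; rewrite mxE mulrA. Qed.

Lemma dotNl x y : dot (- x) y = - dot x y.
Proof. by rewrite -scaleN1r dotZl mulN1r. Qed.

Lemma dotDr x y z : dot x (y + z) = dot x y + dot x z.
Proof. by rewrite dotC dotDl !(dotC _ x). Qed.

Lemma dotZr a x y : dot x (a *: y) = a * dot x y.
Proof. by rewrite dotC dotZl dotC. Qed.

Lemma dotNr x y : dot x (- y) = - dot x y.
Proof. by rewrite dotC dotNl dotC. Qed.

Lemma dot_ge0 x : 0 <= dot x x.
Proof. by apply: sumr_ge0 => i _; rewrite -expr2 sqr_ge0. Qed.

Lemma enormE x : enorm x = Num.sqrt (dot x x).
Proof.
by rewrite /enorm big_ord1; congr Num.sqrt; apply: eq_bigr => i _; rewrite expr2.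
Qed.

Lemma enorm_sqr x : enorm x ^+ 2 = dot x x.
Proof. by rewrite enormE sqr_sqrtr// dot_ge0. Qed.

Lemma enorm_ge0 x : 0 <= enorm x.
Proof. exact: sqrtr_ge0. Qed.

Lemma enormN x : enorm (- x) = enorm x.
Proof. by rewrite !enormE dotNl dotNr opprK. Qed.

Lemma enormZ a x : enorm (a *: x) = `|a| * enorm x.
Proof.
by rewrite !enormE dotZl dotZr mulrA -expr2 sqrtrM ?sqr_ge0// sqrtr_sqr.
Qed.

Lemma enorm0 : enorm (0 : 'rV[R]_n) = 0.
Proof. by rewrite -(scale0r (0 : 'rV[R]_n)) enormZ normr0 mul0r. Qed.

Lemma coord_le_enorm x i : `|x ord0 i| <= enorm x.
Proof.
rewrite -sqrtr_sqr enormE ler_sqrt ?dot_ge0// /dot (bigD1 i)//= -expr2 lerDl.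
by apply: sumr_ge0 => j _; rewrite -expr2 sqr_ge0.
Qed.

Lemma enorm_eq0 x : (enorm x == 0) = (x == 0).
Proof.
apply/eqP/eqP => [x0|->]; last exact: enorm0.
apply/rowP => i; rewrite mxE; apply/eqP; rewrite -normr_le0 -x0.
exact: coord_le_enorm.
Qed.

Lemma enorm_gt0 x : (0 < enorm x) = (x != 0).
Proof. by rewrite lt_neqAle enorm_ge0 eq_sym enorm_eq0 andbT. Qed.

(** With [a], [b] the two norms, the vector [enorm y *: x - enorm x *: y] has squared norm
    [2ab(ab - dot x y)], and [ab > 0] can be cancelled. *)
Lemma dot_le_enorm x y : dot x y <= enorm x * enorm y.
Proof.
have [->|x0] := eqVneq x 0.
  by rewrite -(scale0r 0) dotZl mul0r scale0r enorm0 mul0r.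
have [->|y0] := eqVneq y 0.
  by rewrite -(scale0r 0) dotZr mul0r scale0r enorm0 mulr0.
have xy : 0 < enorm x * enorm y by rewrite mulr_gt0 ?enorm_gt0.
have := dot_ge0 (enorm y *: x - enorm x *: y).
rewrite !(dotDl, dotDr, dotNl, dotNr, dotZl, dotZr) -!enorm_sqr (dotC y x).
set a := enorm x in xy *; set b := enorm y in xy *; set d := dot x y => h.
by rewrite -(ler_pM2l xy); nra.
Qed.

Lemma normr_dot x y : `|dot x y| <= enorm x * enorm y.
Proof.
by rewrite ler_norml dot_le_enorm andbT lerNl -dotNl -(enormN x) dot_le_enorm.
Qed.

Lemma enormD x y : enorm (x + y) <= enorm x + enorm y.
Proof.
rewrite -(ler_pXn2r (ltn0Sn 1)) ?nnegrE ?addr_ge0 ?enorm_ge0//.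
rewrite enorm_sqr dotDl !dotDr -!enorm_sqr (dotC y x).
by have := dot_le_enorm x y; nra.
Qed.

Lemma enorm_sub x y : enorm (x - y) <= enorm x + enorm y.
Proof. by rewrite -(enormN y) enormD. Qed.

Lemma enorm_lerB x y : enorm x - enorm y <= enorm (x + y).
Proof.
rewrite lerBlDr (le_trans _ (enorm_sub _ _))//.
by rewrite addrK.
Qed.

Lemma enorm_le_coord x r : 0 <= r -> (forall i, `|x ord0 i| <= r) ->
  enorm x <= n%:R * r.
Proof.
move=> r0 xr; rewrite -(ler_pXn2r (ltn0Sn 1)) ?nnegrE ?mulr_ge0 ?enorm_ge0//.
rewrite enorm_sqr (@le_trans _ _ (\sum_(i < n) r ^+ 2))//.
  apply: ler_sum => i _; rewrite -expr2 -(real_normK (num_real _)).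
  by rewrite ler_pXn2r ?nnegrE.
rewrite sumr_const card_ord -[leLHS]mulr_natl exprMn ler_wpM2r ?sqr_ge0//.
by rewrite -natrX ler_nat; case: (n) => // m; rewrite leq_pmulr.
Qed.

Lemma mx_norm_le_enorm x : `|x| <= enorm x.
Proof.
rewrite [leLHS]/Num.norm/= mx_normrE; apply/bigmax_leP => /=.
split; first exact: enorm_ge0.
by move=> [i j] _ /=; rewrite ord1 coord_le_enorm.
Qed.

Lemma coord_continuous_rV i : continuous (fun x : 'rV[R]_n => x ord0 i : R).
Proof. exact: coord_continuous. Qed.

Lemma continuous_sum (T : topologicalType) (I : Type) (s : seq I)
    (f : I -> T -> R) (t : T) :
  (forall i, {for t, continuous (f i)}) ->
  {for t, continuous (fun t' => \sum_(i <- s) f i t')}.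
Proof.
move=> fc; elim: s => [|i s IH]; rewrite /prop_for /continuous_at.
  by rewrite big_nil; under eq_fun do rewrite big_nil; exact: cvg_cst.
rewrite big_cons; under eq_fun do rewrite big_cons.
by apply: cvgD; [exact: fc|exact: IH].
Qed.

Lemma dot_continuous (T : topologicalType) (f g : T -> 'rV[R]_n) (t : T) :
  {for t, continuous f} -> {for t, continuous g} ->
  {for t, continuous (fun s => dot (f s) (g s))}.
Proof.
move=> fc gc; apply: continuous_sum => i.
apply: (@continuousM _ _ (fun t => f t ord0 i) (fun t => g t ord0 i)).
  exact: (@continuous_comp _ _ _ f _ t fc (@coord_continuous_rV i _)).
exact: (@continuous_comp _ _ _ g _ t gc (@coord_continuous_rV i _)).
Qed.

Lemma enorm_continuous : continuous (@enorm R 1 n).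
Proof.
move=> x; rewrite /prop_for (_ : @enorm R 1 n = (fun y => Num.sqrt (dot y y))).
  apply: (@continuous_comp _ _ _ (fun y => dot y y) Num.sqrt).
    by apply: dot_continuous.
  exact: sqrt_continuous.
by apply/funext => y; rewrite enormE.
Qed.

Lemma open_eball_at x r : open [set y : 'rV[R]_n | enorm (y - x) < r].
Proof.
rewrite (_ : [set _ | _] = (fun y => enorm (y - x)) @^-1` [set a | a < r])//.
apply: open_comp; last exact: open_lt.
move=> y _; apply: (@continuous_comp _ _ _ (fun y => y - x) (@enorm R 1 n)).
  by apply: (@continuousB _ _ _ id (cst x)) => //; exact: cst_continuous.
exact: enorm_continuous.
Qed.

Lemma open_eball r : open (@eball R n r).
Proof.
rewrite (_ : eball r = [set y : 'rV[R]_n | enorm (y - 0) < r]).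
  exact: open_eball_at.
by apply/seteqP; split => y /=; rewrite subr0.
Qed.

End euclidean_norm.

(** * Borel sets and Lebesgue measure on [R^n] *)

Section rV_borel.
Context {R : realType} {n : nat}.

Lemma measurable_box (A : 'I_n -> set R) : (forall i, measurable (A i)) ->
  measurable [set x : 'rV[R]_n | forall i, A i (x ord0 i)].
Proof.
move=> mA; rewrite (_ : mkset _ = \bigcap_(i in setT)
    ((fun x : 'rV[R]_n => x ord0 i) @^-1` A i)); last first.
  by apply/seteqP; split => x /= H i; [move=> _|]; exact: H.
apply: fin_bigcap_measurable => // i _.
by rewrite -[X in measurable X]setTI; exact: measurable_coord_rV.
Qed.

(** The sigma-algebra is the product one, so [U] has to be written as a countable union of boxes:
    the cubes with rational centre and half-side [1/(k+1)] that [U] contains. *)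
Lemma open_measurable_rV (U : set 'rV[R]_n) : open U -> measurable U.
Proof.
move=> oU.
pose box (qk : 'rV[rat]_n * nat) := [set x : 'rV[R]_n |
  forall i, [set a | `|a - ratr (qk.1 ord0 i)| < qk.2.+1%:R^-1] (x ord0 i)].
pose F qk := if `[< box qk `<=` U >] then box qk else set0.
rewrite (_ : U = \bigcup_qk F qk); last first.
  apply/seteqP; split => [x Ux|x [qk _]]; last first.
    by rewrite /F; case: ifPn => // /asboolP; exact.
  have /nbhs_ballP[e /= e0 xeU] : nbhs x U by apply: open_nbhs_nbhs.
  (* The cube contains [x] without being centred there, so its points are within twice the half-side
     of [x]. *)
  have [k ke] : exists k, k.+1%:R^-1 < e / 2 :> R.
    by have [k] := ltr_add_invr (divr_gt0 e0 (ltr0n _ 2)); rewrite add0r; exists k.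
  have qP i : exists q : rat, `|x ord0 i - ratr q| < k.+1%:R^-1 :> R.
    have : x ord0 i - k.+1%:R^-1 < x ord0 i + k.+1%:R^-1.
      by rewrite ltrD2l gtrN.
    move=> /rat_in_itvoo[q]; rewrite in_itv/= => /andP[q1 q2].
    by exists q; rewrite ltr_distlC q1 q2.
  pose q := \row_i projT1 (cid (qP i)).
  exists (q, k) => //.
  have xq : box (q, k) x.
    by move=> i /=; rewrite mxE; case: cid.
  rewrite /F ifT//; apply/asboolP => y yq; apply: xeU.
  rewrite mx_norm_ball /ball_/=.
  rewrite (@le_lt_trans _ _ (2 * k.+1%:R^-1))//; last by rewrite mulrC -ltr_pdivlMr.
  rewrite [leLHS]/Num.norm/= mx_normrE; apply/bigmax_leP => /=.
  split; first by rewrite mulr_ge0.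
  move=> [i j] _ /=; rewrite ord1 !mxE.
  have := xq j; have := yq j; rewrite /= => h1 h2.
  rewrite (le_trans (ler_distD (ratr (q ord0 j)) _ _))// mulr_natl mulr2n.
  by rewrite lerD ?ltW// distrC.
apply: countable_bigcupT_measurable => [|qk]; first exact: countableP.
rewrite /F; case: ifPn => // _; rewrite /box; apply: (measurable_box (A := fun i =>
  [set a | `|a - ratr (qk.1 ord0 i)| < qk.2.+1%:R^-1])) => i.
rewrite (_ : mkset _ = ball (ratr (qk.1 ord0 i) : R) (qk.2.+1%:R^-1)).
  exact: measurable_ball.
by apply/seteqP; split => a /=; rewrite /ball/= distrC.
Qed.

Lemma continuous_on_measurable_rV (U : set 'rV[R]_n) (f : 'rV[R]_n -> R) :
  open U -> (forall x, U x -> {for x, continuous f}) -> measurable_fun U f.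
Proof.
move=> oU fc; apply: (measurability _ (RGenOInfty.measurableE R)).
move=> _ [_ [x ->] <-]; apply: open_measurable_rV.
rewrite openE => y [Uy fy]; rewrite /interior.
have := fc y Uy; rewrite /prop_for /continuous_at => fyc.
have : nbhs (f y) `]x, +oo[%classic.
  by apply: open_nbhs_nbhs; split => //; exact: interval_open.
move/fyc => nf; near=> z; split.
  by near: z; apply: open_nbhs_nbhs.
by near: z.
Unshelve. all: by end_near. Qed.

Lemma continuous_measurable_rV (f : 'rV[R]_n -> R) :
  continuous f -> measurable_fun setT f.
Proof.
move=> fc; apply: continuous_on_measurable_rV; first exact: openT.
by move=> x _; exact: fc.
Qed.

Lemma measurable_enorm : measurable_fun setT (@enorm R 1 n).
Proof. by apply: continuous_measurable_rV; exact: enorm_continuous. Qed.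

End rV_borel.

(** * Invariance of Lebesgue measure under point reflections *)

Section reflection.
Context {R : realType}.
Local Open Scope ereal_scope.

(** Lebesgue measure is determined by half-open intervals, and the preimage of []a, b]] is [[c - b,
    c - a[], of the same length. Reflections suffice throughout: [c = 0] is the symmetry, and two of
    them compose to a translation. *)
Lemma lebesgue_measure_reflect (c : R) (A : set R) : measurable A ->
  lebesgue_measure ((fun x => c - x)%R @^-1` A) = lebesgue_measure A.
Proof.
move=> mA.
have mf : measurable_fun setT
    ((fun x => (c - x)%R) : measurableTypeR R -> measurableTypeR R).
  exact: measurable_funB.
pose mixin := isMeasurableFun.Build _ _ _ _ _ mf.
pose f : {mfun measurableTypeR R >-> measurableTypeR R} :=
  HB.pack (fun x : measurableTypeR R => (c - x)%R) mixin.
apply/esym; apply: (@lebesgue_measure_unique _ (pushforward lebesgue_measure f)) => //.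
move=> _ [[a b]] _ <-.
rewrite [RHS](_ : _ = lebesgue_measure
  ((fun x => c - x)%R @^-1` `]a, b]%classic)%R)//.
rewrite (_ : (fun x => c - x)%R @^-1` _ = `[c - b, c - a[%classic)%R; last first.
  apply/seteqP; split => x /=; rewrite !in_itv/= => /andP[h1 h2];
    by apply/andP; split; lra.
rewrite !lebesgue_measure_itv/= !lte_fin.
rewrite (_ : (c - b < c - a)%R = (a < b)%R); last by rewrite ltrD2l ltrN2.
by case: ifPn => // _; rewrite -!EFinB; congr EFin; ring.
Qed.

(** The pushforward by [T] agrees with the product measure on rectangles, hence everywhere by
    uniqueness of the product measure. *)
Lemma product_measure_preserving d1 d2 (T1 : measurableType d1)
    (T2 : measurableType d2) (m1 : {sigma_finite_measure set T1 -> \bar R})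
    (m2 : {sigma_finite_measure set T2 -> \bar R}) (T : T1 * T2 -> T1 * T2) :
    measurable_fun setT T ->
    (forall A B, measurable A -> measurable B ->
      (m1 \x m2) (T @^-1` (A `*` B)) = m1 A * m2 B) ->
  forall X, measurable X -> (m1 \x m2) (T @^-1` X) = (m1 \x m2) X.
Proof.
move=> mT TE X mX.
pose mixin := isMeasurableFun.Build _ _ _ _ _ mT.
pose f : {mfun (T1 * T2)%type >-> (T1 * T2)%type} := HB.pack T mixin.
apply/esym; exact: (@product_measure_unique _ _ _ _ _ _ _
  (pushforward (m1 \x m2) f) TE).
Qed.

Lemma measurable_reflect_rV n (c : 'rV[R]_n) :
  measurable_fun setT (fun x : 'rV[R]_n => (c - x)%R).
Proof.
apply: measurable_fun_rVP => i; under eq_fun do rewrite !mxE.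
apply: measurable_funB; first exact: measurable_cst.
exact: measurable_coord_rV.
Qed.

(** Induction on the dimension: through [cons_rV] the reflection acts separately on the first
    coordinate and on the remaining ones. *)
Lemma lebesgue_rV_reflect n (c : 'rV[R]_n) (A : set 'rV[R]_n) : measurable A ->
  lebesgue_rV n ((fun x => c - x)%R @^-1` A) = lebesgue_rV n A.
Proof.
elim: n c A => [|n IH] c A mA.
  congr (lebesgue_rV 0 _); apply/seteqP; split => x /=;
    by rewrite (flatmx0 (c - x)%R) (flatmx0 x) || rewrite thinmx0 (thinmx0 x).
pose c' : 'rV[R]_n := (\row_j c ord0 (lift ord0 j))%R.
rewrite /= /lebesgue_rV_step /pushforward.
have mT : measurable_fun setT (fun p : measurableTypeR R * 'rV[R]_n =>
    ((c ord0 ord0 - p.1)%R, (c' - p.2)%R) :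
    measurableTypeR R * 'rV[R]_n).
  apply: measurable_fun_pair.
    by apply: measurable_funB => //; exact: measurable_fst.
  exact: (measurableT_comp (measurable_reflect_rV _) measurable_snd).
pose T (p : measurableTypeR R * 'rV[R]_n) : measurableTypeR R * 'rV[R]_n :=
  ((c ord0 ord0 - p.1)%R, (c' - p.2)%R).
have mB : measurable (@cons_rV R n @^-1` A).
  by rewrite -[X in measurable X]setTI; exact: measurable_cons_rV.
rewrite -[RHS](product_measure_preserving (T := T) mT)//; last first.
  move=> A1 A2 mA1 mA2.
  rewrite (_ : T @^-1` _ = ((fun x => c ord0 ord0 - x)%R @^-1` A1) `*`
     ((fun x => c' - x)%R @^-1` A2))//.
  have m1 : measurable ((fun x => c ord0 ord0 - x)%R @^-1` A1 : set (measurableTypeR R)).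
    rewrite -[X in measurable X]setTI.
    by apply: (measurable_funB (measurable_cst _) (@measurable_id _ _ _)).
  have m2 : measurable ((fun x => c' - x)%R @^-1` A2).
    by rewrite -[X in measurable X]setTI; exact: measurable_reflect_rV.
  rewrite product_measure1E//; congr (_ * _); [exact: lebesgue_measure_reflect|exact: IH].
congr ((_ \x _) _); apply/seteqP; split => -[a v] /=;
  suff -> : (c - cons_rV (a, v))%R = cons_rV (T (a, v)) by [].
  by apply/rowP => i; rewrite !mxE; case: unliftP => [j|] ->; rewrite ?mxE.
by apply/rowP => i; rewrite !mxE; case: unliftP => [j|] ->; rewrite ?mxE.
Qed.

Lemma ge0_integral_reflect_rV n (c : 'rV[R]_n) (D : set 'rV[R]_n)
    (f : 'rV[R]_n -> \bar R) : measurable D -> measurable_fun D f ->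
    (forall x, D x -> 0 <= f x) ->
  \int[lebesgue_rV n]_(x in D) f x =
  \int[lebesgue_rV n]_(x in (fun x => c - x)%R @^-1` D) f (c - x)%R.
Proof.
move=> mD mf f0.
rewrite -(ge0_integral_pushforward (measurable_reflect_rV c))//; last first.
  by move=> x /set_mem; exact: f0.
apply: eq_measure_integral => /= [|mphi A mA _].
  exact: measurable_reflect_rV.
by rewrite -(lebesgue_rV_reflect c mA).
Qed.

Lemma integral_reflect_rV n (c : 'rV[R]_n) (D : set 'rV[R]_n)
    (f : 'rV[R]_n -> \bar R) : measurable D -> measurable_fun D f ->
  \int[lebesgue_rV n]_(x in D) f x =
  \int[lebesgue_rV n]_(x in (fun x => c - x)%R @^-1` D) f (c - x)%R.
Proof.
move=> mD mf; rewrite integralE [RHS]integralE; congr (_ - _).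
  rewrite (ge0_integral_reflect_rV c mD (measurable_funepos mf)) => [|x _].
    by apply: eq_integral => x _; rewrite !funeposE.
  exact: funepos_ge0.
rewrite (ge0_integral_reflect_rV c mD (measurable_funeneg mf)) => [|x _].
  by apply: eq_integral => x _; rewrite !funenegE.
exact: funeneg_ge0.
Qed.

End reflection.

(** * Dyadic bounds for integrals of powers of the norm *)

Section radial_integrals.
Context {R : realType} {n : nat}.
Local Notation mu := (@lebesgue_rV R n).

Lemma measurable_enorm_lt (r : R) : measurable [set v : 'rV[R]_n | enorm v < r].
Proof. by apply: open_measurable_rV; exact: open_eball. Qed.

Lemma measurable_enorm_ge (r : R) : measurable [set v : 'rV[R]_n | r <= enorm v].
Proof.
rewrite (_ : mkset _ = ~` [set v : 'rV[R]_n | enorm v < r]).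
  by apply: measurableC; exact: measurable_enorm_lt.
by apply/seteqP; split => v /=; rewrite leNgt => /negP.
Qed.

Lemma measurable_enorm_gt (r : R) : measurable [set v : 'rV[R]_n | r < enorm v].
Proof.
rewrite -[X in measurable X]setTI (_ : mkset _ = @enorm R 1 n @^-1` `]r, +oo[).
  by apply: measurable_enorm => //; exact: measurable_itv.
by apply/seteqP; split => v /=; rewrite in_itv/= andbT.
Qed.

Lemma lebesgue_rV_cube (a b : R) : a <= b ->
  mu [set x | forall i, `[a, b]%classic (x ord0 i)] = ((b - a) ^+ n)%:E.
Proof.
move=> ab; rewrite (@lebesgue_rV_box R n (fun=> `[a, b]%classic))//.
rewrite (eq_bigr (fun=> (b - a)%:E)); last first.
  move=> i _; rewrite lebesgue_measure_itv/= lte_fin; case: ltP => // ba.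
  by rewrite (_ : b = a) ?subrr//; apply/eqP; rewrite eq_le ab ba.
by rewrite prodEFin prodr_const card_ord.
Qed.

(* Dominating [f] by a sum over nested cubes, rather than over disjoint dyadic
   annuli, makes disjointness irrelevant. *)
Lemma integral_le_geometric (D : set 'rV[R]_n) (f : 'rV[R]_n -> \bar R)
    (rad coef : nat -> R) (c q : R) :
    measurable D -> measurable_fun D f -> (forall v, D v -> 0 <= f v)%E ->
    (forall k, 0 <= rad k) -> (forall k, 0 <= coef k) -> 0 <= q < 1 ->
    (forall v, D v -> exists2 k, enorm v <= rad k & (f v <= (coef k)%:E)%E) ->
    (forall k, coef k * (2 * rad k) ^+ n <= c * q ^+ k) ->
  (\int[mu]_(v in D) f v <= (c / (1 - q))%:E)%E.
Proof.
move=> mD mf f0 rad0 coef0 /andP[q0 q1] cover bound.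
pose cube k := [set x : 'rV[R]_n | forall i, `[- rad k, rad k]%classic (x ord0 i)].
have mcube k : measurable (cube k).
  exact: (@measurable_box R n (fun=> `[- rad k, rad k]%classic)).
pose g k v := (coef k * \1_(cube k) v)%:E.
have g0 k v : (0 <= g k v)%E by rewrite lee_fin mulr_ge0.
have mg k : measurable_fun D (g k).
  by apply/measurable_EFinP; apply: measurable_funM.
have ig k : (\int[mu]_(v in D) g k v <= (c * q ^+ k)%:E)%E.
  apply: (@le_trans _ _ (\int[mu]_v g k v)%E).
    by apply: ge0_subset_integral => //; apply/measurable_EFinP; apply: measurable_funM.
  rewrite /g; under eq_integral do rewrite EFinM.
  rewrite ge0_integralZl_EFin//; last by apply/measurable_EFinP.
  have mcubeE : mu (cube k) = ((rad k - - rad k) ^+ n)%:E.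
    by apply: lebesgue_rV_cube; rewrite (@le_trans _ _ 0)// oppr_le0.
  rewrite integral_indic// setIT [X in (_ * X)%E]mcubeE.
  by rewrite opprK -mulr2n -mulr_natl -EFinM lee_fin.
apply: (@le_trans _ _ (\int[mu]_(v in D) (\sum_(0 <= k <oo) g k v))%E).
  apply: ge0_le_integral => //.
    by apply: ge0_emeasurable_sum => //.
  move=> v Dv; have [k vk fk] := cover v Dv.
  apply: (le_trans fk); apply: (@le_trans _ _ (g k v)).
    rewrite lee_fin indicE mem_set ?mulr1//= => i.
    by rewrite /= in_itv/= -ler_norml (le_trans (coord_le_enorm _ _)).
  apply: (@le_trans _ _ (\sum_(0 <= j < k.+1) g j v)%E).
    by rewrite big_nat_recr//= leeDr// sume_ge0.
  exact: nneseries_lim_ge.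
rewrite integral_nneseries//.
apply: (@le_trans _ _ (\sum_(0 <= k <oo) (c * q ^+ k)%:E)%E).
  by apply: lee_nneseries => // k _ _; apply: integral_ge0 => v _.
have q1' : `|q| < 1 by rewrite ger0_norm.
rewrite (_ : (fun m => _) = EFin \o series (geometric c q)).
  rewrite EFin_lim; last exact: is_cvg_geometric_series.
  by rewrite lee_fin (cvg_lim _ (cvg_geometric_series q1')).
by apply/funext => m /=; rewrite sumEFin.
Qed.

End radial_integrals.

Section power_kernel.
Context {R : realType} {n : nat}.
Local Notation mu := (@lebesgue_rV R n).
Variable s : R.

Definition power_kernel (v : 'rV[R]_n) : R := enorm v `^ (- n%:R - 2 * s).

Lemma power_kernel_ge0 v : 0 <= power_kernel v.
Proof. exact: powR_ge0. Qed.

Lemma measurable_power_kernel (D : set 'rV[R]_n) : measurable_fun D power_kernel.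
Proof.
apply: measurable_funTS; apply: (measurableT_comp (measurable_powR _)).
exact: measurable_enorm.
Qed.

Lemma powR_dim (a : R) : 0 < a -> a `^ (- n%:R - 2 * s) * a ^+ n = a `^ (- 2 * s).
Proof.
move=> a0; rewrite -powR_mulrn ?ltW// -powRD; last by rewrite (gt_eqF a0) implybT.
by congr (_ `^ _); ring.
Qed.

Lemma powR_decr (a b p : R) : 0 < a -> a <= b -> 0 <= p -> b `^ (- p) <= a `^ (- p).
Proof.
move=> a0 ab p0; have b0 := lt_le_trans a0 ab.
by rewrite !powRN lef_pV2 ?posrE ?powR_gt0// ge0_ler_powR ?nnegrE ?(ltW a0) ?(ltW b0).
Qed.

Lemma powR2N_lt1 (p : R) : 0 < p -> 2 `^ (- p) < 1 :> R.
Proof.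
move=> p0; rewrite powRN invf_lt1 ?powR_gt0//.
rewrite -[ltLHS](_ : 1 `^ p = 1); last by rewrite powR1.
by rewrite gt0_ltr_powR ?nnegrE// ltr1n.
Qed.

Lemma power_kernel_decr (a b : R) : 0 <= s -> 0 < a -> a <= b ->
  b `^ (- n%:R - 2 * s) <= a `^ (- n%:R - 2 * s).
Proof.
by move=> s0 a0 ab; rewrite -opprD powR_decr// addr_ge0// mulr_ge0.
Qed.

Lemma powR2_expn (p : R) k : (2 ^+ k) `^ p = (2 `^ p) ^+ k :> R.
Proof.
elim: k => [|k IH]; first by rewrite !expr0 powR1.
by rewrite !exprS powRM ?ler0n ?exprn_ge0 ?ler0n// IH.
Qed.

Lemma exists_pow2_gt (a : R) : exists k, a < 2 ^+ k.
Proof.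
have [a0|a0] := leP a 0; first by exists 0%N; rewrite expr0 (le_lt_trans a0).
exists (Num.bound a); apply: (@lt_trans _ _ (Num.bound a)%:R).
  by have := archi_boundP (ltW a0).
by rewrite -natrX ltr_nat ltn_expl.
Qed.

(** With [a = 2^k r], the shell [a <= |v| <= 2a] lies in a cube of side [4a], whence [4 ^+ n]; the
    shells contribute a geometric series of ratio [2^(-2s)]. *)
Definition tail_const : R := 4 ^+ n / (1 - 2 `^ (- 2 * s)).

Lemma integral_power_kernel_tail (r : R) : 0 < s -> 0 < r ->
  (\int[mu]_(v in [set v | (r <= enorm v)%R]) (power_kernel v)%:E
    <= (tail_const * r `^ (- 2 * s))%:E)%E.
Proof.
move=> s0 r0.
rewrite /tail_const mulrAC.
apply: (@integral_le_geometric _ _ _ _ (fun k => 2 * (2 ^+ k * r))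
  (fun k => (2 ^+ k * r) `^ (- n%:R - 2 * s))).
- exact: measurable_enorm_ge.
- by apply/measurable_EFinP; exact: measurable_power_kernel.
- by move=> v _; rewrite lee_fin power_kernel_ge0.
- by move=> k; rewrite !mulr_ge0// ltW.
- by move=> k; exact: powR_ge0.
- by rewrite powR_ge0/= mulNr powR2N_lt1 ?mulr_gt0.
- move=> v /= rv.
  have kP : exists k, enorm v <= 2 * (2 ^+ k * r).
    have [k] := exists_pow2_gt (enorm v / r); rewrite ltr_pdivrMr// => vk.
    by exists k; rewrite (le_trans (ltW vk))// ler_peMl ?ler1n// mulr_ge0// ltW.
  (* Minimality of [k] puts [v] outside the ball of radius [2^k r], where the kernel is at most its
     value at that radius; for [k = 0] this is [r <= enorm v]. *)
  have [k kv kmin] := ex_minnP kP; exists k => //.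
  rewrite lee_fin power_kernel_decr ?(ltW s0) ?mulr_gt0 ?exprn_gt0//.
  case: k kv kmin => [|k] _ kmin; first by rewrite expr0 mul1r.
  rewrite leNgt; apply/negP => /ltW vk.
  have /kmin : enorm v <= 2 * (2 ^+ k * r) by rewrite mulrA -exprS.
  by rewrite ltnn.
move=> k; have a0 : 0 < 2 ^+ k * r by rewrite mulr_gt0 ?exprn_gt0.
rewrite mulrA -natrM exprMn mulrCA powR_dim// powRM ?(ltW r0) ?exprn_ge0//.
by rewrite powR2_expn [(2 `^ _ ^+ k) * _]mulrC mulrA.
Qed.

(** Here the shells are [a / 2 <= |v| <= a] with [a = r / 2^k]. The kernel is taken at [a / 2]: the
    cube side [2a = 4 (a / 2)] gives [4 ^+ n], and [(a / 2)^(-2s)] gives [2^(2s)]. The factor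
    [|v|^2] turns the ratio into [2^(-(2-2s))]. *)
Definition near_const : R := 4 ^+ n * 2 `^ (2 * s) / (1 - 2 `^ (- (2 - 2 * s))).

Lemma integral_power_kernel_near (r : R) : 0 <= s -> s < 1 -> 0 < r ->
  (\int[mu]_(v in [set v | (enorm v < r)%R]) (enorm v ^+ 2 * power_kernel v)%:E
    <= (near_const * r `^ (2 - 2 * s))%:E)%E.
Proof.
move=> s0 s1 r0.
rewrite /near_const mulrAC.
apply: (@integral_le_geometric _ _ _ _ (fun k => r / 2 ^+ k)
  (fun k => (r / 2 ^+ k) ^+ 2 * (r / 2 ^+ k / 2) `^ (- n%:R - 2 * s))).
- exact: measurable_enorm_lt.
- apply/measurable_EFinP; apply: measurable_funM.
    apply: measurable_funX; apply: measurable_funTS; exact: measurable_enorm.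
  exact: measurable_power_kernel.
- by move=> v _; rewrite lee_fin mulr_ge0 ?power_kernel_ge0 ?exprn_ge0 ?enorm_ge0.
- by move=> k; rewrite divr_ge0// ltW.
- by move=> k; rewrite mulr_ge0 ?powR_ge0// sqr_ge0.
- by rewrite powR_ge0/= powR2N_lt1//; lra.
(* The origin belongs to no shell, but the integrand vanishes there. *)
- move=> v /= rv; have [->|v0] := eqVneq v 0.
    exists 0%N; first by rewrite enorm0 divr_ge0// ltW.
    by rewrite enorm0 expr0n mul0r lee_fin mulr_ge0 ?powR_ge0// sqr_ge0.
  have {}v0 : 0 < enorm v by rewrite enorm_gt0.
  have kP : exists k, r / 2 ^+ k / 2 <= enorm v.
    have [k] := exists_pow2_gt (r / enorm v); rewrite ltr_pdivrMr// => vk.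
    exists k; rewrite -mulrA -invfM ler_pdivrMr ?mulr_gt0 ?exprn_gt0//.
    rewrite (le_trans (ltW vk))// [leRHS]mulrC ler_pM2r//.
    by rewrite ler_peMr ?ler1n// exprn_ge0.
  have [k kv kmin] := ex_minnP kP; exists k.
    case: k kv kmin => [|k] _ kmin; first by rewrite expr0 divr1 ltW.
    rewrite leNgt; apply/negP => /ltW vk.
    have /kmin : r / 2 ^+ k / 2 <= enorm v by rewrite -mulrA -invfM -exprSr.
    by rewrite ltnn.
  have vk : enorm v <= r / 2 ^+ k.
    case: k kv kmin => [|k] _ kmin; first by rewrite expr0 divr1 ltW.
    rewrite leNgt; apply/negP => /ltW vk.
    have /kmin : r / 2 ^+ k / 2 <= enorm v by rewrite -mulrA -invfM -exprSr.
    by rewrite ltnn.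
  have rk0 : 0 < r / 2 ^+ k by rewrite divr_gt0 ?exprn_gt0.
  rewrite lee_fin ler_pM ?sqr_ge0 ?power_kernel_ge0//.
    by rewrite ler_pXn2r ?nnegrE ?enorm_ge0 ?(ltW rk0).
  by rewrite power_kernel_decr// divr_gt0.
move=> k; have a0 : 0 < r / 2 ^+ k by rewrite divr_gt0 ?exprn_gt0.
have [a aE] : exists a, a = r / 2 ^+ k by exists (r / 2 ^+ k).
rewrite -aE in a0 *.
have -> : 2 * a = 4 * (a / 2) by field.
have -> : a ^+ 2 * (a / 2) `^ (- n%:R - 2 * s) * (4 * (a / 2)) ^+ n =
    4 ^+ n * (a ^+ 2 * ((a / 2) `^ (- n%:R - 2 * s) * (a / 2) ^+ n)).
  rewrite [(4 * _) ^+ n]exprMn.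
  by move: (_ `^ _) ((a / 2) ^+ n) (4 ^+ n) (a ^+ 2) => x y z w; ring.
rewrite powR_dim; last by rewrite divr_gt0.
rewrite powRM ?(ltW a0) ?invr_ge0//.
have -> : 2^-1 `^ (- 2 * s) = 2 `^ (2 * s) :> R.
  by rewrite -powR_inv1// -powRrM; congr (_ `^ _); ring.
rewrite -!mulrA ler_wpM2l ?exprn_ge0//.
have -> : a * (a * (a `^ (- 2 * s) * 2 `^ (2 * s))) = 2 `^ (2 * s) * a `^ (2 - 2 * s).
  rewrite powRD ?(gt_eqF a0) ?implybT// powR_mulrn ?(ltW a0)// mulNr.
  by ring.
rewrite ler_wpM2l ?powR_ge0//.
rewrite aE powRM ?invr_ge0 ?(ltW r0)// ?exprn_ge0// ler_wpM2l ?powR_ge0//.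
by rewrite -powR_inv1 ?exprn_ge0// -powRrM mulN1r powR2_expn.
Qed.

Lemma tail_const_gt0 : 0 < s -> 0 < tail_const.
Proof.
move=> s0; rewrite divr_gt0 ?exprn_gt0// subr_gt0 mulNr.
by rewrite powR2N_lt1 ?mulr_gt0.
Qed.

End power_kernel.

(** * Kernel differences *)

Section mean_value.
Context {R : realType} {n : nat}.
Implicit Types (f : 'rV[R]_n -> R) (p h x : 'rV[R]_n).

Lemma derive_dot_grad f x h : differentiable f x -> 'D_h f x = dot (grad f x) h.
Proof.
move=> df; rewrite deriveE// [in LHS](row_sum_delta h) linear_sum.
apply: eq_bigr => i _; rewrite linearZ /= -deriveE// mxE.
by rewrite [LHS]mulrC.
Qed.

Lemma is_derive_line f p h (t : R) : differentiable f (p + t *: h) ->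
  is_derive t 1 (fun t : R => f (p + t *: h)) (dot (grad f (p + t *: h)) h).
Proof.
move=> df.
have E : (fun e : R => e^-1 *: (((fun t => f (p + t *: h)) \o shift t) (e *: 1) -
    f (p + t *: h))) = (fun e => e^-1 *: ((f \o shift (p + t *: h)) (e *: h) -
    f (p + t *: h))).
  apply/funext => e /=; congr (_ *: (f _ - _)).
  by rewrite /shift/= scalerDl [e *: 1]mulr1 addrCA addrC.
apply: DeriveDef; first by rewrite /derivable E; exact: diff_derivable.
by rewrite /derive E -derive_dot_grad.
Qed.

Lemma MVT_is_derive (g dg : R -> R) (a b : R) : a <= b ->
  (forall t, a <= t <= b -> is_derive t 1 g (dg t)) ->
  exists2 c, a <= c <= b & g b - g a = dg c * (b - a).
Proof.
move=> ab gd; have [c cab E] : exists2 c, c \in `[a, b] & g b - g a = dg c * (b - a).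
  apply: MVT_segment => //.
    by move=> t; rewrite in_itv/= => /andP[h1 h2]; apply: gd; rewrite !ltW.
  apply: derivable_within_continuous => t; rewrite in_itv/= => /gd gt.
  exact: ex_derive.
by exists c => //; move: cab; rewrite in_itv.
Qed.

Lemma MVT_line f p h (B : R) :
  (forall t, 0 <= t <= 1 -> differentiable f (p + t *: h)) ->
  (forall t, 0 <= t <= 1 -> enorm (grad f (p + t *: h)) <= B) ->
  `|f (p + h) - f p| <= B * enorm h.
Proof.
move=> df gB.
have [c c01] := @MVT_is_derive (fun t => f (p + t *: h)) _ 0 1 ler01
  (fun t t01 => is_derive_line (df t t01)).
rewrite scale1r scale0r addr0 subr0 mulr1 => ->.
by rewrite (le_trans (normr_dot _ _))// ler_wpM2r ?enorm_ge0// gB.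
Qed.

(** Cauchy-Schwarz against [x], then on each column of [A]; summing the squared column norms
    produces the Frobenius norm. *)
Lemma bilinear_le_enorm (A : 'M[R]_n) (x y : 'rV[R]_n) :
  `|\sum_j x ord0 j * (\sum_i A i j * y ord0 i)| <= enorm x * (enorm A * enorm y).
Proof.
pose c j : 'rV[R]_n := \row_i A i j; pose Ay : 'rV[R]_n := \row_j dot (c j) y.
have -> : \sum_j x ord0 j * (\sum_i A i j * y ord0 i) = dot x Ay.
  apply: eq_bigr => j _; rewrite mxE; congr (_ * _).
  by apply: eq_bigr => i _; rewrite mxE.
rewrite (le_trans (normr_dot _ _))// ler_wpM2l ?enorm_ge0//.
have A0 : 0 <= enorm A := sqrtr_ge0 _.
rewrite -(ler_pXn2r (ltn0Sn 1)) ?nnegrE ?mulr_ge0 ?enorm_ge0//.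
rewrite exprMn enorm_sqr [enorm A]/enorm sqr_sqrtr; last first.
  by apply: sumr_ge0 => i _; apply: sumr_ge0 => j _; exact: sqr_ge0.
rewrite exchange_big /dot mulr_suml; apply: ler_sum => j _; rewrite mxE -expr2.
have -> : \sum_i A i j ^+ 2 = enorm (c j) ^+ 2.
  by rewrite enorm_sqr; apply: eq_bigr => i _; rewrite mxE expr2.
rewrite -exprMn -(real_normK (num_real (dot _ _))).
by rewrite ler_pXn2r ?nnegrE ?mulr_ge0 ?enorm_ge0// normr_dot.
Qed.

(** The mean value theorem is applied twice: to the even part [f (p + t h) + f (p - t h)] on
    [[0, 1]], which gives a point [c], then to the directional derivative on [[-c, c]]. The factor 2
    bounds the length of that interval. *)
Lemma second_difference_le f p h (B : R) :
  (forall t, `|t| <= 1 -> twice_differentiable f (p + t *: h)) ->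
  (forall t, `|t| <= 1 -> enorm (hess f (p + t *: h)) <= B) ->
  `|f (p + h) + f (p - h) - 2 * f p| <= 2 * B * enorm h ^+ 2.
Proof.
move=> df hB.
pose g t := f (p + t *: h); pose g' t := dot (grad f (p + t *: h)) h.
pose g'' t := \sum_j h ord0 j * (\sum_i hess f (p + t *: h) i j * h ord0 i).
have gd (t : R) : `|t| <= 1 -> is_derive t (1 : R) g (g' t).
  by move=> /df[df1 _]; exact: is_derive_line.
have gd' (t : R) : `|t| <= 1 -> is_derive t (1 : R) g' (g'' t).
  move=> t1; have [_ dgrad] := df _ t1.
  have dcoord j : differentiable ('D_(delta_mx ord0 j) f) (p + t *: h).
    rewrite (_ : 'D_(delta_mx ord0 j) f =
      (fun M : 'rV[R]_n => M ord0 j) \o grad f).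
      by apply: differentiable_comp => //; exact: differentiable_coord.
    by apply/funext => x /=; rewrite mxE.
  have {}dcoord j := is_derive_line (dcoord j).
  rewrite (_ : g' = \sum_j (h ord0 j \*: (fun t : R =>
      'D_(delta_mx ord0 j) f (p + t *: h)))); last first.
    apply/funext => x; rewrite /g' /dot fct_sumE; apply: eq_bigr => j _.
    by rewrite mxE mulrC.
  apply: is_derive_sum => j.
  apply: (is_derive_eq (is_deriveZ (h ord0 j) (dcoord j))).
  congr (_ * _); apply: eq_bigr => i _.
  by rewrite !mxE.
have Gd (t : R) : 0 <= t <= 1 -> is_derive t (1 : R)
    (g + (fun t : R => f (p + t *: - h))) (g' t - g' (- t)).
  move=> /andP[t0 t1]; have t1' : `|t| <= 1 by rewrite ger0_norm.
  apply: is_derive_eq.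
    apply: is_deriveD; first exact: gd.
    apply: is_derive_line; rewrite scalerN -scaleNr.
    by have [] := df (- t); rewrite ?normrN.
  by rewrite /= scalerN -scaleNr dotNr.
have [c /andP[c0 c1]] := MVT_is_derive ler01 Gd.
rewrite !fctE /g !scale1r !scale0r addr0 subr0 mulr1.
have cc : - c <= c by rewrite (@le_trans _ _ 0)// oppr_le0.
have gdc (t : R) : - c <= t <= c -> is_derive t (1 : R) g' (g'' t).
  by move=> tc; apply: gd'; rewrite (le_trans _ c1)// ler_norml.
have [d /andP[d1 d2]] := MVT_is_derive cc gdc.
move=> -> E.
have -> : f (p + h) + f (p - h) - 2 * f p = g'' d * (c - - c) by rewrite -E; ring.
have d1' : `|d| <= 1 by rewrite ler_norml; apply/andP; split; lra.
have c2 : 0 <= c - - c by lra.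
rewrite normrM (ger0_norm c2) mulrC -[leRHS]mulrA ler_pM//; first lra.
rewrite (le_trans (bilinear_le_enorm _ _ _))// mulrCA -expr2.
by rewrite ler_wpM2r ?sqr_ge0// hB.
Qed.

End mean_value.

Section kernel_bounds.
Context {R : realType} {n : nat}.
Variables (s lam Lam : R) (K : 'rV[R]_n -> \bar R).
Hypotheses (s0 : 0 <= s) (lam0 : 0 < lam) (lamLam : lam <= Lam).
Hypothesis hK : kernel_class s lam Lam K.

Local Notation k := (fine \o K).
Local Notation pk := (power_kernel s).

Let Lam0 : 0 < Lam. Proof. exact: lt_le_trans lamLam. Qed.

Lemma kernel_fin (y : 'rV[R]_n) : y != 0 -> K y = (k y)%:E.
Proof.
move=> y0; rewrite fineK// ge0_fin_numE ?(kernel_ge0 hK)//.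
exact: le_lt_trans (kernel_upper hK y0) (ltry _).
Qed.

Lemma kernel_fin_ge0 (y : 'rV[R]_n) : 0 <= k y.
Proof. by rewrite fine_ge0// (kernel_ge0 hK). Qed.

Lemma kernel_finN (y : 'rV[R]_n) : k (- y) = k y.
Proof. by rewrite /= (kernel_sym hK). Qed.

Lemma kernel_fin_lower (y : 'rV[R]_n) : y != 0 -> lam * pk y <= k y.
Proof. by move=> y0; rewrite -lee_fin -kernel_fin//; exact: (kernel_lower hK). Qed.

Lemma kernel_fin_upper (y : 'rV[R]_n) : y != 0 -> k y <= Lam * pk y.
Proof. by move=> y0; rewrite -lee_fin -kernel_fin//; exact: (kernel_upper hK). Qed.

(** Measurability is not part of the kernel class; it is recovered from continuity off the origin,
    itself a consequence of differentiability there. *)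
Lemma measurable_jump_kernel : measurable_fun [set y : 'rV[R]_n | 0 < enorm y] k.
Proof.
apply: continuous_on_measurable_rV => [|y /=].
  rewrite (_ : mkset _ = @enorm R 1 n @^-1` [set a | 0 < a])//.
  apply: open_comp; last exact: open_gt.
  by move=> y _; exact: enorm_continuous.
rewrite enorm_gt0 => y0; have [dk _] := kernel_diff hK y0.
exact: differentiable_continuous.
Qed.

(** Keeps the whole segment along which the mean value theorem is applied away from the singularity,
    at a distance comparable to [enorm p]. *)
Lemma line_far (p h : 'rV[R]_n) (t : R) : p != 0 -> enorm h <= enorm p / 2 ->
  `|t| <= 1 -> enorm p / 2 <= enorm (p + t *: h).
Proof.
move=> p0 hp t1; rewrite (le_trans _ (enorm_lerB _ _))// enormZ.
rewrite lerBrDr -lerBrDl (le_trans (ler_piMl (enorm_ge0 _) t1))//.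
by rewrite (le_trans hp)//; lra.
Qed.

Lemma line_neq0 (p h : 'rV[R]_n) (t : R) : p != 0 -> enorm h <= enorm p / 2 ->
  `|t| <= 1 -> p + t *: h != 0.
Proof.
move=> p0 hp t1; rewrite -enorm_gt0 (lt_le_trans _ (line_far p0 hp t1))//.
by rewrite divr_gt0// enorm_gt0.
Qed.

Lemma kernel_upper_far (p q : 'rV[R]_n) : p != 0 -> enorm p / 2 <= enorm q ->
  k q <= Lam * (enorm p / 2) `^ (- n%:R - 2 * s).
Proof.
move=> p0 pq; have p2 : 0 < enorm p / 2 by rewrite divr_gt0// enorm_gt0.
have q0 : q != 0 by rewrite -enorm_gt0 (lt_le_trans p2).
by rewrite (le_trans (kernel_fin_upper q0))// ler_wpM2l ?power_kernel_decr// ltW.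
Qed.

(** One factor [Lam] comes from the gradient bound, the other from the upper bound on the kernel,
    both used at distance at least [enorm p / 2] from the origin. *)
Lemma kernel_first_difference (p h : 'rV[R]_n) : p != 0 -> enorm h <= enorm p / 2 ->
  `|k (p + h) - k p| <=
  Lam ^+ 2 * (enorm p / 2)^-1 * (enorm p / 2) `^ (- n%:R - 2 * s) * enorm h.
Proof.
move=> p0 hp; have p2 : 0 < enorm p / 2 by rewrite divr_gt0// enorm_gt0.
apply: MVT_line => t /andP[t0 t1]; have {t0}t1 : `|t| <= 1 by rewrite ger0_norm.
  by have [] := kernel_diff hK (line_neq0 p0 hp t1).
have far := line_far p0 hp t1.
rewrite (le_trans (kernel_grad hK (line_neq0 p0 hp t1)))//.
rewrite expr2 -!mulrA ler_wpM2l ?(ltW Lam0)// mulrCA.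
apply: ler_pM; rewrite ?invr_ge0 ?enorm_ge0 ?kernel_fin_ge0//.
  by rewrite lef_pV2 ?posrE// (lt_le_trans p2).
exact: kernel_upper_far.
Qed.

Lemma kernel_second_difference (p h : 'rV[R]_n) : p != 0 -> enorm h <= enorm p / 2 ->
  `|k (p + h) + k (p - h) - 2 * k p| <=
  2 * (Lam ^+ 2 * (enorm p / 2) ^- 2 * (enorm p / 2) `^ (- n%:R - 2 * s)) *
  enorm h ^+ 2.
Proof.
move=> p0 hp; have p2 : 0 < enorm p / 2 by rewrite divr_gt0// enorm_gt0.
apply: second_difference_le => t t1.
  exact: (kernel_diff hK (line_neq0 p0 hp t1)).
have far := line_far p0 hp t1.
rewrite (le_trans (kernel_hess hK (line_neq0 p0 hp t1)))//.
rewrite [Lam ^+ 2]expr2 -!mulrA ler_wpM2l ?(ltW Lam0)// mulrCA.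
apply: ler_pM; rewrite ?invr_ge0 ?exprn_ge0 ?enorm_ge0 ?kernel_fin_ge0//.
  rewrite lef_pV2 ?posrE ?exprn_gt0// ?(lt_le_trans p2)//.
  by rewrite ler_pXn2r ?nnegrE ?enorm_ge0// ltW.
exact: kernel_upper_far.
Qed.

End kernel_bounds.

(** * A cutoff with controlled second differences *)

Section cutoff.
Context {R : realType}.
Implicit Types a b t : R.

Definition pos_sqr t : R := Num.max t 0 ^+ 2.

(** The derivative [2 max(a, 0)] is 2-Lipschitz, so the first-order remainder is at most the squared
    increment. *)
Lemma pos_sqr_taylor a b :
  `|pos_sqr b - pos_sqr a - 2 * Num.max a 0 * (b - a)| <= (b - a) ^+ 2.
Proof.
rewrite /pos_sqr; case: (leP a 0) => a0; case: (leP b 0) => b0;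
  rewrite ler_norml ?expr0n/=; have := sqr_ge0 (b - a) => ?; apply/andP; split; nra.
Qed.

(* A C^{1,1} step: [0] below [1], [1] above [2]. *)
Definition cutoff t : R :=
  2 * (pos_sqr (t - 1) - 2 * pos_sqr (t - 3 / 2) + pos_sqr (t - 2)).

Lemma cutoff_eq0 t : t <= 1 -> cutoff t = 0.
Proof.
move=> t1; rewrite /cutoff /pos_sqr !max_r; [|lra..].
by rewrite expr0n/=; ring.
Qed.

Lemma cutoff_eq1 t : 2 <= t -> cutoff t = 1.
Proof. by move=> t2; rewrite /cutoff /pos_sqr !max_l; [field|lra..]. Qed.

Lemma cutoff_ge0 t : 0 <= cutoff t.
Proof.
rewrite /cutoff /pos_sqr; case: (leP (t - 1) 0) => ?; case: (leP (t - 3 / 2) 0) => ?;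
  case: (leP (t - 2) 0) => ?; nra.
Qed.

Lemma cutoff_le1 t : cutoff t <= 1.
Proof.
rewrite /cutoff /pos_sqr; case: (leP (t - 1) 0) => ?; case: (leP (t - 3 / 2) 0) => ?;
  case: (leP (t - 2) 0) => ?; nra.
Qed.

(** [d] is the derivative at [a], a tent supported on [[1, 2]] with height 2 at [3/2]. The remainder
    constant is [2 (1 + 2 + 1)], from the coefficients of the three squares. This expansion replaces
    a second derivative, which fails to exist at the knots. *)
Lemma cutoff_taylor a : exists2 d, 0 <= d <= 2 &
  forall b, `|cutoff b - cutoff a - d * (b - a)| <= 8 * (b - a) ^+ 2.
Proof.
exists (4 * (Num.max (a - 1) 0 - 2 * Num.max (a - 3 / 2) 0 + Num.max (a - 2) 0)).
  case: (leP (a - 1) 0) => ?; case: (leP (a - 3 / 2) 0) => ?;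
  case: (leP (a - 2) 0) => ?; apply/andP; split; lra.
move=> b; rewrite /cutoff.
have := pos_sqr_taylor (a - 1) (b - 1).
have := pos_sqr_taylor (a - 3 / 2) (b - 3 / 2).
have := pos_sqr_taylor (a - 2) (b - 2).
have E c : b - c - (a - c) = b - a by ring.
rewrite !E !ler_norml => /andP[? ?] /andP[? ?] /andP[? ?].
by apply/andP; split; lra.
Qed.

Lemma measurable_cutoff : measurable_fun setT cutoff.
Proof.
have mp c : measurable_fun setT (fun t : R => pos_sqr (t - c)).
  apply: measurable_funX; apply: measurable_maxr => //.
  exact: measurable_funB.
apply: measurable_funM => //; apply: measurable_funD => //.
by apply: measurable_funB => //; apply: measurable_funM.
Qed.

End cutoff.

Section radial_cutoff.
Context {R : realType} {n : nat}.
Variable r : R.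
Implicit Types v h : 'rV[R]_n.

(** The squared norm makes the argument a polynomial in [v], so that its increments are computed
    exactly. *)
Definition radial_cutoff v : R := cutoff (enorm v ^+ 2 / r ^+ 2).

Lemma radial_cutoff_eq0 v : 0 < r -> enorm v <= r -> radial_cutoff v = 0.
Proof.
move=> r0 vr; apply: cutoff_eq0; rewrite ler_pdivrMr ?exprn_gt0// mul1r.
by rewrite ler_pXn2r ?nnegrE ?enorm_ge0// ltW.
Qed.

Lemma radial_cutoff_eq1 v : 0 < r -> 2 * r <= enorm v -> radial_cutoff v = 1.
Proof.
move=> r0 vr; apply: cutoff_eq1; rewrite ler_pdivlMr ?exprn_gt0//.
have : (2 * r) ^+ 2 <= enorm v ^+ 2.
  by rewrite ler_pXn2r ?nnegrE ?enorm_ge0// mulr_ge0// ltW.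
by have := sqr_ge0 r; rewrite exprMn; lra.
Qed.

Lemma radial_cutoff_arg v h : enorm (v + h) ^+ 2 / r ^+ 2 =
  enorm v ^+ 2 / r ^+ 2 + (2 * (dot v h / r ^+ 2) + (enorm h / r) ^+ 2).
Proof.
rewrite expr_div_n !enorm_sqr dotDl !dotDr (dotC h v).
move: (r ^+ 2) (dot v v) (dot v h) (dot h h) => q a b c; ring.
Qed.

Lemma radial_cutoff_arg_le v h : 0 < r -> enorm v <= 3 * r -> enorm h <= r / 8 ->
  `|dot v h / r ^+ 2| <= 3 * (enorm h / r) /\ (enorm h / r) ^+ 2 <= enorm h / r / 8.
Proof.
move=> r0 vr hr; have r20 : 0 < r ^+ 2 by rewrite exprn_gt0.
have h0 := enorm_ge0 h; split.
  rewrite normrM (ger0_norm (_ : 0 <= (r ^+ 2)^-1)); last first.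
    by rewrite invr_ge0 ltW.
  rewrite ler_pdivrMr// (le_trans (normr_dot v h))//.
  have -> : 3 * (enorm h / r) * r ^+ 2 = 3 * r * enorm h.
    by field; rewrite gt_eqF.
  by rewrite ler_wpM2r.
rewrite expr2 ler_wpM2l ?divr_ge0 ?(ltW r0)//.
by rewrite ler_pdivrMr// mulrC.
Qed.

(** Beyond [3 r] both values are 1. Otherwise, with [q = |h| / r], the argument changes by [f] with
    [|f| <= 7q] and [f^2 <= 7q], and the Taylor bound gives [2 * 7q + 8 * 7q = 70q]. *)
Lemma radial_cutoff_first_difference v h : 0 < r -> enorm h <= r / 8 ->
  `|radial_cutoff (v + h) - radial_cutoff v| <= 70 * (enorm h / r).
Proof.
move=> r0 hr; have hr0 : 0 <= enorm h / r by rewrite divr_ge0 ?enorm_ge0// ltW.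
have [vr|vr] : 3 * r <= enorm v \/ enorm v <= 3 * r.
    by case: (leP (3 * r) (enorm v)) => [|/ltW]; [left|right].
  have far : 2 * r <= enorm (v + h).
    by rewrite (le_trans _ (enorm_lerB _ _))//; lra.
  have near : 2 * r <= enorm v by lra.
  by rewrite !radial_cutoff_eq1// subrr normr0 mulr_ge0.
have [d /andP[d0 d2] /(_ (enorm (v + h) ^+ 2 / r ^+ 2))] :=
  cutoff_taylor (enorm v ^+ 2 / r ^+ 2).
rewrite -/(radial_cutoff v) -/(radial_cutoff (v + h)) radial_cutoff_arg.
rewrite [_ + _ - enorm v ^+ 2 / _]addrAC subrr add0r.
have [] := radial_cutoff_arg_le r0 vr hr.
have hr1 : enorm h / r <= 8^-1 by rewrite ler_pdivrMr// mulrC.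
move: hr0 hr1; set e := dot v h / r ^+ 2; set a := radial_cutoff _.
set b := radial_cutoff _; set q := enorm h / r.
move: (q) e a b => {}q e a b hr0 hr1.
rewrite !ler_norml => /andP[e1 e2] q2 /andP[t1 t2].
have qq : 0 <= q ^+ 2 := sqr_ge0 q.
have E1 : `|2 * e + q ^+ 2| <= 7 * q by rewrite ler_norml; apply/andP; split; lra.
have E2 : (2 * e + q ^+ 2) ^+ 2 <= 7 * q.
  rewrite -(real_normK (num_real _)) expr2 (le_trans (ler_wpM2l _ E1))//.
  by rewrite ler_piMl//; lra.
move: E1 E2 t1 t2; set f := 2 * e + q ^+ 2; rewrite ler_norml => /andP[f1 f2] E2 t1 t2.
have d7 : d * f <= 2 * (7 * q) by nra.
have d7' : - (2 * (7 * q)) <= d * f by nra.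
by apply/andP; split; lra.
Qed.

(** In the Taylor expansions at [v] the increments are [2e + q^2] and [-2e + q^2]: the terms in [e]
    cancel, leaving [2 d q^2 <= 4 q^2]. The squared increments sum to at most [74 q^2], so the
    remainders add [592 q^2]; 800 is a round bound. *)
Lemma radial_cutoff_second_difference v h : 0 < r -> enorm h <= r / 8 ->
  `|radial_cutoff (v + h) + radial_cutoff (v - h) - 2 * radial_cutoff v| <=
  800 * (enorm h / r) ^+ 2.
Proof.
move=> r0 hr; have hr0 : 0 <= enorm h / r by rewrite divr_ge0 ?enorm_ge0// ltW.
have [vr|vr] : 3 * r <= enorm v \/ enorm v <= 3 * r.
    by case: (leP (3 * r) (enorm v)) => [|/ltW]; [left|right].
  have far : 2 * r <= enorm (v + h).
    by rewrite (le_trans _ (enorm_lerB _ _))//; lra.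
  have far' : 2 * r <= enorm (v - h).
    by rewrite (le_trans _ (enorm_lerB _ _))// enormN; lra.
  have near : 2 * r <= enorm v by lra.
  rewrite !radial_cutoff_eq1// (_ : 1 + 1 - 2 * 1 = 0); last by ring.
  rewrite normr0 mulr_ge0 ?ler0n//; exact: sqr_ge0.
have [d /andP[d0 d2] dP] := cutoff_taylor (enorm v ^+ 2 / r ^+ 2).
have := dP (enorm (v + h) ^+ 2 / r ^+ 2); have := dP (enorm (v - h) ^+ 2 / r ^+ 2).
rewrite -/(radial_cutoff v) -/(radial_cutoff (v + h)) -/(radial_cutoff (v - h)).
rewrite !radial_cutoff_arg enormN dotNr mulNr.
rewrite ![_ + _ - enorm v ^+ 2 / _]addrAC !subrr !add0r.
have [] := radial_cutoff_arg_le r0 vr hr.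
move: hr0; set e := dot v h / r ^+ 2; set q := enorm h / r.
set a := radial_cutoff _; set b := radial_cutoff _; set c := radial_cutoff _.
have hr1 : q <= 8^-1 by rewrite ler_pdivrMr// mulrC.
move: (q) hr1 e a b c => {}q hr1 e a b c hr0.
rewrite !ler_norml => /andP[e1 e2] q2 /andP[t1 t2] /andP[u1 u2].
have qq : 0 <= q ^+ 2 := sqr_ge0 q.
have ee : e ^+ 2 <= 9 * q ^+ 2 by nra.
have q4 : (q ^+ 2) ^+ 2 <= q ^+ 2 by nra.
have ff : (2 * e + q ^+ 2) ^+ 2 + (2 * - e + q ^+ 2) ^+ 2 <= 74 * q ^+ 2 by nra.
have dq : d * q ^+ 2 <= 2 * q ^+ 2 by rewrite ler_wpM2r.
have dq0 : 0 <= d * q ^+ 2 by rewrite mulr_ge0.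
move: ff t1 t2 u1 u2; set f1 := (2 * e + _) ^+ 2; set f2 := (2 * - e + _) ^+ 2.
move: (f1) (f2) => {}f1 {}f2 *.
by apply/andP; split; lra.
Qed.

Lemma measurable_radial_cutoff : measurable_fun setT radial_cutoff.
Proof.
apply: (measurableT_comp measurable_cutoff).
by apply: measurable_funM => //; apply: measurable_funX; exact: measurable_enorm.
Qed.

End radial_cutoff.

(** Discrete Leibniz rule. The letters [t] and [k] stand for cutoff and kernel; the indices [p],
    [m], [c] for the points [w + m + h], [w + m - h], [w + m], while [tt] and [kk] are the values at
    [w]. Moving the centre from [w + m] back to [w] costs only first differences, whence the term in
    [f]. *)
Lemma three_point_product (R : realType) (L A e f tp tm tc tt kp km kc kk : R) :
  0 <= L -> 0 <= A -> 0 <= e -> 0 <= f -> 0 <= tc -> tc <= 1 ->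
  0 <= kc -> kc <= L * A -> 0 <= kk -> kk <= L * A ->
  `|tp - tc| <= 70 * e -> `|tm - tc| <= 70 * e -> `|tc - tt| <= 70 * f ->
  `|tp + tm - 2 * tc| <= 800 * e ^+ 2 ->
  `|kp - kc| <= 8 * L ^+ 2 * A * e -> `|km - kc| <= 8 * L ^+ 2 * A * e ->
  `|kc - kk| <= 8 * L ^+ 2 * A * f ->
  `|kp + km - 2 * kc| <= 128 * L ^+ 2 * A * e ^+ 2 ->
  `|tp * kp + tm * km - 2 * (tt * kk)| <= 2000 * (L ^+ 2 + L) * A * (e ^+ 2 + f).
Proof.
move=> L0 A0 e0 f0 tc0 tc1 kc0 kcL kk0 kkL t1 t2 t3 t4 d1 d2 d3 d4.
have -> : tp * kp + tm * km - 2 * (tt * kk) =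
   tc * (kp + km - 2 * kc) + kc * (tp + tm - 2 * tc) +
   (tp - tc) * (kp - kc) + (tm - tc) * (km - kc) +
   2 * (tc * (kc - kk) + kk * (tc - tt)) by ring.
have b1 : `|tc * (kp + km - 2 * kc)| <= 1 * (128 * L ^+ 2 * A * e ^+ 2).
  by rewrite normrM (ger0_norm tc0); apply: ler_pM.
have b2 : `|kc * (tp + tm - 2 * tc)| <= L * A * (800 * e ^+ 2).
  by rewrite normrM (ger0_norm kc0); apply: ler_pM.
have b3 : `|(tp - tc) * (kp - kc)| <= 70 * e * (8 * L ^+ 2 * A * e).
  by rewrite normrM; apply: ler_pM.
have b4 : `|(tm - tc) * (km - kc)| <= 70 * e * (8 * L ^+ 2 * A * e).
  by rewrite normrM; apply: ler_pM.
have b5 : `|tc * (kc - kk)| <= 1 * (8 * L ^+ 2 * A * f).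
  by rewrite normrM (ger0_norm tc0); apply: ler_pM.
have b6 : `|kk * (tc - tt)| <= L * A * (70 * f).
  by rewrite normrM (ger0_norm kk0); apply: ler_pM.
have LA : 0 <= L * A * e ^+ 2 by rewrite !mulr_ge0 ?sqr_ge0.
have L2 : 0 <= L ^+ 2 := sqr_ge0 L.
have LA2 : 0 <= L ^+ 2 * A * e ^+ 2.
  by apply: mulr_ge0 (sqr_ge0 e); apply: mulr_ge0.
have LB : 0 <= L * A * f by rewrite !mulr_ge0.
have LB2 : 0 <= L ^+ 2 * A * f by apply: mulr_ge0 f0; apply: mulr_ge0.
move: b1 b2 b3 b4 b5 b6; rewrite !ler_norml.
move=> /andP[? ?] /andP[? ?] /andP[? ?] /andP[? ?] /andP[? ?] /andP[? ?].
by apply/andP; split; lra.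
Qed.

Section cut_kernel.
Context {R : realType} {n : nat}.
Variables (s lam Lam : R) (K : 'rV[R]_n -> \bar R).
Variable r : R.

Local Notation k := (fine \o K).
Local Notation pk := (power_kernel s).

Definition cut_kernel (v : 'rV[R]_n) : R := radial_cutoff r v * k v.

(** The last factor compares the power kernel at distance [|w| / 4], a lower bound for every
    distance at which the kernel bounds are used, with its value at [w]. *)
Definition diff_const : R := 2000 * (Lam ^+ 2 + Lam) * 4^-1 `^ (- n%:R - 2 * s).

(* Discrete product rule for the second difference of [radial_cutoff * k]. *)
Lemma cut_kernel_three_point (w h m : 'rV[R]_n) :
  0 <= s -> 0 < lam -> lam <= Lam -> kernel_class s lam Lam K -> 0 < r ->
  enorm h <= r / 8 -> enorm m <= r / 8 -> r / 2 <= enorm w ->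
  `|cut_kernel (w + m + h) + cut_kernel (w + m - h) - 2 * cut_kernel w| <=
  diff_const * pk w * ((enorm h / r) ^+ 2 + enorm m / r).
Proof.
move=> s0 lam0 lamLam hK r0 hr mr rw.
have Lam0 : 0 < Lam by exact: lt_le_trans lamLam.
have w0 : 0 < enorm w by rewrite (lt_le_trans _ rw)// divr_gt0.
have w00 : w != 0 by rewrite -enorm_gt0.
set w' := w + m.
have ww' : 3 / 4 * enorm w <= enorm w'.
  by rewrite (le_trans _ (enorm_lerB _ _))//; lra.
have w'00 : w' != 0 by rewrite -enorm_gt0; lra.
have [AP APE] : exists AP, AP = (enorm w / 4) `^ (- n%:R - 2 * s).
  by exists ((enorm w / 4) `^ (- n%:R - 2 * s)).
have AP0 : 0 <= AP by rewrite APE powR_ge0.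
have w4 : 0 < enorm w / 4 by rewrite divr_gt0.
have quarter (a : R) : enorm w / 4 <= a -> a `^ (- n%:R - 2 * s) <= AP.
  by move=> wa; rewrite APE; exact: power_kernel_decr.
have q' : (enorm w' / 2) `^ (- n%:R - 2 * s) <= AP by apply: quarter; lra.
have q : (enorm w / 2) `^ (- n%:R - 2 * s) <= AP by apply: quarter; lra.
(* Both centres [w] and [w'] are at distance at least [3r/8] from the origin, so the inverse
   half-distances in the derivative bounds are at most [8 / r]. This yields powers of [|h| / r]. *)
have inv (a : R) : r / 8 <= a -> a^-1 <= 8 / r.
  move=> ra; have a0 : 0 < a by rewrite (lt_le_trans _ ra)// divr_gt0.
  by rewrite -[8 / r]invrK lef_pV2 ?posrE ?invf_div ?divr_gt0//; lra.
have i' : (enorm w' / 2)^-1 <= 8 / r by apply: inv; lra.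
have i : (enorm w / 2)^-1 <= 8 / r by apply: inv; lra.
have i0' : 0 <= (enorm w' / 2)^-1 by rewrite invr_ge0 divr_ge0 ?enorm_ge0.
have i0 : 0 <= (enorm w / 2)^-1 by rewrite invr_ge0 divr_ge0 ?enorm_ge0.
have hw' : enorm h <= enorm w' / 2 by lra.
have hNw' : enorm (- h) <= enorm w' / 2 by rewrite enormN.
have mw : enorm m <= enorm w / 2 by lra.
set e := enorm h / r; set f := enorm m / r.
have e0 : 0 <= e by rewrite divr_ge0 ?enorm_ge0// ltW.
have f0 : 0 <= f by rewrite divr_ge0 ?enorm_ge0// ltW.
have L2 : 0 <= Lam ^+ 2 by exact: sqr_ge0.
have first (p v : 'rV[R]_n) : p != 0 -> enorm v <= enorm p / 2 ->
    (enorm p / 2) `^ (- n%:R - 2 * s) <= AP -> (enorm p / 2)^-1 <= 8 / r ->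
    `|k (p + v) - k p| <= 8 * Lam ^+ 2 * AP * (enorm v / r).
  move=> p0 vp qp ip.
  apply: (le_trans (kernel_first_difference s0 lam0 lamLam hK p0 vp)).
  have -> : 8 * Lam ^+ 2 * AP * (enorm v / r) = Lam ^+ 2 * (8 / r) * AP * enorm v.
    by field; rewrite gt_eqF.
  have ip0 : 0 <= (enorm p / 2)^-1 by rewrite invr_ge0 divr_ge0 ?enorm_ge0.
  rewrite ler_wpM2r ?enorm_ge0//; apply: ler_pM => //.
  - by rewrite mulr_ge0.
  - exact: powR_ge0.
  - by rewrite ler_wpM2l.
have d1 := first _ _ w'00 hw' q' i'.
have d2 := first _ _ w'00 hNw' q' i'.
have d3 := first _ _ w00 mw q i.
rewrite enormN in d2.
have d4 : `|k (w' + h) + k (w' - h) - 2 * k w'| <= 128 * Lam ^+ 2 * AP * e ^+ 2.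
  apply: (le_trans (kernel_second_difference s0 lam0 lamLam hK w'00 hw')).
  have -> : 128 * Lam ^+ 2 * AP * e ^+ 2 =
      2 * (Lam ^+ 2 * (8 / r) ^+ 2 * AP) * enorm h ^+ 2.
    by rewrite /e; field; rewrite gt_eqF.
  rewrite ler_wpM2r ?sqr_ge0// ler_wpM2l//.
  have ip0 : 0 <= (enorm w' / 2) ^- 2 by rewrite invr_ge0 sqr_ge0.
  apply: ler_pM => //.
  - by rewrite mulr_ge0.
  - exact: powR_ge0.
  rewrite ler_wpM2l// -exprVn ler_pXn2r ?nnegrE//.
  by rewrite divr_ge0// ltW.
have kw' : k w' <= Lam * AP.
  rewrite (le_trans (kernel_upper_far s0 lam0 lamLam hK w'00 _))//.
    by have := enorm_ge0 w'; lra.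
  by rewrite ler_wpM2l// ltW.
have kw : k w <= Lam * AP.
  rewrite (le_trans (kernel_upper_far s0 lam0 lamLam hK w00 _))//; first by lra.
  by rewrite ler_wpM2l// ltW.
have k0' := kernel_fin_ge0 hK w'; have k0 := kernel_fin_ge0 hK w.
have t1 := radial_cutoff_first_difference w' r0 hr.
have hNr : enorm (- h) <= r / 8 by rewrite enormN.
have t2 := radial_cutoff_first_difference w' r0 hNr.
have t3 := radial_cutoff_first_difference w r0 mr.
have t4 := radial_cutoff_second_difference w' r0 hr.
rewrite enormN in t2.
have T0 v : 0 <= radial_cutoff r v by exact: cutoff_ge0.
have T1 v : radial_cutoff r v <= 1 by exact: cutoff_le1.
rewrite /cut_kernel -/w' -/e -/f -/w' in t3 *.
have -> : diff_const * pk w = 2000 * (Lam ^+ 2 + Lam) * AP.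
  by rewrite /diff_const -mulrA APE powRM ?(ltW w0) ?invr_ge0// [pk w * _]mulrC.
exact: (three_point_product (ltW Lam0) AP0 e0 f0 (T0 _ w') (T1 _ w') k0' kw' k0 kw
  t1 t2 t3 t4 d1 d2 d3 d4).
Qed.

Lemma cut_kernel_eq0 (v : 'rV[R]_n) : 0 < r -> enorm v <= r -> cut_kernel v = 0.
Proof. by move=> r0 vr; rewrite /cut_kernel radial_cutoff_eq0 ?mul0r. Qed.

(** All three points lie within [3r/4] of the origin, where the cut kernel vanishes. *)
Lemma cut_kernel_three_point0 (w h m : 'rV[R]_n) : 0 < r ->
  enorm h <= r / 8 -> enorm m <= r / 8 -> enorm w < r / 2 ->
  cut_kernel (w + m + h) + cut_kernel (w + m - h) - 2 * cut_kernel w = 0.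
Proof.
move=> r0 hr mr wr; have wm := enormD w m.
rewrite !cut_kernel_eq0 ?mulr0 ?addr0 ?subr0//; first by lra.
  by rewrite (le_trans (enorm_sub _ _))//; lra.
by rewrite (le_trans (enormD _ _))//; lra.
Qed.

End cut_kernel.

(** * The key integral estimate *)

Section bounded_integrable.
Context d (T : measurableType d) (R : realType) (mu : {measure set T -> \bar R}).

Lemma integrable_bounded_mul (D : set T) (f g : T -> R) (B : R) :
  measurable D -> mu.-integrable D (EFin \o f) -> measurable_fun D g ->
  (forall x, D x -> `|g x| <= B) ->
  mu.-integrable D (EFin \o (fun x => g x * f x)).
Proof.
move=> mD intf mg gB.
have mf : measurable_fun D f by apply/measurable_EFinP; exact: (measurable_int mu intf).
apply: (@le_integrable _ _ _ _ _ mD _ (fun x => `|B|%:E * (f x)%:E)%E).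
- by apply/measurable_EFinP; apply: measurable_funM.
- move=> x Dx; rewrite -EFinM !abse_EFin lee_fin !normrM normr_id.
  by rewrite ler_wpM2r// (le_trans (gB _ Dx))// ler_norm.
- exact: integrableZl.
Qed.

Lemma integrable_EFinD (D : set T) (f g : T -> R) : measurable D ->
  mu.-integrable D (EFin \o f) -> mu.-integrable D (EFin \o g) ->
  mu.-integrable D (EFin \o (fun x => f x + g x)).
Proof. by move=> mD intf intg; exact: (integrableD mD intf intg). Qed.

Lemma integrable_EFinZl (D : set T) (f : T -> R) (a : R) : measurable D ->
  mu.-integrable D (EFin \o f) -> mu.-integrable D (EFin \o (fun x => a * f x)).
Proof. by move=> mD intf; exact: (integrableZl mD a intf). Qed.

Lemma le_Rintegral_nonneg (D : set T) (f : T -> R) (B : R) :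
  (\int[mu]_(x in D) (f x)%:E <= B%:E)%E -> (forall x, D x -> 0 <= f x) ->
  \int[mu]_(x in D) f x <= B.
Proof.
move=> fB f0; have I0 : (0 <= \int[mu]_(x in D) (f x)%:E)%E.
  by apply: integral_ge0 => x Dx; rewrite lee_fin f0.
rewrite /Rintegral -lee_fin fineK// ge0_fin_numE//.
exact: le_lt_trans fB (ltry _).
Qed.

Lemma Rintegral_restrict (D E : set T) (f : T -> R) : E `<=` D ->
  (forall x, D x -> ~ E x -> f x = 0) ->
  \int[mu]_(x in D) f x = \int[mu]_(x in E) f x.
Proof.
move=> ED f0; rewrite Rintegral_mkcond [RHS]Rintegral_mkcond.
apply: eq_Rintegral => x _; rewrite /patch.
have [xE|xE] := boolP (x \in E).
  by rewrite ifT// inE; apply: ED; move: xE; rewrite inE.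
case: ifPn => // xD; apply: f0; first by move: xD; rewrite inE.
by move: xE; rewrite notin_setE.
Qed.

End bounded_integrable.

Section reflect_Rintegral.
Context {R : realType} {n : nat}.
Local Notation mu := (@lebesgue_rV R n).

Lemma Rintegral_reflect_rV (c : 'rV[R]_n) (D : set 'rV[R]_n) (f : 'rV[R]_n -> R) :
  measurable D -> measurable_fun D f ->
  \int[mu]_(x in D) f x = \int[mu]_(x in (fun x => c - x) @^-1` D) f (c - x).
Proof.
move=> mD mf; rewrite /Rintegral (integral_reflect_rV c mD)//.
exact/measurable_EFinP.
Qed.

Lemma Rintegral_reflectT_rV (c : 'rV[R]_n) (f : 'rV[R]_n -> R) :
  measurable_fun setT f -> \int[mu]_x f x = \int[mu]_x f (c - x).
Proof. by move=> mf; rewrite (Rintegral_reflect_rV c). Qed.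

Lemma integrable_reflect_rV (c : 'rV[R]_n) (f : 'rV[R]_n -> R) :
  mu.-integrable setT (EFin \o f) ->
  mu.-integrable setT (EFin \o (fun x => f (c - x))).
Proof.
move=> intf; have mf : measurable_fun setT f.
  apply/measurable_EFinP; exact: (measurable_int mu intf).
case/integrableP: intf => _ intf; apply/integrableP; split.
  by apply/measurable_EFinP; apply: (measurableT_comp mf); exact: measurable_reflect_rV.
move: intf; rewrite (ge0_integral_reflect_rV c)//; last first.
  by apply/measurable_EFinP; apply: measurableT_comp.
Qed.

(** Used to discard linear terms [dot p v], which are odd while the kernel and the radial cutoff are
    even. *)
Lemma Rintegral_odd (D : set 'rV[R]_n) (f : 'rV[R]_n -> R) :
  measurable D -> (forall x, D x -> D (- x)) ->
  mu.-integrable D (EFin \o f) -> (forall x, f (- x) = - f x) ->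
  \int[mu]_(x in D) f x = 0.
Proof.
move=> mD DN intf fN.
have mf : measurable_fun D f by apply/measurable_EFinP; exact: (measurable_int mu intf).
have E : \int[mu]_(x in D) f x = - \int[mu]_(x in D) f x.
  rewrite [LHS](Rintegral_reflect_rV 0)//.
  have -> : (fun x => 0 - x) @^-1` D = D.
    apply/seteqP; split => x /=; rewrite sub0r; last exact: DN.
    by move=> /DN; rewrite opprK.
  rewrite -mulN1r -RintegralZl//; apply: eq_Rintegral => x _.
  by rewrite sub0r fN mulN1r.
by lra.
Qed.

End reflect_Rintegral.

Section kernel_integrable.
Context {R : realType} {n : nat}.
Variables (s lam Lam : R) (K : 'rV[R]_n -> \bar R).
Local Notation mu := (@lebesgue_rV R n).
Local Notation k := (fine \o K).
Local Notation pk := (@power_kernel R n s).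
Implicit Types rho : R.

Definition outside (rho : R) := [set v : 'rV[R]_n | rho <= enorm v].

Lemma measurable_outside rho : measurable (outside rho).
Proof. exact: measurable_enorm_ge. Qed.

Lemma outsideN rho v : outside rho v -> outside rho (- v).
Proof. by rewrite /outside/= enormN. Qed.

Lemma outside_neq0 rho v : 0 < rho -> outside rho v -> v != 0.
Proof. by move=> rho0 /(lt_le_trans rho0); rewrite enorm_gt0. Qed.

Lemma integrable_power_kernel rho : 0 < s -> 0 < rho ->
  mu.-integrable (outside rho) (EFin \o pk).
Proof.
move=> s0 rho0; apply/integrableP; split.
  by apply/measurable_EFinP; exact: measurable_power_kernel.
rewrite (eq_integral (EFin \o pk)); last first.
  by move=> x _; rewrite /= ger0_norm// power_kernel_ge0.
exact: le_lt_trans (integral_power_kernel_tail s0 rho0) (ltry _).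
Qed.

Lemma measurable_kernel_outside rho : kernel_class s lam Lam K -> 0 < rho ->
  measurable_fun (outside rho) k.
Proof.
move=> hK rho0; apply: (measurable_funS _ _ (measurable_jump_kernel hK)).
  exact: measurable_enorm_gt.
by move=> v /=; exact: lt_le_trans.
Qed.

Lemma integrable_kernel rho : 0 < s -> 0 < lam -> lam <= Lam ->
  kernel_class s lam Lam K -> 0 < rho ->
  mu.-integrable (outside rho) (EFin \o k).
Proof.
move=> s0 lam0 lamLam hK rho0.
have Lam0 : 0 < Lam by exact: lt_le_trans lamLam.
apply: (@le_integrable _ _ _ _ _ (measurable_outside rho) _
    (fun v => Lam%:E * (pk v)%:E)%E).
- by apply/measurable_EFinP; exact: measurable_kernel_outside.
- move=> v vrho; rewrite -EFinM !abse_EFin lee_fin.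
  rewrite ger0_norm ?(kernel_fin_ge0 hK)// ger0_norm; last first.
    by rewrite mulr_ge0 ?power_kernel_ge0 ?(ltW Lam0).
  exact: (kernel_fin_upper hK (outside_neq0 rho0 vrho)).
- by apply: integrableZl; [exact: measurable_outside|exact: integrable_power_kernel].
Qed.

End kernel_integrable.

(** * Splitting the kernel at the radius [r] *)

Section split_kernel.
Context {R : realType} {n : nat}.
Variables (s lam Lam : R) (K : 'rV[R]_n -> \bar R).
Local Notation mu := (@lebesgue_rV R n).
Local Notation k := (fine \o K).
Local Notation pk := (@power_kernel R n s).
Implicit Types (rho r : R) (v w x y z : 'rV[R]_n).

Lemma radial_cutoffN r v : radial_cutoff r (- v) = radial_cutoff r v.
Proof. by rewrite /radial_cutoff enormN. Qed.

Lemma measurable_radial_cutoffS r (D : set 'rV[R]_n) :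
  measurable_fun D (radial_cutoff r : 'rV[R]_n -> R).
Proof. by apply: measurable_funTS; exact: measurable_radial_cutoff. Qed.

Lemma measurable_enormS (D : set 'rV[R]_n) : measurable_fun D (@enorm R 1 n).
Proof. by apply: measurable_funTS; exact: measurable_enorm. Qed.

Lemma measurable_dotS (D : set 'rV[R]_n) (p : 'rV[R]_n) : measurable_fun D (dot p).
Proof.
apply: measurable_funTS; apply: continuous_measurable_rV => v.
by apply: (dot_continuous (f := cst p) (g := id)); [exact: cst_continuous|].
Qed.

Lemma diff_const_ge0 : 0 <= Lam -> 0 <= @diff_const R n s Lam.
Proof.
move=> Lam0; apply: mulr_ge0; last exact: powR_ge0.
apply: mulr_ge0; first exact: ler0n.
by apply: addr_ge0 => //; exact: sqr_ge0.
Qed.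

(** The integrand vanishes beyond [2 r], and [|v|^2] compensates the singularity because [s < 1].
    The bound does not involve [rho], so the truncation may be as fine as the touching argument
    requires. *)
Lemma Rintegral_kernel_near rho r : 0 <= s -> s < 1 -> 0 < lam -> lam <= Lam ->
  kernel_class s lam Lam K -> 0 < rho -> 0 < r ->
  \int[mu]_(v in outside rho) (enorm v ^+ 2 * (1 - radial_cutoff r v) * k v) <=
  Lam * (@near_const R n s * (2 * r) `^ (2 - 2 * s)).
Proof.
move=> s0 s1 lam0 lamLam hK rho0 r0.
have Lam0 : 0 < Lam by exact: lt_le_trans lamLam.
have T01 v : 0 <= 1 - radial_cutoff r v by rewrite subr_ge0; exact: cutoff_le1.
have f0 v : 0 <= enorm v ^+ 2 * (1 - radial_cutoff r v) * k v.
  by rewrite mulr_ge0 ?(kernel_fin_ge0 hK)// mulr_ge0// sqr_ge0.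
apply: le_Rintegral_nonneg => //.
pose near := [set v : 'rV[R]_n | enorm v < 2 * r].
have mnear : measurable near by exact: measurable_enorm_lt.
have g0 v : 0 <= Lam * (enorm v ^+ 2 * pk v).
  by rewrite mulr_ge0 ?(ltW Lam0)// mulr_ge0 ?power_kernel_ge0// sqr_ge0.
have mg : measurable_fun setT (fun v : 'rV[R]_n => enorm v ^+ 2 * pk v).
  apply: measurable_funM; last exact: measurable_power_kernel.
  by apply: measurable_funX; exact: measurable_enorm.
apply: (@le_trans _ _ (\int[mu]_(v in near) (Lam * (enorm v ^+ 2 * pk v))%:E)%E).
  rewrite integral_mkcond [leRHS]integral_mkcond.
  apply: ge0_le_integral => //.
  - by move=> v _; rewrite /patch; case: ifPn => // _; rewrite lee_fin.
  - apply/(measurable_restrictT _ _).1; first exact: measurable_outside.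
    apply/measurable_EFinP; apply: measurable_funM; last exact: measurable_kernel_outside hK _.
    apply: measurable_funM; first by apply: measurable_funX; exact: measurable_enormS.
    by apply: measurable_funB => //; exact: measurable_radial_cutoffS.
  - apply/(measurable_restrictT _ _).1 => //.
    apply/measurable_EFinP; apply: measurable_funM => //.
    exact: measurable_funTS.
  move=> v _; rewrite /patch; case: ifPn => [|_]; last first.
    by case: ifPn => // _; rewrite lee_fin.
  rewrite inE => vrho; have v0 := outside_neq0 rho0 vrho.
  case: ifPn => [_|]; last first.
    rewrite notin_setE /near/= => /negP; rewrite -leNgt => rv.
    by rewrite radial_cutoff_eq1// subrr mulr0 mul0r.
  rewrite lee_fin -mulrA [leRHS]mulrCA ler_wpM2l ?sqr_ge0//.
  rewrite (le_trans _ (kernel_fin_upper hK v0))// ler_piMl ?(kernel_fin_ge0 hK)//.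
  by rewrite lerBlDr lerDl; exact: cutoff_ge0.
under eq_integral do rewrite EFinM.
rewrite ge0_integralZl_EFin ?(ltW Lam0)//; last 2 first.
- by move=> v _; rewrite lee_fin mulr_ge0 ?power_kernel_ge0// sqr_ge0.
- by apply/measurable_EFinP; exact: measurable_funTS.
rewrite EFinM lee_wpmul2l ?lee_fin ?(ltW Lam0)//.
by apply: integral_power_kernel_near => //; rewrite mulr_gt0.
Qed.

(** The slope [p] is uncontrolled but disappears by oddness; only [Q |v|^2] is paid for. The bound
    [B] serves integrability alone. *)
Lemma Rintegral_near_le rho r (g : 'rV[R]_n -> R) (p : 'rV[R]_n) (Q B : R) :
  0 < s -> s < 1 -> 0 < lam -> lam <= Lam ->
  kernel_class s lam Lam K -> 0 < rho -> 0 < r -> 0 <= Q ->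
  measurable_fun setT g -> (forall v, `|g v| <= B) ->
  (forall v, enorm v <= 2 * r -> g v <= dot p v + Q * enorm v ^+ 2) ->
  \int[mu]_(v in outside rho) (g v * (1 - radial_cutoff r v) * k v) <=
  Q * (Lam * (@near_const R n s * (2 * r) `^ (2 - 2 * s))).
Proof.
move=> s0 s1 lam0 lamLam hK rho0 r0 Q0 mg gB gQ.
have T01 v : 0 <= 1 - radial_cutoff r v by rewrite subr_ge0; exact: cutoff_le1.
have T1 v : 1 - radial_cutoff r v <= 1 by rewrite lerBlDr lerDl; exact: cutoff_ge0.
have mO : measurable (@outside R n rho) by exact: measurable_outside.
have mT : measurable_fun (outside rho) (fun v => 1 - radial_cutoff r v : R).
  by apply: measurable_funB => //; exact: measurable_radial_cutoffS.
have ik := integrable_kernel s0 lam0 lamLam hK rho0.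
have far v : 2 * r <= enorm v -> 1 - radial_cutoff r v = 0.
  by move=> /(radial_cutoff_eq1 r0) ->; rewrite subrr.
have ig : mu.-integrable (outside rho)
    (EFin \o (fun v => g v * (1 - radial_cutoff r v) * k v)).
  apply: (@integrable_bounded_mul _ _ _ _ _ _ _ B) => //.
    by apply: measurable_funM => //; exact: measurable_funTS.
  move=> v _; rewrite normrM (ger0_norm (T01 _)) -[leRHS]mulr1.
  by apply: ler_pM.
have id : mu.-integrable (outside rho)
    (EFin \o (fun v => dot p v * (1 - radial_cutoff r v) * k v)).
  apply: (@integrable_bounded_mul _ _ _ _ _ _ _ (enorm p * (2 * r))) => //.
    by apply: measurable_funM => //; exact: measurable_dotS.
  move=> v _; rewrite normrM (ger0_norm (T01 _)).
  have [rv|rv] : 2 * r <= enorm v \/ enorm v <= 2 * r.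
    by case: (leP (2 * r) (enorm v)) => [|/ltW]; [left|right].
    by rewrite far// mulr0 mulr_ge0 ?enorm_ge0// mulr_ge0// ltW.
  rewrite -[leRHS]mulr1; apply: ler_pM => //.
  by rewrite (le_trans (normr_dot _ _))// ler_wpM2l ?enorm_ge0.
have iq : mu.-integrable (outside rho)
    (EFin \o (fun v => enorm v ^+ 2 * (1 - radial_cutoff r v) * k v)).
  apply: (@integrable_bounded_mul _ _ _ _ _ _ _ ((2 * r) ^+ 2)) => //.
    apply: measurable_funM => //.
    by apply: measurable_funX; exact: measurable_enormS.
  move=> v _; rewrite normrM (ger0_norm (T01 _)) (ger0_norm (sqr_ge0 _)).
  have [rv|rv] : 2 * r <= enorm v \/ enorm v <= 2 * r.
    by case: (leP (2 * r) (enorm v)) => [|/ltW]; [left|right].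
    by rewrite far// mulr0 sqr_ge0.
  rewrite -[leRHS]mulr1; apply: ler_pM => //; first exact: sqr_ge0.
  by rewrite ler_pXn2r ?nnegrE ?enorm_ge0// mulr_ge0// ltW.
have iQ := integrable_EFinZl Q mO iq.
apply: (@le_trans _ _ (\int[mu]_(v in outside rho)
    (dot p v * (1 - radial_cutoff r v) * k v +
     Q * (enorm v ^+ 2 * (1 - radial_cutoff r v) * k v)))).
  apply: le_Rintegral => //.
    exact: integrable_EFinD.
  move=> v _.
  have [rv|rv] : 2 * r <= enorm v \/ enorm v <= 2 * r.
    by case: (leP (2 * r) (enorm v)) => [|/ltW]; [left|right].
    by rewrite far// !(mulr0, mul0r) addr0.
  rewrite (_ : _ + _ = (dot p v + Q * enorm v ^+ 2) * (1 - radial_cutoff r v) * k v).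
    by rewrite ler_wpM2r ?(kernel_fin_ge0 hK)// ler_wpM2r// gQ.
  by ring.
rewrite RintegralD// RintegralZl// Rintegral_odd//; first last.
- by move=> v; rewrite dotNr radial_cutoffN (kernel_finN hK) !mulNr.
- exact: outsideN.
rewrite add0r ler_wpM2l//.
by apply: Rintegral_kernel_near => //; exact: ltW.
Qed.

(** Ellipticity from below. On the cube [[2r, 3r]^n], of volume [r^n], the cutoff is 1 and
    [|v| <= 3 n r], so [k v] is at least its lower bound at that distance. *)
Lemma Rintegral_far_ge rho r : (0 < n)%N -> 0 < s -> 0 < lam -> lam <= Lam ->
  kernel_class s lam Lam K -> 0 < rho -> rho <= r ->
  lam * (3 * n%:R) `^ (- n%:R - 2 * s) * r `^ (- 2 * s) <=
  \int[mu]_(v in outside rho) (radial_cutoff r v * k v).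
Proof.
move=> n0 s0 lam0 lamLam hK rho0 rhor.
have r0 : 0 < r by exact: lt_le_trans rhor.
have mO : measurable (@outside R n rho) by exact: measurable_outside.
pose cube := [set x : 'rV[R]_n | forall i, `[2 * r, 3 * r]%classic (x ord0 i)].
have mcube : measurable cube.
  exact: (@measurable_box R n (fun=> `[2 * r, 3 * r]%classic)).
pose c := lam * (3 * n%:R * r) `^ (- n%:R - 2 * s).
have cubeP v : cube v -> 2 * r <= enorm v /\ enorm v <= 3 * n%:R * r.
  move=> vc; split.
    have := vc (Ordinal n0); rewrite /= in_itv/= => /andP[h1 _].
    by rewrite (le_trans h1)// (le_trans (ler_norm _))// coord_le_enorm.
  rewrite [3 * _]mulrC -mulrA; apply: enorm_le_coord; first by rewrite mulr_ge0// ltW.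
  move=> i; have := vc i; rewrite /= in_itv/= => /andP[h1 h2].
  by rewrite ger0_norm// (le_trans _ h1)// mulr_ge0// ltW.
have cube_sub : cube `<=` outside rho.
  by move=> v /cubeP[h _]; rewrite /outside/=; lra.
have ik := integrable_kernel s0 lam0 lamLam hK rho0.
have iT : mu.-integrable (outside rho) (EFin \o (fun v => radial_cutoff r v * k v)).
  apply: (@integrable_bounded_mul _ _ _ _ _ _ _ 1) => //.
    exact: measurable_radial_cutoffS.
  by move=> v _; rewrite ger0_norm; [exact: cutoff_le1|exact: cutoff_ge0].
have c0 : 0 <= c by rewrite mulr_ge0 ?powR_ge0// ltW.
have cubeE : mu cube = ((3 * r - 2 * r) ^+ n)%:E.
  by apply: lebesgue_rV_cube; lra.
apply: (@le_trans _ _ (\int[mu]_(v in cube) c)).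
  rewrite Rintegral_cst//= [X in c * fine X]cubeE/=.
  have -> : 3 * r - 2 * r = r by ring.
  rewrite /c (@powRM _ (3 * n%:R) r) ?mulr_ge0 ?(ltW r0)// -(powR_dim (n := n) s r0).
  move: ((3 * n%:R) `^ _) (r `^ _) (r ^+ n) => X Y Z.
  by rewrite [leRHS](_ : _ = lam * X * (Y * Z)) //; ring.
rewrite -lee_fin /Rintegral.
have itT : (\int[mu]_(v in outside rho) (radial_cutoff r v * k v)%:E)%E \is a fin_num.
  exact: (integrable_fin_num mO iT).
rewrite (fineK itT) fineK; last first.
  by rewrite integral_cst//= [X in (_ * X)%E]cubeE.
have TK0 v : 0 <= radial_cutoff r v * k v.
  by rewrite mulr_ge0 ?(kernel_fin_ge0 hK)//; exact: cutoff_ge0.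
apply: (@le_trans _ _ (\int[mu]_(v in cube) (radial_cutoff r v * k v)%:E)%E).
  apply: ge0_le_integral => //.
    apply: (measurable_funS mO cube_sub); exact: (measurable_int mu iT).
  move=> v /cubeP[h1 h2]; rewrite lee_fin radial_cutoff_eq1// mul1r.
  have v0 : 0 < enorm v by rewrite (lt_le_trans _ h1)// mulr_gt0.
  have v00 : v != 0 by rewrite -enorm_gt0.
  rewrite (le_trans _ (kernel_fin_lower hK v00))// ler_wpM2l ?(ltW lam0)//.
  by rewrite power_kernel_decr// ltW.
apply: ge0_subset_integral => //; first exact: (measurable_int mu iT).
by move=> v _; rewrite lee_fin.
Qed.

Lemma integrable_cut_kernel r : 0 < s -> 0 < lam -> lam <= Lam ->
  kernel_class s lam Lam K -> 0 < r ->
  mu.-integrable setT (EFin \o cut_kernel K r).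
Proof.
move=> s0 lam0 lamLam hK r0.
have mO : measurable (@outside R n r) by exact: measurable_outside.
have ik := integrable_kernel s0 lam0 lamLam hK r0.
have : mu.-integrable (outside r) (EFin \o cut_kernel K r).
  apply: (@integrable_bounded_mul _ _ _ _ _ _ _ 1) => //.
    exact: measurable_radial_cutoffS.
  by move=> v _; rewrite ger0_norm; [exact: cutoff_le1|exact: cutoff_ge0].
move=> /(integrable_mkcond _ mO); apply: eq_integrable => // v _.
rewrite /patch; case: ifPn => //; rewrite notin_setE /outside/= => /negP.
by rewrite -ltNge => /ltW vr; rewrite cut_kernel_eq0.
Qed.

(** Summation by parts without derivatives: changes of variable transfer the three shifts from [u]
    to the integrable cut kernel, and then [u] is bounded by [U]. What remains is the L^1 norm of a
    second difference of the kernel. *)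
Lemma Rintegral_second_difference r (u : 'rV[R]_n -> R) (U : R)
    (x y z h m : 'rV[R]_n) :
  0 < s -> 0 < lam -> lam <= Lam -> kernel_class s lam Lam K -> 0 < r -> 0 <= U ->
  measurable_fun setT u -> (forall v, `|u v| <= U) ->
  x - z = m + h -> y - z = m - h -> enorm h <= r / 8 -> enorm m <= r / 8 ->
  `|\int[mu]_v ((u (x - v) + u (y - v) - 2 * u (z - v)) * cut_kernel K r v)| <=
  U * (@diff_const R n s Lam * (@tail_const R n s * (r / 2) `^ (- 2 * s)) *
    ((enorm h / r) ^+ 2 + enorm m / r)).
Proof.
move=> s0 lam0 lamLam hK r0 U0 mu_ uU xz yz hr mr.
have Lam0 : 0 < Lam by exact: lt_le_trans lamLam.
set k2 := cut_kernel K r.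
have ik2 : mu.-integrable setT (EFin \o k2) by exact: integrable_cut_kernel.
have mk2 : measurable_fun setT k2.
  by apply/measurable_EFinP; exact: (measurable_int mu ik2).
have mur (c : 'rV[R]_n) : measurable_fun setT (fun v => u (c - v)).
  by apply: (measurableT_comp mu_); exact: measurable_reflect_rV.
have iu (c : 'rV[R]_n) : mu.-integrable setT (EFin \o (fun v => u (c - v) * k2 v)).
  by apply: (@integrable_bounded_mul _ _ _ _ _ _ _ U).
have iuk (c : 'rV[R]_n) : mu.-integrable setT (EFin \o (fun v => u v * k2 (c - v))).
  apply: (@integrable_bounded_mul _ _ _ _ _ _ _ U) => //.
  exact: integrable_reflect_rV.
have swap (c : 'rV[R]_n) : \int[mu]_v (u (c - v) * k2 v) = \int[mu]_v (u v * k2 (c - v)).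
  rewrite (Rintegral_reflectT_rV c); last by apply: measurable_funM.
  by apply: eq_Rintegral => v _; rewrite subKr.
have -> : \int[mu]_v ((u (x - v) + u (y - v) - 2 * u (z - v)) * k2 v) =
    \int[mu]_v (u v * (k2 (x - v) + k2 (y - v) - 2 * k2 (z - v))).
  transitivity (\int[mu]_v (u (x - v) * k2 v) + \int[mu]_v (u (y - v) * k2 v) +
      (- 2) * \int[mu]_v (u (z - v) * k2 v)).
    rewrite -RintegralD// -RintegralZl// -RintegralD//; first last.
    - exact: integrable_EFinZl.
    - exact: integrable_EFinD.
    by apply: eq_Rintegral => v _; ring.
  rewrite !swap -RintegralD// -RintegralZl// -RintegralD//; first last.
  - exact: integrable_EFinZl.
  - exact: integrable_EFinD.
  by apply: eq_Rintegral => v _; ring.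
have iH : mu.-integrable setT
    (EFin \o (fun v => k2 (x - v) + k2 (y - v) - 2 * k2 (z - v))).
  have -> : (fun v => k2 (x - v) + k2 (y - v) - 2 * k2 (z - v)) =
      (fun v => k2 (x - v) + k2 (y - v) + (- 2) * k2 (z - v)).
    by apply/funext => v; rewrite mulNr.
  apply: integrable_EFinD => //.
    by apply: integrable_EFinD => //; exact: integrable_reflect_rV.
  by apply: integrable_EFinZl => //; exact: integrable_reflect_rV.
have iuH : mu.-integrable setT
    (EFin \o (fun v => u v * (k2 (x - v) + k2 (y - v) - 2 * k2 (z - v)))).
  by apply: (@integrable_bounded_mul _ _ _ _ _ _ _ U).
rewrite (le_trans (le_normr_Rintegral _ iuH))//.
have iaH := integrable_norm iH.
apply: (@le_trans _ _ (\int[mu]_v (U * `|k2 (x - v) + k2 (y - v) - 2 * k2 (z - v)|))).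
  apply: le_Rintegral => //.
  - exact: (integrable_norm iuH).
  - exact: integrable_EFinZl.
  by move=> v _; rewrite normrM ler_wpM2r.
rewrite RintegralZl// ler_wpM2l//.
rewrite (Rintegral_reflectT_rV z); last first.
  by apply/measurable_EFinP; exact: (measurable_int mu iaH).
pose B : R := (enorm h / r) ^+ 2 + enorm m / r.
have B0 : 0 <= B.
  by rewrite addr_ge0 ?sqr_ge0// divr_ge0 ?enorm_ge0// ltW.
have r20 : 0 < r / 2 by rewrite divr_gt0.
have dc0 := diff_const_ge0 (ltW Lam0).
have dB0 : 0 <= @diff_const R n s Lam * B by exact: mulr_ge0.
pose H v := `|k2 (v + m + h) + k2 (v + m - h) - 2 * k2 v|.
(* Centring at [z] turns the three points into [v + m + h], [v + m - h] and [v]; the integrand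
   vanishes for [|v| < r / 2]. *)
have -> : \int[mu]_v `|k2 (x - (z - v)) + k2 (y - (z - v)) - 2 * k2 (z - (z - v))| =
    \int[mu]_(v in outside (r / 2)) H v.
  rewrite -(@Rintegral_restrict _ _ _ mu setT (outside (r / 2)) H)//; last first.
    move=> v _; rewrite /outside/= => /negP; rewrite -ltNge => vr; rewrite /H.
    by rewrite cut_kernel_three_point0// normr0.
  apply: eq_Rintegral => v _; rewrite /H subKr.
  have -> : x - (z - v) = v + m + h.
    by rewrite opprB addrCA xz addrA.
  have -> : y - (z - v) = v + m - h.
    by rewrite opprB addrCA yz addrA.
  by [].
have mO : measurable (@outside R n (r / 2)) by exact: measurable_outside.
apply: le_Rintegral_nonneg => [|v _]; last by rewrite /H.
have mH : measurable_fun (outside (r / 2)) (EFin \o H).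
  have mshift (a : 'rV[R]_n) : measurable_fun setT (fun v : 'rV[R]_n => k2 (v + a)).
    apply: (measurableT_comp mk2).
    rewrite (_ : (fun v => v + a) = (fun v => a - v) \o (fun v => 0 - v)).
      by apply: measurableT_comp; exact: measurable_reflect_rV.
    by apply/funext => v /=; rewrite sub0r opprK addrC.
  apply: measurable_funTS; apply/measurable_EFinP.
  apply: (measurableT_comp (@normr_measurable R setT)).
  apply: measurable_funB; last by apply: measurable_funM.
  apply: measurable_funD.
    by under eq_fun do rewrite -addrA; exact: mshift.
  by under eq_fun do rewrite -addrA; exact: mshift.
apply: (@le_trans _ _ (\int[mu]_(v in outside (r / 2))
    ((@diff_const R n s Lam * B)%:E * (pk v)%:E))%E).
  apply: ge0_le_integral => //.
  - by move=> v _; rewrite lee_fin /H.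
  - apply: emeasurable_funM => //.
    by apply/measurable_EFinP; exact: measurable_power_kernel.
  move=> v rv; rewrite -EFinM lee_fin [leRHS]mulrAC.
  exact: (cut_kernel_three_point (ltW s0) lam0 lamLam hK r0).
rewrite ge0_integralZl_EFin//; last 2 first.
- by move=> v _; rewrite lee_fin power_kernel_ge0.
- by apply/measurable_EFinP; exact: measurable_power_kernel.
rewrite -/B [X in (_ <= X%:E)%E]mulrAC [leRHS]EFinM lee_wpmul2l ?lee_fin//.
exact: integral_power_kernel_tail.
Qed.

(* The key estimate: where [D] is bounded below by a quadratic near [0], the
   average of [D] against the cut-off kernel controls [D 0], and the second
   difference is moved onto that kernel. *)
Lemma Rintegral_second_difference_le rho r (u : 'rV[R]_n -> R) (U A Q : R)
    (p x y z h m : 'rV[R]_n) (D := fun v => u (x - v) + u (y - v) - 2 * u (z - v)) :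
  (0 < n)%N -> 0 < s -> s < 1 -> 0 < lam -> lam <= Lam -> kernel_class s lam Lam K ->
  0 < rho -> rho <= r -> 0 <= U -> 0 <= Q ->
  measurable_fun setT u -> (forall v, `|u v| <= U) ->
  x - z = m + h -> y - z = m - h -> enorm h <= r / 8 -> enorm m <= r / 8 ->
  (forall v, enorm v <= 2 * r -> D 0 - D v <= dot p v + Q * enorm v ^+ 2) ->
  0 <= A -> D 0 <= - A ->
  \int[mu]_(v in outside rho) ((D 0 - D v) * k v) <=
  Q * (Lam * (@near_const R n s * (2 * r) `^ (2 - 2 * s)))
  - A * (lam * (3 * n%:R) `^ (- n%:R - 2 * s) * r `^ (- 2 * s))
  + U * (@diff_const R n s Lam * (@tail_const R n s * (r / 2) `^ (- 2 * s)) *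
    ((enorm h / r) ^+ 2 + enorm m / r)).
Proof.
move=> n0 s0 s1 lam0 lamLam hK rho0 rhor U0 Q0 mu_ uU xz yz hr mr DQ A0 DA.
have r0 : 0 < r by exact: lt_le_trans rhor.
have mO : measurable (@outside R n rho) by exact: measurable_outside.
have ik := integrable_kernel s0 lam0 lamLam hK rho0.
have mur (c : 'rV[R]_n) : measurable_fun setT (fun v => u (c - v)).
  by apply: (measurableT_comp mu_); exact: measurable_reflect_rV.
have mD : measurable_fun setT D.
  apply: measurable_funB; last by apply: measurable_funM.
  exact: measurable_funD.
have DU v : `|D v| <= 4 * U.
  rewrite /D; have := uU (x - v); have := uU (y - v); have := uU (z - v).
  rewrite !ler_norml => /andP[? ?] /andP[? ?] /andP[? ?].
  by apply/andP; split; lra.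
have DD v : `|D 0 - D v| <= 8 * U.
  have := DU v; have := DU 0; rewrite !ler_norml => /andP[? ?] /andP[? ?].
  by apply/andP; split; lra.
have T01 v : 0 <= 1 - radial_cutoff r v by rewrite subr_ge0; exact: cutoff_le1.
have T1 v : 1 - radial_cutoff r v <= 1 by rewrite lerBlDr lerDl; exact: cutoff_ge0.
have mT : measurable_fun (outside rho) (fun v => radial_cutoff r v : R).
  exact: measurable_radial_cutoffS.
have mDO : measurable_fun (outside rho) (fun v => D 0 - D v).
  by apply: measurable_funB => //; exact: measurable_funTS.
have i1 : mu.-integrable (outside rho)
    (EFin \o (fun v => (D 0 - D v) * (1 - radial_cutoff r v) * k v)).
  apply: (@integrable_bounded_mul _ _ _ _ _ _ _ (8 * U * 1)) => //.
    by apply: measurable_funM => //; apply: measurable_funB.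
  by move=> v _; rewrite normrM (ger0_norm (T01 _)); apply: ler_pM.
have iT : mu.-integrable (outside rho) (EFin \o (fun v => radial_cutoff r v * k v)).
  apply: (@integrable_bounded_mul _ _ _ _ _ _ _ 1) => //.
  by move=> v _; rewrite ger0_norm; [exact: cutoff_le1|exact: cutoff_ge0].
have iDT : mu.-integrable (outside rho)
    (EFin \o (fun v => D v * (radial_cutoff r v * k v))).
  apply: (@integrable_bounded_mul _ _ _ _ _ _ _ (4 * U)) => //.
  exact: measurable_funTS.
(* Split [1] into [1 - radial_cutoff] and [radial_cutoff]. Near the origin the quadratic bound
   applies; far away [D 0] multiplies the mass of the cut kernel, and [D v] is left to the
   second-difference estimate. *)
have -> : \int[mu]_(v in outside rho) ((D 0 - D v) * k v) =
    \int[mu]_(v in outside rho) ((D 0 - D v) * (1 - radial_cutoff r v) * k v) +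
    (D 0 * \int[mu]_(v in outside rho) (radial_cutoff r v * k v) +
    (- 1) * \int[mu]_(v in outside rho) (D v * (radial_cutoff r v * k v))).
  rewrite -RintegralZl// -RintegralZl// -RintegralD//; last 2 first.
  - exact: integrable_EFinZl.
  - exact: integrable_EFinZl.
  rewrite -RintegralD//; last first.
    by apply: integrable_EFinD => //; exact: integrable_EFinZl.
  by apply: eq_Rintegral => v _; ring.
have e1 : \int[mu]_(v in outside rho) ((D 0 - D v) * (1 - radial_cutoff r v) * k v)
    <= Q * (Lam * (@near_const R n s * (2 * r) `^ (2 - 2 * s))).
  apply: (Rintegral_near_le s0 s1 lam0 lamLam hK rho0 r0 Q0 _ DD DQ).
  exact: measurable_funB.
have e2 := Rintegral_far_ge n0 s0 lam0 lamLam hK rho0 rhor.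
have e3 : `|\int[mu]_(v in outside rho) (D v * (radial_cutoff r v * k v))| <=
  U * (@diff_const R n s Lam * (@tail_const R n s * (r / 2) `^ (- 2 * s)) *
    ((enorm h / r) ^+ 2 + enorm m / r)).
  have -> : \int[mu]_(v in outside rho) (D v * (radial_cutoff r v * k v)) =
      \int[mu]_v (D v * cut_kernel K r v).
    apply/esym; apply: Rintegral_restrict => // v _; rewrite /outside/= => /negP.
    rewrite -ltNge => vr.
    by rewrite cut_kernel_eq0 ?mulr0// (le_trans (ltW vr)).
  exact: Rintegral_second_difference.
move: e1 e2 e3; set I1 := \int[mu]_(v in _) _; set I2 := \int[mu]_(v in _) _.
set I3 := \int[mu]_(v in _) _; set c := lam * _ * _.
move: (I1) (I2) (I3) (D 0) DA => {}I1 {}I2 {}I3 D0 DA e1 e2.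
rewrite ler_norml => /andP[e3 e4].
have c0 : 0 <= c by rewrite !mulr_ge0 ?powR_ge0// ltW.
have : D0 * I2 <= - (A * c).
  rewrite -mulNr -lerN2 -!mulNr opprK.
  rewrite (@le_trans _ _ (A * I2))//; first by rewrite ler_wpM2l.
  by rewrite ler_wpM2r ?(le_trans c0)// lerNr.
by move: e1 e2 e3 e4; lra.
Qed.

End split_kernel.

(** * Consequences of the viscosity inequalities *)

Section quadratic.
Context {R : realType} {n : nat}.
Implicit Types (x y v p : 'rV[R]_n) (a c : R).

Lemma is_derive_coord y v (i : 'I_n) :
  is_derive y v (fun x : 'rV[R]_n => x ord0 i : R) (v ord0 i).
Proof.
have dc := @differentiable_coord R 1 n y ord0 i.
apply: DeriveDef; first exact: diff_derivable.
have := @derive_id R 'rV[R]_n y v.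
rewrite derive_mx => [/(congr1 (fun M : 'rV[R]_n => M ord0 i))|]; first by rewrite mxE.
exact: (@derivable_id R 'rV[R]_n).
Qed.

Definition quadratic a p c x y : R := a + dot p (y - x) + c * enorm (y - x) ^+ 2.

Lemma is_derive_quadratic a p c x y v :
  is_derive y v (quadratic a p c x) (dot (p + (2 * c) *: (y - x)) v).
Proof.
pose f i : 'rV[R]_n -> R := (fun y => y ord0 i) - cst (x ord0 i).
have fd i : is_derive y v (f i) (v ord0 i).
  apply: (is_derive_eq (is_deriveB (is_derive_coord y v i) (is_derive_cst _ _ _))).
  by rewrite subr0.
have -> : quadratic a p c x = cst a + \sum_i (p ord0 i \*: f i + c \*: (f i * f i)).
  apply/funext => z; rewrite /quadratic enorm_sqr /dot mulr_sumr -addrA -big_split/=.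
  rewrite fctE fct_sumE; congr (_ + _); apply: eq_bigr => i _ /=.
  by rewrite !fctE !mxE.
have H := is_deriveD (is_derive_cst a y v) (is_derive_sum (fun i =>
  is_deriveD (is_deriveZ (p ord0 i) (fd i)) (is_deriveZ c (is_deriveM (fd i) (fd i))))).
apply: (is_derive_eq H).
rewrite add0r; apply: eq_bigr => i _; rewrite !mxE /f !fctE /GRing.scale/=.
by ring.
Qed.

Lemma grad_quadratic a p c x :
  grad (quadratic a p c x) = fun y => p + (2 * c) *: (y - x).
Proof.
apply/funext => y; apply/rowP => i; rewrite mxE.
rewrite (@derive_val _ _ _ _ _ _ _ (is_derive_quadratic _ _ _ _ _ _)).
rewrite /dot (bigD1 i)//= !mxE !eqxx mulr1 big1 ?addr0// => j ji.
by rewrite !mxE (negbTE ji) mulr0.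
Qed.

Lemma hess_quadratic a p c x y : hess (quadratic a p c x) y = (2 * c)%:M.
Proof.
apply/matrixP => i j; rewrite !mxE.
have -> : 'D_(delta_mx ord0 j) (quadratic a p c x) =
    (fun y => p ord0 j + 2 * c * (y ord0 j - x ord0 j)).
  apply/funext => z; transitivity (grad (quadratic a p c x) z ord0 j).
    by rewrite mxE.
  by rewrite grad_quadratic !mxE.
have -> : (fun y => p ord0 j + 2 * c * (y ord0 j - x ord0 j)) =
    (cst (p ord0 j) + (2 * c) \*: ((fun y => y ord0 j) - cst (x ord0 j))
      : 'rV[R]_n -> R).
  by apply/funext => z; rewrite !fctE.
rewrite (@derive_val _ _ _ _ _ _ _ (is_deriveD (is_derive_cst _ _ _)
  (is_deriveZ (2 * c) (is_deriveB (is_derive_coord _ _ _) (is_derive_cst _ _ _))))).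
rewrite add0r subr0 !mxE eqxx/= /GRing.scale/= [j == i]eq_sym.
by case: (i == j); rewrite ?mulr1 ?mulr0.
Qed.

Lemma C2_on_quadratic (N : set 'rV[R]_n) a p c x : C2_on N (quadratic a p c x).
Proof.
have dcoord (z : 'rV[R]_n) i := @differentiable_coord R 1 n z ord0 i.
move=> y _; split; last first.
  rewrite (_ : hess _ = cst (2 * c)%:M); last first.
    by apply/funext => z; exact: hess_quadratic.
  exact: cst_continuous.
split.
  have -> : quadratic a p c x = cst a + \sum_i (p ord0 i \*:
      ((fun y => y ord0 i) - cst (x ord0 i)) +
      c \*: (((fun y => y ord0 i) - cst (x ord0 i)) *
              ((fun y => y ord0 i) - cst (x ord0 i)))).
    apply/funext => z; rewrite /quadratic enorm_sqr /dot mulr_sumr -addrA -big_split/=.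
    rewrite fctE fct_sumE; congr (_ + _); apply: eq_bigr => i _ /=.
    by rewrite !fctE !mxE.
  apply: differentiableD => //; apply: differentiable_sum => i.
  apply: differentiableD; apply: differentiableZ; last apply: differentiableM;
    exact: differentiableB.
rewrite grad_quadratic.
have -> : (fun y => p + (2 * c) *: (y - x)) = cst p + (2 * c) \*: (id - cst x).
  by apply/funext => z; rewrite !fctE.
by apply: differentiableD => //; apply: differentiableZ; exact: differentiableB.
Qed.

End quadratic.

(** * Principal values for patched paraboloids *)

Section principal_value.
Context {R : realType} {n : nat}.
Variables (s lam Lam : R).
Local Notation mu := (@lebesgue_rV R n).
Local Notation pk := (@power_kernel R n s).
Implicit Types (K : 'rV[R]_n -> \bar R) (u : 'rV[R]_n -> R) (rho eps : R).

Definition ball_at (x : 'rV[R]_n) rho := [set y : 'rV[R]_n | enorm (y - x) < rho].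

(** The contribution from outside the touching ball, in the variable [v = x - y]: it involves [u]
    alone, not the test function. *)
Definition tail_op K u (x : 'rV[R]_n) rho : R :=
  \int[mu]_(v in outside rho) ((u x - u (x - v)) * fine (K v)).

Definition annulus eps rho := [set v : 'rV[R]_n | eps < enorm v < rho].

Lemma measurable_annulus eps rho : measurable (annulus eps rho).
Proof.
rewrite (_ : annulus _ _ = [set v | eps < enorm v] `&` [set v | enorm v < rho]).
  by apply: measurableI; [exact: measurable_enorm_gt|exact: measurable_enorm_lt].
by apply/seteqP; split => v /= /andP.
Qed.

Lemma measurable_patch (N : set 'rV[R]_n) (f g : 'rV[R]_n -> R) : measurable N ->
  measurable_fun setT f -> measurable_fun setT g -> measurable_fun setT (patch f N g).
Proof.
move=> mN mf mg; apply: measurable_fun_ifT => //.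
apply: (measurable_fun_bool true); rewrite setTI.
rewrite (_ : _ @^-1` _ = N)//; apply/seteqP; split => x /=; [exact: set_mem|exact: mem_set].
Qed.

Lemma measurable_quadratic (a : R) (p : 'rV[R]_n) (c : R) (x : 'rV[R]_n) :
  measurable_fun setT (quadratic a p c x).
Proof.
apply: continuous_measurable_rV => y.
have [[dq _] _] := @C2_on_quadratic R n setT a p c x y I.
exact: differentiable_continuous.
Qed.

Lemma Rintegral_annulus_near K eps rho : 0 <= s -> s < 1 -> 0 < lam -> lam <= Lam ->
  kernel_class s lam Lam K -> 0 <= eps -> 0 < rho ->
  (\int[mu]_(v in annulus eps rho) (enorm v ^+ 2 * fine (K v))%:E <=
  (Lam * (@near_const R n s * rho `^ (2 - 2 * s)))%:E)%E.
Proof.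
move=> s0 s1 lam0 lamLam hK eps0 rho0.
have Lam0 : 0 < Lam by exact: lt_le_trans lamLam.
pose near := [set v : 'rV[R]_n | enorm v < rho].
have mnear : measurable near by exact: measurable_enorm_lt.
have mA : measurable (annulus eps rho) by exact: measurable_annulus.
have mg : measurable_fun setT (fun v : 'rV[R]_n => enorm v ^+ 2 * pk v).
  apply: measurable_funM; last exact: measurable_power_kernel.
  by apply: measurable_funX; exact: measurable_enorm.
have g0 v : 0 <= enorm v ^+ 2 * pk v.
  by rewrite mulr_ge0 ?power_kernel_ge0// sqr_ge0.
apply: (@le_trans _ _ (\int[mu]_(v in annulus eps rho)
    (Lam * (enorm v ^+ 2 * pk v))%:E)%E).
  apply: ge0_le_integral => //.
  - by move=> v _; rewrite lee_fin mulr_ge0 ?(kernel_fin_ge0 hK)// sqr_ge0.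
  - apply/measurable_EFinP; apply: measurable_funM.
      by apply: measurable_funX; exact: measurable_enormS.
    apply: (measurable_funS _ _ (measurable_jump_kernel hK)).
      exact: measurable_enorm_gt.
    by move=> v /= /andP[h _]; exact: le_lt_trans h.
  - apply/measurable_EFinP; apply: measurable_funM => //.
    exact: measurable_funTS.
  move=> v /= /andP[v1 _]; have v0 : v != 0 by rewrite -enorm_gt0 (le_lt_trans eps0).
  rewrite lee_fin [leRHS]mulrCA ler_wpM2l ?sqr_ge0//.
  exact: (kernel_fin_upper hK v0).
apply: (@le_trans _ _ (\int[mu]_(v in near) (Lam * (enorm v ^+ 2 * pk v))%:E)%E).
  apply: ge0_subset_integral => //.
  - apply/measurable_EFinP; apply: measurable_funM => //.
    exact: measurable_funTS.
  - by move=> v _; rewrite lee_fin mulr_ge0// ltW.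
  by move=> v /= /andP[].
under eq_integral do rewrite EFinM.
rewrite ge0_integralZl_EFin ?(ltW Lam0)//; last 2 first.
- by move=> v _; rewrite lee_fin.
- by apply/measurable_EFinP; exact: measurable_funTS.
rewrite [leRHS]EFinM lee_wpmul2l ?lee_fin ?(ltW Lam0)//.
exact: integral_power_kernel_near.
Qed.

(** Inside the ball [w x - w (x - v)] equals [dot p v - c |v|^2]. The first term cancels by oddness
    on each annulus; the integrals of [|v|^2 K] increase to a finite limit [G] as [eps] decreases.
    The bound on [G] tends to 0 with [rho]. *)
Lemma pv_op_patch_quadratic K u (U : R) (x p : 'rV[R]_n) (c rho : R)
    (w := patch u (ball_at x rho) (quadratic (u x) p c x)) :
  0 < s -> s < 1 -> 0 < lam -> lam <= Lam -> kernel_class s lam Lam K -> 0 < rho ->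
  measurable_fun setT u -> (forall v, `|u v| <= U) ->
  exists2 G : R, 0 <= G <= Lam * (@near_const R n s * rho `^ (2 - 2 * s)) &
    pv_op K w x = (tail_op K u x rho - c * G)%:E.
Proof.
move=> s0 s1 lam0 lamLam hK rho0 mu_ uU.
set bound := Lam * _.
pose k := fine \o K.
pose g eps := \int[mu]_(v in annulus eps rho) (enorm v ^+ 2 * k v).
pose F eps := (\int[mu]_(y in [set y | (eps < enorm (x - y))%R])
          ((w x - w y)%:E * K (x - y)%R))%E.
have ball_meas : measurable (ball_at x rho).
  by apply: open_measurable_rV; exact: open_eball_at.
have mw : measurable_fun setT w.
  by apply: measurable_patch => //; exact: measurable_quadratic.
have wx : w x = u x.
  rewrite /w /patch ifT; last by rewrite inE /ball_at/= subrr enorm0.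
  by rewrite /quadratic subrr /dot big1 ?enorm0 ?expr0n ?mulr0 ?addr0// => i _;
    rewrite mxE mulr0.
pose B := `|u x| + enorm p * rho + `|c| * rho ^+ 2 + U.
have U0 : 0 <= U by apply: le_trans (uU 0).
have wB v : `|w v| <= B.
  rewrite /w /patch; case: ifPn => [|_]; last first.
    rewrite (le_trans (uU v))// lerDr !addr_ge0//.
      by rewrite mulr_ge0 ?enorm_ge0// ltW.
    by rewrite mulr_ge0 ?sqr_ge0.
  rewrite inE /ball_at/= => vx; rewrite /B /quadratic.
  apply: (@le_trans _ _ (`|u x| + enorm p * rho + `|c| * rho ^+ 2)); last by rewrite lerDl.
  rewrite (le_trans (ler_normD _ _))// lerD//.
    rewrite (le_trans (ler_normD _ _))// lerD//.
    by rewrite (le_trans (normr_dot _ _))// ler_wpM2l ?enorm_ge0// ltW.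
  rewrite normrM ler_wpM2l// ger0_norm ?sqr_ge0//.
  by rewrite ler_pXn2r ?nnegrE ?enorm_ge0// ltW.
have iw eps : 0 < eps -> mu.-integrable [set v | eps < enorm v]
    (EFin \o (fun v => (w x - w (x - v)) * k v)).
  move=> eps0; apply: (@integrable_bounded_mul _ _ _ _ _ _ _ (B + B)) => //.
  - exact: measurable_enorm_gt.
  - apply: (integrableS (measurable_outside eps)).
    + exact: measurable_enorm_gt.
    + by move=> v /= /ltW.
    + exact: (integrable_kernel s0 lam0 lamLam hK).
  - apply: measurable_funTS; apply: measurable_funB => //.
    by apply: (measurableT_comp mw); exact: measurable_reflect_rV.
  by move=> v _; rewrite (le_trans (ler_normB _ _))// lerD.
have FE eps : 0 < eps -> F eps =
    (\int[mu]_(v in [set v | (eps < enorm v)%R]) ((w x - w (x - v)) * k v)%R%:E)%E.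
  move=> eps0; rewrite /F.
  (* The kernel is known to be measurable only off the origin; its extension by zero is measurable
     everywhere. *)
  pose k0 : 'rV[R]_n -> R := k \_ [set v | 0 < enorm v].
  have mk0 : measurable_fun setT k0.
    apply/(measurable_restrictT _ _).1; first exact: measurable_enorm_gt.
    exact: (measurable_jump_kernel hK).
  have k0E v : eps < enorm v -> k0 v = k v.
    by move=> ev; rewrite /k0 /patch ifT// inE/=; exact: lt_trans ev.
  have mD : measurable [set y : 'rV[R]_n | eps < enorm (x - y)].
    rewrite -[X in measurable X]setTI.
    exact: (measurable_reflect_rV x measurableT (measurable_enorm_gt eps)).
  transitivity (\int[mu]_(y in [set y | (eps < enorm (x - y))%R])
      ((w x - w y) * k0 (x - y))%R%:E)%E.
    apply: eq_integral => y; rewrite inE/= => ey.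
    rewrite EFinM k0E// (kernel_fin hK)// -enorm_gt0; exact: lt_trans ey.
  rewrite (integral_reflect_rV x mD); last first.
    apply/measurable_EFinP; apply: measurable_funTS.
    apply: measurable_funM; first exact: measurable_funB.
    by apply: (measurableT_comp mk0); exact: measurable_reflect_rV.
  have -> : (fun x0 => x - x0) @^-1` [set y | eps < enorm (x - y)] =
      [set v | eps < enorm v].
    by apply/seteqP; split => v /=; rewrite subKr.
  by apply: eq_integral => v; rewrite inE/= => ev; rewrite subKr k0E.
have ann_outside eps : [set v : 'rV[R]_n | eps < enorm v] `<=` outside eps.
  by move=> v /= /ltW.
have i2 eps : 0 < eps -> mu.-integrable (annulus eps rho)
    (EFin \o (fun v => enorm v ^+ 2 * k v)).
  move=> eps0; apply: (@integrable_bounded_mul _ _ _ _ _ _ _ (rho ^+ 2)) => //.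
  - exact: measurable_annulus.
  - apply: (integrableS (measurable_outside eps)).
    + exact: measurable_annulus.
    + by move=> v /= /andP[/ltW].
    + exact: (integrable_kernel s0 lam0 lamLam hK).
  - by apply: measurable_funX; exact: measurable_enormS.
  move=> v /= /andP[_ vr]; rewrite ger0_norm ?sqr_ge0//.
  by rewrite ler_pXn2r ?nnegrE ?enorm_ge0// ltW.
have i1 eps : 0 < eps -> mu.-integrable (annulus eps rho)
    (EFin \o (fun v => dot p v * k v)).
  move=> eps0; apply: (@integrable_bounded_mul _ _ _ _ _ _ _ (enorm p * rho)) => //.
  - exact: measurable_annulus.
  - apply: (integrableS (measurable_outside eps)).
    + exact: measurable_annulus.
    + by move=> v /= /andP[/ltW].
    + exact: (integrable_kernel s0 lam0 lamLam hK).
  - exact: measurable_dotS.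
  move=> v /= /andP[_ vr]; rewrite (le_trans (normr_dot _ _))//.
  by rewrite ler_wpM2l ?enorm_ge0// ltW.
have Fg eps : 0 < eps < rho -> F eps = (tail_op K u x rho - c * g eps)%:E.
  move=> /andP[eps0 er]; rewrite FE//.
  have mA := measurable_annulus eps rho.
  have mO : measurable (@outside R n rho) := measurable_outside rho.
  have -> : [set v : 'rV[R]_n | eps < enorm v] = outside rho `|` annulus eps rho.
    apply/seteqP; split => v /=; rewrite /outside /annulus/=.
      by move=> ev; case: (leP rho (enorm v)) => h; [left|right; rewrite ev].
    by case=> [/(lt_le_trans er)//|/andP[]].
  have iw' := iw _ eps0.
  rewrite -[LHS]fineK; last first.
    apply: integrable_fin_num; first exact: measurableU.
    apply: integrableS iw' => //; first exact: measurable_enorm_gt.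
      exact: measurableU.
    by move=> v [/(lt_le_trans er)//|/andP[]].
  congr EFin; rewrite -[LHS]/(Rintegral _ _ _) Rintegral_setU//; last 2 first.
  - apply: integrableS iw' => //; first exact: measurable_enorm_gt.
      exact: measurableU.
    by move=> v [/(lt_le_trans er)//|/andP[]].
  - apply/disj_setPS => v [] /=; rewrite /outside /annulus/= => h /andP[_].
    by rewrite ltNge h.
  congr (_ + _).
    apply: eq_Rintegral => v; rewrite inE /outside/= => rv.
    rewrite wx {1}/w /patch ifF//; apply/negbTE; rewrite notin_setE /ball_at/=.
    by rewrite addrAC subrr add0r enormN; apply/negP; rewrite -leNgt.
  transitivity (\int[mu]_(v in annulus eps rho)
      (dot p v * k v + (- c) * (enorm v ^+ 2 * k v))).
    apply: eq_Rintegral => v; rewrite inE /annulus/= => /andP[_ vr].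
    rewrite wx {1}/w /patch ifT; last first.
      by rewrite inE /ball_at/= addrAC subrr add0r enormN.
    rewrite /quadratic [x - v - x]addrAC subrr add0r dotNr enormN.
    by ring.
  rewrite RintegralD//; [|exact: i1|by apply: integrable_EFinZl => //; exact: i2].
  rewrite Rintegral_odd//; last 3 first.
  - by move=> v; rewrite /annulus/= enormN.
  - exact: i1.
  - by move=> v; rewrite dotNr [k _](kernel_finN hK) mulNr.
  by rewrite add0r RintegralZl ?mulNr//; exact: i2.
have gE eps : 0 < eps -> (g eps)%:E =
    (\int[mu]_(v in annulus eps rho) (enorm v ^+ 2 * k v)%:E)%E.
  move=> eps0; rewrite /g /Rintegral fineK//; apply: integrable_fin_num.
    exact: measurable_annulus.
  exact: i2.
have k20 v : 0 <= enorm v ^+ 2 * k v.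
  by rewrite mulr_ge0 ?(kernel_fin_ge0 hK)// sqr_ge0.
have g0 eps : 0 <= g eps by apply: Rintegral_ge0 => v _.
have gb eps : 0 < eps -> g eps <= bound.
  move=> eps0; rewrite -lee_fin gE//.
  by apply: Rintegral_annulus_near => //; exact: ltW.
(* A smaller [eps] means a larger annulus and the integrand is nonnegative, so the limit at [0^'+]
   exists and is the supremum. *)
have gmono : {in `]0, rho[ &, nonincreasing_fun g}.
  move=> a b; rewrite !in_itv/= => /andP[a0 _] /andP[b0 _] ba.
  rewrite -lee_fin !gE//; apply: ge0_subset_integral.
  - exact: measurable_annulus.
  - exact: measurable_annulus.
  - exact: (measurable_int mu (i2 _ _)).
  - by move=> v _; rewrite lee_fin.
  move=> v; rewrite /annulus/= => /andP[av vr]; apply/andP; split => //.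
  exact: le_lt_trans av.
have [G0 Gb gcvg] : [/\ 0 <= sup (g @` `]0, rho[), sup (g @` `]0, rho[) <= bound &
    g e @[e --> 0^'+] --> sup (g @` `]0, rho[)].
  have rin : (rho / 2) \in `]0, rho[.
    by rewrite in_itv/=; apply/andP; split; lra.
  have ub : ubound (g @` `]0, rho[) bound.
    by move=> _ [e /= + <-]; rewrite in_itv/= => /andP[e0 _]; exact: gb.
  split.
  - apply: (@le_trans _ _ (g (rho / 2))) => //; apply: ub_le_sup.
      by exists bound.
    by exists (rho / 2).
  - by apply: ge_sup => //; exists (g (rho / 2)), (rho / 2).
  - apply: (@nonincreasing_at_right_cvgr _ g 0 (BLeft rho)) => //.
    by exists bound.
exists (sup (g @` `]0, rho[)); first by rewrite G0.
have Fcvg : F e @[e --> 0^'+] --> (tail_op K u x rho - c * sup (g @` `]0, rho[))%:E.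
  have near_in : \forall e \near 0^'+, 0 < e < rho.
    near=> e; apply/andP; split; near: e; [exact: nbhs_right_gt|exact: nbhs_right_lt].
  apply/fine_cvgP; split.
    by near=> e; rewrite Fg//; near: e.
  have cv : tail_op K u x rho - c * g e @[e --> 0^'+] -->
      tail_op K u x rho - c * sup (g @` `]0, rho[).
    by apply: cvgB; [exact: cvg_cst|apply: cvgM => //; exact: cvg_cst].
  apply: cvg_trans cv; apply: near_eq_cvg; near=> e.
  by rewrite /= Fg//; near: e.
exact: cvg_lim Fcvg.
Unshelve. all: by end_near. Qed.

End principal_value.

(** * Null sets and a bounded Borel representative *)

Section integral_modification.
Context d (T : measurableType d) (R : realType) (mu : {measure set T -> \bar R}).
Local Open Scope ereal_scope.

Import HBNNSimple.

(* The integral of a nonnegative function is a supremum over simple functions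
   below it, measurable or not. *)
Lemma ge0_le_integral_null (N : set T) (f g : T -> \bar R) :
  measurable N -> mu N = 0 -> (forall x, 0 <= f x) -> (forall x, 0 <= g x) ->
  (forall x, ~ N x -> f x = g x) -> \int[mu]_x f x <= \int[mu]_x g x.
Proof.
move=> mN N0 f0 g0 fg; rewrite !ge0_integralTE//.
apply: ge_ereal_sup => _ /= [h hf <-].
have mC : measurable (~` N) by exact: measurableC.
apply: ereal_sup_ubound; exists (proj_nnsfun h mC).
  move=> x /=; rewrite mindicE; have [xN|xN] := boolP (x \in ~` N).
    by rewrite mulr1 -fg ?hf//; move: xN; rewrite inE.
  by rewrite mulr0.
rewrite -!integralT_nnsfun; apply: ge0_ae_eq_integral => //.
- exact/measurable_EFinP.
- exact/measurable_EFinP.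
- by move=> x _; rewrite lee_fin.
- by move=> x _; rewrite lee_fin.
exists N; split => // x /= hx; apply: contrapT => xN; apply: hx => _.
by rewrite mindicE mem_set// mulr1.
Qed.

(** Stated for arbitrary functions because [u] is merely equal almost everywhere to a Borel
    function. *)
Lemma integral_eq_null (D N : set T) (f g : T -> \bar R) :
  measurable N -> mu N = 0 -> (forall x, ~ N x -> f x = g x) ->
  \int[mu]_(x in D) f x = \int[mu]_(x in D) g x.
Proof.
move=> mN N0 fg; rewrite integral_mkcond [RHS]integral_mkcond.
have {}fg x : ~ N x -> (f \_ D) x = (g \_ D) x by move=> /fg; rewrite /patch => ->.
move: (f \_ D) (g \_ D) fg => {}f {}g fg.
rewrite integralE [RHS]integralE; congr (_ - _); apply/eqP; rewrite eq_le;
  apply/andP; split; apply: (ge0_le_integral_null mN) => // x;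
  rewrite ?funepos_ge0 ?funeneg_ge0// ?funeposE ?funenegE => /fg ->//.
Qed.

End integral_modification.

Section representative.
Context {R : realType} {n : nat}.
Local Notation mu := (@lebesgue_rV R n).
Implicit Types (u v : 'rV[R]_n -> R).

(** This is what upgrades the almost everywhere bound [|u| <= U] to every point of the ball, by
    continuity. *)
Lemma open_lebesgue_rV_gt0 (W : set 'rV[R]_n) (x : 'rV[R]_n) :
  open W -> W x -> (0 < mu W)%E.
Proof.
move=> oW Wx; have mW := open_measurable_rV oW.
have /nbhs_ballP[e /= e0 xeW] : nbhs x W by apply: open_nbhs_nbhs.
pose A (i : 'I_n) := `[x ord0 i - e / 2, x ord0 i + e / 2]%classic.
pose box := [set y : 'rV[R]_n | forall i, A i (y ord0 i)].
have mA i : measurable (A i) by exact: measurable_itv.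
have mbox : measurable box by exact: measurable_box.
have boxW : box `<=` W.
  move=> y yA; apply: xeW; rewrite mx_norm_ball /ball_/=.
  rewrite (@le_lt_trans _ _ (e / 2))//; last by rewrite ltr_pdivrMr// ltr_pMr// ltr1n.
  rewrite [leLHS]/Num.norm/= mx_normrE; apply/bigmax_leP => /=.
  split; first by rewrite divr_ge0// ltW.
  move=> [i j] _ /=; rewrite ord1 !mxE; have := yA j.
  by rewrite /A/= in_itv/= => h; rewrite distrC ler_distl.
apply: (@lt_le_trans _ _ (mu box)); last by apply: le_measure; rewrite ?inE.
rewrite [ltRHS](lebesgue_rV_box mA) (eq_bigr (fun=> e%:E)) => [|i _].
  by rewrite prodEFin prodr_const card_ord lte_fin exprn_gt0.
rewrite lebesgue_measure_itv/= lte_fin ifT; last by rewrite ltrBlDr -addrA ltrDl; lra.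
by rewrite -EFinB; congr EFin; field.
Qed.

(** [v] is [u] itself on the unit ball, where values matter pointwise and continuity gives
    measurability. Elsewhere it is the Borel representative, truncated so that the norm bounds it at
    every point. *)
Lemma Linfty_representative u :
  (forall x, eball 1 x -> {for x, continuous u}) -> Linfty u ->
  exists v, [/\ measurable_fun setT v, (forall x, `|v x| <= Linfty_norm u),
    (forall x, eball 1 x -> v x = u x) &
    exists N, [/\ measurable N, mu N = 0%E & forall x, ~ N x -> u x = v x]].
Proof.
move=> uc [u0 u0P uu0].
have mu0 : measurable_fun setT u0 := set_mem (sub_Lfun_mfun u0P).
have muT : (0 < mu setT)%E by exact: (@open_lebesgue_rV_gt0 _ 0 openT).
have fu0 : (ess_sup mu (abse \o (EFin \o u0)) < +oo)%E.
  by have := set_mem (sub_Lfun_finLfun u0P); rewrite /= /finite_norm unlock /= muT.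
have eqsup : ess_sup mu (abse \o (EFin \o u)) = ess_sup mu (abse \o (EFin \o u0)).
  by apply: eq_ess_sup; apply: filterS uu0 => x /= ->.
set U := Linfty_norm u.
have UE : U%:E = ess_sup mu (abse \o (EFin \o u)).
  rewrite /U /Linfty_norm unlock /= muT fineK// ge0_fin_numE ?eqsup//.
  by rewrite -eqsup; apply: ess_sup_gee => //; apply: aeW => x; exact: abse_ge0.
have [N [mN N0 NP]] : exists N, [/\ measurable N, mu N = 0%E &
    forall x, ~ N x -> u x = u0 x /\ `|u x| <= U].
  have [N [mN N0 NP]] : {ae mu, forall x, u x = u0 x /\ `|u x| <= U}.
    have H := ess_sup_ge mu (abse \o (EFin \o u)); rewrite -UE in H.
    by apply: filterS2 uu0 H => x /= h1 h2; split; [exact: h1|rewrite -lee_fin].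
  by exists N; split => // x Nx; apply: contrapT => h; apply: Nx; exact: NP.
have mB : measurable (@eball R n 1) by apply: open_measurable_rV; exact: open_eball.
(* Inside the ball the set where [|u| > U] is open and null, hence empty. *)
have uU x : eball 1 x -> `|u x| <= U.
  move=> Bx; rewrite leNgt; apply/negP => Uux.
  pose W := eball 1 `&` [set y | U < `|u y|].
  have oW : open W.
    rewrite openE => y [By Uy]; rewrite /interior.
    have uy := uc _ By; have oB : nbhs y (@eball R n 1).
      by apply: open_nbhs_nbhs; split => //; exact: open_eball.
    have : \forall z \near y, U < `|u z|.
      have nc : {for y, continuous (fun z => `|u z|)}.
        by apply: continuous_comp => //; exact: norm_continuous.
      by apply: (cvgr_gt _ nc).
    by move=> h; near=> z; split; near: z.
  have : (0 < mu W)%E by exact: (@open_lebesgue_rV_gt0 _ x oW).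
  suff -> : mu W = 0%E by rewrite ltxx.
  apply: (subset_measure0 (open_measurable_rV oW) mN _ N0) => y [_ /= Uy].
  by apply: contrapT => /NP[_]; rewrite leNgt Uy.
pose u1 x := if `|u0 x| <= U then u0 x else 0.
have U0 : 0 <= U.
  rewrite -lee_fin UE; apply: ess_sup_gee => //; apply: aeW => x; exact: abse_ge0.
have mu1 : measurable_fun setT u1.
  apply: measurable_fun_ifT => //.
  by apply: measurable_fun_ler => //; exact: measurableT_comp.
have mu2 : measurable_fun setT (u \_ (@eball R n 1)).
  apply: (measurable_restrictT _ mB).1.
  by apply: continuous_on_measurable_rV; [exact: open_eball|exact: uc].
exists (patch u1 (eball 1) (u \_ (eball 1))); split.
- exact: measurable_patch.
- move=> x; rewrite {1}/patch; case: ifPn => [xB|_].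
    by rewrite /patch xB; apply: uU; exact: set_mem.
  by rewrite /u1; case: ifPn => // _; rewrite normr0.
- by move=> x Bx; rewrite /patch mem_set.
exists N; split => // x /NP[uu0x uxU]; rewrite {1}/patch.
case: ifPn => [xB|_]; first by rewrite /patch xB.
by rewrite /u1 -uu0x uxU.
Unshelve. all: by end_near. Qed.

(** Test functions see only values in [D], where [u] and [v] agree; off the touching neighbourhood
    the operator sees only integrals, which ignore null sets. *)
Lemma viscosity_solution_null (Gamma : Type) (K : Gamma -> 'rV[R]_n -> \bar R)
    (D N0 : set 'rV[R]_n) u v :
  measurable N0 -> mu N0 = 0%E -> (forall x, ~ N0 x -> u x = v x) ->
  (forall x, D x -> v x = u x) ->
  viscosity_solution (inf_op K) D u -> viscosity_solution (inf_op K) D v.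
Proof.
move=> mN N00 uv vu visc x0 N phi Dx0 oN Nx0 ND C2 phix0.
have pvE g : pv_op (K g) (patch v N phi) x0 = pv_op (K g) (patch u N phi) x0.
  have FE : (fun eps : R => \int[mu]_(y in [set y | (eps < enorm (x0 - y))%R])
        ((patch v N phi x0 - patch v N phi y)%:E * K g (x0 - y)%R))%E =
      (fun eps : R => \int[mu]_(y in [set y | (eps < enorm (x0 - y))%R])
        ((patch u N phi x0 - patch u N phi y)%:E * K g (x0 - y)%R))%E.
    apply/funext => eps; apply: (@integral_eq_null _ _ _ mu _ _ _ _ mN N00) => y Ny.
    congr (_%:E * _)%E; rewrite /patch (mem_set Nx0).
    by case: ifPn => // _; rewrite uv.
  by rewrite /pv_op FE.
have E : inf_op K (patch v N phi) x0 = inf_op K (patch u N phi) x0.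
  have /funext pvEf : (fun g => pv_op (K g) (patch v N phi) x0) =1
    (fun g => pv_op (K g) (patch u N phi) x0) by exact: pvE.
  exact: (congr1 (fun F : Gamma -> \bar R => ereal_inf (F @` [set: Gamma])) pvEf).
rewrite E.
have [h1 h2] := visc x0 N phi Dx0 oN Nx0 ND C2 (etrans phix0 (vu _ Dx0)).
split=> h.
  by apply: h1 => y Ny; rewrite -(vu _ (ND _ Ny)); exact: h.
by apply: h2 => y Ny; rewrite -(vu _ (ND _ Ny)); exact: h.
Qed.

End representative.

(** * Touching by paraboloids from below and from above *)

Section touching.
Context {R : realType} {n : nat}.
Variables (s lam Lam : R) (Gamma : Type) (K : Gamma -> 'rV[R]_n -> \bar R).
Variables (u : 'rV[R]_n -> R) (U : R).
Local Notation mu := (@lebesgue_rV R n).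
Implicit Types (x y z p v : 'rV[R]_n) (c rho : R).

Definition near_bound rho : R := Lam * (@near_const R n s * rho `^ (2 - 2 * s)).

(** A nonnegative infimum makes every operator nonnegative, so the conclusion holds for all [g].
    Touching from above only supplies one near-minimiser. *)
Lemma touching_below x p c rho :
  0 < s -> s < 1 -> 0 < lam -> lam <= Lam -> (forall g, kernel_class s lam Lam (K g)) ->
  measurable_fun setT u -> (forall v, `|u v| <= U) ->
  viscosity_solution (inf_op K) (eball 1) u ->
  0 < rho -> ball_at x rho `<=` eball 1 ->
  (forall y, ball_at x rho y -> quadratic (u x) p c x y <= u y) ->
  forall g, - (`|c| * near_bound rho) <= tail_op (K g) u x rho.
Proof.
move=> s0 s1 lam0 lamLam hK mu_ uU visc rho0 sub below g.
have xx : ball_at x rho x by rewrite /ball_at/= subrr enorm0.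
have qx : quadratic (u x) p c x x = u x.
  by rewrite /quadratic subrr /dot big1 ?enorm0 ?expr0n ?mulr0 ?addr0// => i _;
    rewrite mxE mulr0.
have [_ /(_ below) inf0] := visc x (ball_at x rho) (quadratic (u x) p c x)
  (sub _ xx) (@open_eball_at R n x rho) xx sub (@C2_on_quadratic _ _ _ _ _ _ _) qx.
have pv0 : (0 <= pv_op (K g) (patch u (ball_at x rho) (quadratic (u x) p c x)) x)%E.
  by apply: (le_trans inf0); apply: ereal_inf_lbound; exists g.
have [G /andP[G0 Gb] E] := pv_op_patch_quadratic x p c s0 s1 lam0 lamLam (hK g) rho0 mu_ uU.
move: pv0; rewrite E lee_fin subr_ge0 => cG.
rewrite (le_trans _ cG)// lerNl (le_trans (ler_norm _))// normrN normrM ler_wpM2l//.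
by rewrite ger0_norm.
Qed.

(** The infimum may fail to be attained; [tau] is the price of selecting one operator. *)
Lemma touching_above x p c rho (tau : R) :
  0 < s -> s < 1 -> 0 < lam -> lam <= Lam -> (forall g, kernel_class s lam Lam (K g)) ->
  measurable_fun setT u -> (forall v, `|u v| <= U) ->
  viscosity_solution (inf_op K) (eball 1) u ->
  0 < rho -> ball_at x rho `<=` eball 1 ->
  (forall y, ball_at x rho y -> u y <= quadratic (u x) p c x y) -> 0 < tau ->
  exists g, tail_op (K g) u x rho <= `|c| * near_bound rho + tau.
Proof.
move=> s0 s1 lam0 lamLam hK mu_ uU visc rho0 sub above tau0.
have xx : ball_at x rho x by rewrite /ball_at/= subrr enorm0.
have qx : quadratic (u x) p c x x = u x.
  by rewrite /quadratic subrr /dot big1 ?enorm0 ?expr0n ?mulr0 ?addr0// => i _;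
    rewrite mxE mulr0.
have [/(_ above) inf0 _] := visc x (ball_at x rho) (quadratic (u x) p c x)
  (sub _ xx) (@open_eball_at R n x rho) xx sub (@C2_on_quadratic _ _ _ _ _ _ _) qx.
have /ereal_inf_lt[_ [g _ <-]] : (inf_op K (patch u (ball_at x rho)
    (quadratic (u x) p c x)) x < tau%:E)%E by exact: le_lt_trans inf0 _.
have [G /andP[G0 Gb] ->] := pv_op_patch_quadratic x p c s0 s1 lam0 lamLam (hK g) rho0 mu_ uU.
rewrite lte_fin ltrBlDl => /ltW h; exists g; rewrite (le_trans h)// lerD2r.
rewrite (le_trans (ler_norm _))// normrM ler_wpM2l//.
by rewrite ger0_norm.
Qed.

Lemma tail_op_sum g rho x y z
    (D := fun v => u (x - v) + u (y - v) - 2 * u (z - v)) :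
  0 < s -> 0 < lam -> lam <= Lam -> kernel_class s lam Lam (K g) ->
  measurable_fun setT u -> (forall v, `|u v| <= U) -> 0 < rho ->
  \int[mu]_(v in outside rho) ((D 0 - D v) * fine (K g v)) =
  tail_op (K g) u x rho + tail_op (K g) u y rho - 2 * tail_op (K g) u z rho.
Proof.
move=> s0 lam0 lamLam hK mu_ uU rho0.
have mO : measurable (@outside R n rho) by exact: measurable_outside.
have ik := integrable_kernel s0 lam0 lamLam hK rho0.
have it w : mu.-integrable (outside rho)
    (EFin \o (fun v => (u w - u (w - v)) * fine (K g v))).
  apply: (@integrable_bounded_mul _ _ _ _ _ _ _ (U + U)) => //.
    apply: measurable_funTS; apply: measurable_funB => //.
    by apply: (measurableT_comp mu_); exact: measurable_reflect_rV.
  by move=> v _; rewrite (le_trans (ler_normB _ _))// lerD.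
rewrite -mulNr /tail_op -RintegralD// -RintegralZl// -RintegralD//; first last.
- exact: integrable_EFinZl.
- exact: integrable_EFinD.
by apply: eq_Rintegral => v _; rewrite /D !subr0; ring.
Qed.

Lemma exists_small_near_bound (a eta rho0 : R) : s < 1 -> 0 < eta -> 0 < rho0 ->
  exists2 rho, 0 < rho <= rho0 & a * near_bound rho <= eta.
Proof.
move=> s1 eta0 rho00.
have cv : a * near_bound r @[r --> 0^'+] --> a * (Lam * (@near_const R n s * 0)).
  apply: cvgM; first exact: cvg_cst.
  apply: cvgM; first exact: cvg_cst.
  apply: cvgM; first exact: cvg_cst.
  by apply: powR_cvg0; lra.
rewrite !mulr0 in cv.
have h : \forall r \near 0^'+, a * near_bound r < eta by apply: (cvgr_lt 0 cv).
near (0 : R)^'+ => r.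
exists r.
  apply/andP; split; near: r; [exact: nbhs_right_gt|exact: nbhs_right_le].
by apply/ltW; near: r.
Unshelve. all: by end_near. Qed.

(** The operator is selected at [z], where [u] is touched from above; the inequalities at [x] and
    [y] hold for every operator, in particular for this one. The openings [c] and [c'] are fixed
    before [rho] shrinks, so their size is harmless. *)
Lemma three_point_touching x y z px py pz (c c' rho0 eta : R)
    (D := fun v => u (x - v) + u (y - v) - 2 * u (z - v)) :
  0 < s -> s < 1 -> 0 < lam -> lam <= Lam -> (forall g, kernel_class s lam Lam (K g)) ->
  measurable_fun setT u -> (forall v, `|u v| <= U) ->
  viscosity_solution (inf_op K) (eball 1) u -> 0 < rho0 -> 0 < eta ->
  ball_at x rho0 `<=` eball 1 -> ball_at y rho0 `<=` eball 1 ->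
  ball_at z rho0 `<=` eball 1 ->
  (forall w, ball_at x rho0 w -> quadratic (u x) px c x w <= u w) ->
  (forall w, ball_at y rho0 w -> quadratic (u y) py c y w <= u w) ->
  (forall w, ball_at z rho0 w -> u w <= quadratic (u z) pz c' z w) ->
  exists g, exists2 rho, 0 < rho <= rho0 &
    - eta <= \int[mu]_(v in outside rho) ((D 0 - D v) * fine (K g v)).
Proof.
move=> s0 s1 lam0 lamLam hK mu_ uU visc rho00 eta0 subx suby subz bx by_ az.
have eta2 : 0 < eta / 2 by rewrite divr_gt0.
have [rho /andP[rhop rhole] small] :=
  exists_small_near_bound (2 * `|c| + 2 * `|c'|) s1 eta2 rho00.
have shrink (w : 'rV[R]_n) : ball_at w rho `<=` ball_at w rho0.
  by move=> v; rewrite /ball_at/= => /lt_le_trans; exact.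
have eta4 : 0 < eta / 4 by rewrite divr_gt0.
have [g gz] := touching_above s0 s1 lam0 lamLam hK mu_ uU visc rhop
  (subset_trans (shrink z) subz) (fun w ww => az w (shrink _ _ ww)) eta4.
have gx := touching_below s0 s1 lam0 lamLam hK mu_ uU visc rhop
  (subset_trans (shrink x) subx) (fun w ww => bx w (shrink _ _ ww)) g.
have gy := touching_below s0 s1 lam0 lamLam hK mu_ uU visc rhop
  (subset_trans (shrink y) suby) (fun w ww => by_ w (shrink _ _ ww)) g.
exists g, rho; first by rewrite rhop.
rewrite (tail_op_sum _ _ _ s0 lam0 lamLam (hK g) mu_ uU rhop).
move: small gx gy gz; rewrite mulrDl.
move: (near_bound rho) (tail_op _ _ x _) (tail_op _ _ y _) (tail_op _ _ z _).
by move=> b tx ty tz; lra.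
Qed.

End touching.

(** * The penalised minimum *)

Section weight.
Context {R : realType} {n : nat}.
Implicit Types (x y z v : 'rV[R]_n).

(** It vanishes at radius [3/4], strictly between [1/2], where the conclusion is wanted, and [7/8],
    the radius allowed for [x] and [y]. *)
Definition weight z : R := 9 / 16 - enorm z ^+ 2.

(** After clearing the denominator the difference is [a^2 (9 + 22a + 12a^2)], and the last factor is
    positive on [|a| <= 1/2]. *)
Lemma inv_sqr_le (a : R) : `|a| <= 1 / 2 -> (1 + a) ^- 2 <= 1 - 2 * a + 12 * a ^+ 2.
Proof.
rewrite ler_norml => /andP[a1 a2]; have a0 : 0 < 1 + a by lra.
rewrite -div1r ler_pdivrMr ?exprn_gt0//.
have -> : (1 - 2 * a + 12 * a ^+ 2) * (1 + a) ^+ 2 =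
  1 + a ^+ 2 * (9 + 22 * a + 12 * a ^+ 2) by ring.
rewrite lerDl mulr_ge0 ?sqr_ge0//.
by have := sqr_ge0 (a + 1 / 2); nra.
Qed.

Lemma weight_le1 z : weight z <= 9 / 16.
Proof. by rewrite /weight lerBlDr lerDl sqr_ge0. Qed.

Lemma weight_enorm z : 0 < weight z -> enorm z < 3 / 4.
Proof.
move=> t0; rewrite -(ltr_pXn2r (ltn0Sn 1)) ?nnegrE ?enorm_ge0//.
by move: t0; rewrite /weight; lra.
Qed.

Lemma weightB z v : weight (z - v) = weight z + (2 * dot z v - enorm v ^+ 2).
Proof.
by rewrite /weight !enorm_sqr dotDl !dotDr !dotNl !dotNr (dotC v z); ring.
Qed.

Lemma weight_shift_le z v : 0 < weight z -> enorm v <= weight z / 16 ->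
  `|2 * dot z v - enorm v ^+ 2| <= 3 * enorm v.
Proof.
move=> t0 vt; have z34 := weight_enorm t0; have t1 := weight_le1 z.
have := normr_dot z v; have v0 := enorm_ge0 v; have z0 := enorm_ge0 z.
have zv : enorm z * enorm v <= 3 / 4 * enorm v by rewrite ler_wpM2r// ltW.
have vv : enorm v ^+ 2 <= enorm v by rewrite expr2 ler_piMl//; lra.
have vv0 := sqr_ge0 (enorm v).
by rewrite !ler_norml => /andP[d1 d2]; apply/andP; split; lra.
Qed.

Lemma weight_shift_ge z v : 0 < weight z -> enorm v <= weight z / 16 ->
  weight z / 2 <= weight (z - v).
Proof.
move=> t0 vt; have := weight_shift_le t0 vt; rewrite weightB ler_norml => /andP[d1 d2].
by lra.
Qed.

(** With [t = weight z], write [weight (z - v) = t (1 + a)], where [|a| <= 3 |v| / t]. The term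
    [-2a] yields the linear part and [2 |v|^2 / t], and [12 a^2] adds [108 |v|^2 / t^2]; since
    [t <= 1] the total is 110. *)
Lemma weight_inv_sqr_le z v : 0 < weight z -> enorm v <= weight z / 16 ->
  weight (z - v) ^- 2 - weight z ^- 2 <=
  - (4 / weight z ^+ 3) * dot z v + 110 / weight z ^+ 4 * enorm v ^+ 2.
Proof.
move=> t0 vt; have sh := weight_shift_le t0 vt; have t1 := weight_le1 z.
have v0 := enorm_ge0 v.
have tn0 : weight z != 0 by rewrite gt_eqF.
set t := weight z in t0 vt t1 tn0 *.
set b := 2 * dot z v - enorm v ^+ 2 in sh.
pose a := b / t.
have aE : `|a| <= 3 * enorm v / t.
  by rewrite /a normrM (ger0_norm (_ : 0 <= t^-1)) ?invr_ge0 ?(ltW t0)// ler_wpM2r// invr_ge0 ltW.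
have a12 : `|a| <= 1 / 2.
  by rewrite (le_trans aE)// ler_pdivrMr//; lra.
have -> : weight (z - v) = t * (1 + a).
  by rewrite weightB -/t -/b /a; field.
rewrite exprMn invfM -[X in _ - X]mulr1 -mulrBr.
apply: (@le_trans _ _ (t ^- 2 * (- 2 * a + 12 * a ^+ 2))).
  rewrite ler_wpM2l ?invr_ge0 ?sqr_ge0//; have := inv_sqr_le a12.
  by move: ((1 + a) ^- 2) => q; lra.
have a2 : a ^+ 2 <= 9 * enorm v ^+ 2 / t ^+ 2.
  have -> : 9 * enorm v ^+ 2 / t ^+ 2 = (3 * enorm v / t) ^+ 2 by field.
  by rewrite -(real_normK (num_real a)) ler_pXn2r ?nnegrE// (le_trans _ aE).
have -> : - (4 / t ^+ 3) * dot z v + 110 / t ^+ 4 * enorm v ^+ 2 =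
   t ^- 2 * (- 4 * dot z v / t + 110 * (enorm v ^+ 2 / t ^+ 2)) by field.
rewrite ler_wpM2l ?invr_ge0 ?sqr_ge0//.
have -> : - 2 * a = - 4 * dot z v / t + 2 * (enorm v ^+ 2 / t) by rewrite /a /b; field.
have vt2 : enorm v ^+ 2 / t <= enorm v ^+ 2 / t ^+ 2.
  rewrite ler_wpM2l ?sqr_ge0// lef_pV2 ?posrE ?exprn_gt0//.
  by rewrite expr2 ler_piMl// ?(ltW t0)//; lra.
by move: a2; rewrite -mulrA; lra.
Qed.

End weight.

Section minimum.
Context {R : realType} {n : nat}.
Variable u : 'rV[R]_n -> R.
Implicit Types (x y z h : 'rV[R]_n) (kap w t : R).

Definition penalized kap w h x y z : R := u x + u y - 2 * u z +
  kap * (enorm (x - z - h) ^+ 2 + enorm (y - z + h) ^+ 2) + w * weight z ^- 2.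

Lemma compact_enorm_le (r : R) : compact [set x : 'rV[R]_n | enorm x <= r].
Proof.
apply: bounded_closed_compact.
  exists r; split; first exact: num_real.
  move=> M rM x /= xr; rewrite (le_trans (mx_norm_le_enorm x))//.
  by rewrite (le_trans xr)// ltW.
rewrite (_ : mkset _ = @enorm R 1 n @^-1` [set a | a <= r])//.
apply: preimage_closed; last exact: closed_le.
by move=> x _; exact: enorm_continuous.
Qed.

Lemma continuous_enorm_comp (T : topologicalType) (f : T -> 'rV[R]_n) (p : T) :
  {for p, continuous f} -> {for p, continuous (fun q => enorm (f q) ^+ 2)}.
Proof.
move=> fc; rewrite (_ : (fun q => _) = (fun q => dot (f q) (f q))).
  exact: dot_continuous.
by apply/funext => q; rewrite enorm_sqr.
Qed.

(** Restricting [z] to [t <= weight z] makes the domain compact and keeps the inverse square of the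
    weight continuous. That this constraint is inactive at the minimum is shown later, for suitable
    [t]. *)
Lemma penalized_minimum kap w t h x0 y0 z0 :
  (forall x, eball 1 x -> {for x, continuous u}) -> 0 < t ->
  enorm x0 <= 7 / 8 -> enorm y0 <= 7 / 8 -> t <= weight z0 ->
  exists x y z, [/\ enorm x <= 7 / 8, enorm y <= 7 / 8, t <= weight z &
    forall x' y' z', enorm x' <= 7 / 8 -> enorm y' <= 7 / 8 -> t <= weight z' ->
    penalized kap w h x y z <= penalized kap w h x' y' z'].
Proof.
move=> uc t0 hx0 hy0 hz0.
pose B := [set x : 'rV[R]_n | enorm x <= 7 / 8].
pose Z := [set z : 'rV[R]_n | t <= weight z].
have ZE : Z = [set z : 'rV[R]_n | enorm z <= Num.sqrt (9 / 16 - t)].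
  have s0 : 0 <= 9 / 16 - t by have := weight_le1 z0; lra.
  apply/seteqP; split => z; rewrite /Z /weight/= => h1.
    rewrite -(ler_pXn2r (ltn0Sn 1)) ?nnegrE ?enorm_ge0 ?sqrtr_ge0// (sqr_sqrtr s0).
    by rewrite lerBrDr -lerBrDl.
  have : enorm z ^+ 2 <= Num.sqrt (9 / 16 - t) ^+ 2.
    by rewrite ler_pXn2r ?nnegrE ?enorm_ge0 ?sqrtr_ge0.
  by rewrite (sqr_sqrtr s0) lerBrDr -lerBrDl.
have cS : compact (B `*` B `*` Z).
  apply: compact_setX; last by rewrite ZE; exact: compact_enorm_le.
  by apply: compact_setX; exact: compact_enorm_le.
pose Phi (q : 'rV[R]_n * 'rV[R]_n * 'rV[R]_n) := penalized kap w h q.1.1 q.1.2 q.2.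
have Phic : {within B `*` B `*` Z, continuous Phi}.
  apply: continuous_in_subspaceT => q; rewrite inE => -[[/= q1 q2] q3].
  have c1 : {for q, continuous (fun q : 'rV[R]_n * 'rV[R]_n * 'rV[R]_n => q.1.1)}.
    by apply: continuous_comp; exact: cvg_fst.
  have c2 : {for q, continuous (fun q : 'rV[R]_n * 'rV[R]_n * 'rV[R]_n => q.1.2)}.
    by apply: continuous_comp; [exact: cvg_fst|exact: cvg_snd].
  have c3 : {for q, continuous (fun q : 'rV[R]_n * 'rV[R]_n * 'rV[R]_n => q.2)}.
    exact: cvg_snd.
  have u1 : {for q.1.1, continuous u}.
    by apply: uc; rewrite /eball/=; move: q1; rewrite /B/=; lra.
  have u2 : {for q.1.2, continuous u}.
    by apply: uc; rewrite /eball/=; move: q2; rewrite /B/=; lra.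
  have wq : 0 < weight q.2 by exact: lt_le_trans q3.
  have u3 : {for q.2, continuous u}.
    by apply: uc; rewrite /eball/=; have := weight_enorm wq; lra.
  have uc1 := continuous_comp c1 u1.
  have uc2 := continuous_comp c2 u2.
  have uc3 := continuous_comp c3 u3.
  have wc : {for q, continuous (fun q : 'rV[R]_n * 'rV[R]_n * 'rV[R]_n => weight q.2)}.
    rewrite /prop_for /continuous_at /weight.
    by apply: cvgB; [exact: cvg_cst|exact: (continuous_enorm_comp c3)].
  have d1 : {for q, continuous (fun q : 'rV[R]_n * 'rV[R]_n * 'rV[R]_n =>
      q.1.1 - q.2 - h)}.
    rewrite /prop_for /continuous_at.
    by apply: cvgB; [apply: cvgB; [exact: c1|exact: c3]|exact: cvg_cst].
  have d2 : {for q, continuous (fun q : 'rV[R]_n * 'rV[R]_n * 'rV[R]_n =>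
      q.1.2 - q.2 + h)}.
    rewrite /prop_for /continuous_at.
    by apply: cvgD; [apply: cvgB; [exact: c2|exact: c3]|exact: cvg_cst].
  rewrite /prop_for /continuous_at /Phi /penalized.
  apply: cvgD.
    apply: cvgD.
      apply: cvgB; first by apply: cvgD; [exact: uc1|exact: uc2].
      by apply: cvgM; [exact: cvg_cst|exact: uc3].
    apply: cvgM; first exact: cvg_cst.
    by apply: cvgD; [exact: (continuous_enorm_comp d1)|exact: (continuous_enorm_comp d2)].
  apply: cvgM; first exact: cvg_cst.
  apply: cvgV; first by rewrite gt_eqF// exprn_gt0.
  rewrite expr2; under eq_fun do rewrite expr2.
  by apply: cvgM; exact: wc.
have [|[[x y] z]] := compact_EVT_min _ cS Phic.
  by exists (x0, y0, z0).
rewrite inE => -[[/= xB yB] zZ] minP.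
exists x, y, z; split=> // x' y' z' hx hy hz.
by apply: (minP (x', y', z')); rewrite inE.
Qed.

End minimum.

Section minimum_touching.
Context {R : realType} {n : nat}.
Variables (u : 'rV[R]_n -> R) (kap w t1 : R) (h x y z : 'rV[R]_n).
Implicit Types v : 'rV[R]_n.

Lemma enormD_sqr (a v : 'rV[R]_n) :
  enorm (a + v) ^+ 2 = enorm a ^+ 2 + 2 * dot a v + enorm v ^+ 2.
Proof. by rewrite !enorm_sqr dotDl !dotDr (dotC v a); ring. Qed.

Definition penalized_min := forall x' y' z' : 'rV[R]_n,
  enorm x' <= 7 / 8 -> enorm y' <= 7 / 8 -> t1 <= weight z' ->
  penalized u kap w h x y z <= penalized u kap w h x' y' z'.

(* Translating the three points simultaneously leaves the penalty unchanged. *)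
Lemma penalized_min_shift v : penalized_min -> 0 <= w -> 0 < weight z ->
  enorm v <= weight z / 16 -> enorm (x - v) <= 7 / 8 -> enorm (y - v) <= 7 / 8 ->
  t1 <= weight (z - v) ->
  u x + u y - 2 * u z - (u (x - v) + u (y - v) - 2 * u (z - v)) <=
  dot ((- (4 * w / weight z ^+ 3)) *: z) v + 110 * w / weight z ^+ 4 * enorm v ^+ 2.
Proof.
move=> min w0 t0 vt xv yv zv.
have := min _ _ _ xv yv zv.
rewrite /penalized.
have -> : x - v - (z - v) = x - z by rewrite opprB addrA subrK.
have -> : y - v - (z - v) = y - z by rewrite opprB addrA subrK.
have /(ler_wpM2l w0) := weight_inv_sqr_le t0 vt.
rewrite dotZl mulrBr.
have -> : w * (- (4 / weight z ^+ 3) * dot z v + 110 / weight z ^+ 4 * enorm v ^+ 2) =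
  - (4 * w / weight z ^+ 3) * dot z v + 110 * w / weight z ^+ 4 * enorm v ^+ 2.
  by field; rewrite gt_eqF.
lra.
Qed.

(** With [y] and [z] frozen, only [u x] and one square vary, and the variation of that square is
    exactly quadratic in [v]. *)
Lemma penalized_min_x v : penalized_min -> enorm (x + v) <= 7 / 8 ->
  enorm y <= 7 / 8 -> t1 <= weight z ->
  quadratic (u x) ((- (2 * kap)) *: (x - z - h)) (- kap) x (x + v) <= u (x + v).
Proof.
move=> min xv yB zB; have := min _ _ _ xv yB zB; rewrite /penalized.
have -> : x + v - z - h = x - z - h + v.
  by rewrite (addrAC x v) (addrAC (x - z) v).
rewrite (enormD_sqr (x - z - h) v) /quadratic [x + v - x]addrAC subrr add0r dotZl.
lra.
Qed.

Lemma penalized_min_y v : penalized_min -> enorm (y + v) <= 7 / 8 ->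
  enorm x <= 7 / 8 -> t1 <= weight z ->
  quadratic (u y) ((- (2 * kap)) *: (y - z + h)) (- kap) y (y + v) <= u (y + v).
Proof.
move=> min yv xB zB; have := min _ _ _ xB yv zB; rewrite /penalized.
have -> : y + v - z + h = y - z + h + v.
  by rewrite (addrAC y v) (addrAC (y - z) v).
rewrite (enormD_sqr (y - z + h) v) /quadratic [y + v - y]addrAC subrr add0r dotZl.
lra.
Qed.

(** Here [u z] enters with coefficient [-2], so the bound is from above and halved: two squares give
    [kap], and 110 from the weight gives 55. *)
Lemma penalized_min_z v : penalized_min -> 0 <= w -> 0 < weight z ->
  enorm v <= weight z / 16 -> enorm x <= 7 / 8 -> enorm y <= 7 / 8 ->
  t1 <= weight (z + v) ->
  u (z + v) <= quadratic (u z)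
    ((- kap) *: (x - z - h + (y - z + h)) + (2 * w / weight z ^+ 3) *: z)
    (kap + 55 * w / weight z ^+ 4) z (z + v).
Proof.
move=> min w0 t0 vt xB yB zB; have := min _ _ _ xB yB zB; rewrite /penalized.
have -> : x - (z + v) - h = x - z - h - v.
  by rewrite opprD addrA (addrAC (x - z) (- v)).
have -> : y - (z + v) + h = y - z + h - v.
  by rewrite opprD addrA (addrAC (y - z) (- v)).
have vt' : enorm (- v) <= weight z / 16 by rewrite enormN.
have /(ler_wpM2l w0) := weight_inv_sqr_le t0 vt'.
rewrite opprK (enormD_sqr (x - z - h) (- v)) (enormD_sqr (y - z + h) (- v)).
rewrite enormN !dotNr mulrBr.
rewrite /quadratic [z + v - z]addrAC subrr add0r (dotDl (_ *: _)) !dotZl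
  (dotDl (x - z - h) (y - z + h)).
have -> : w * (- (4 / weight z ^+ 3) * - dot z v + 110 / weight z ^+ 4 * enorm v ^+ 2) =
  2 * (2 * w / weight z ^+ 3 * dot z v + 55 * w / weight z ^+ 4 * enorm v ^+ 2).
  by field; rewrite gt_eqF.
rewrite [(kap + _) * _]mulrDl.
move: (2 * w / _ * dot z v) (55 * w / _ * enorm v ^+ 2) (w * _) (w * _).
by move=> a b c d; lra.
Qed.

End minimum_touching.

(** In units of [A q], with [q] standing for [r^(-2s)], the main term is [- c0] and the two errors
    are at most [c0 / 4] each. The sum [- c0 / 2] is strictly below [- c0 / 4]. *)
Lemma final_arithmetic (R : realType)
    (A1 c0 A2 eps m U hh t q hn mn : R) (A := m ^+ 2 * U * hh ^+ 2 / t ^+ 2) :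
  0 < c0 -> 0 <= A2 -> 0 < eps -> eps <= 1 -> 110 * A1 * eps ^+ 2 <= c0 / 4 ->
  1 <= m -> 20 * A2 <= eps ^+ 2 * c0 * m -> 0 < U -> 0 < hh -> 0 < t -> t <= 1 ->
  0 < q -> 0 <= hn -> hn <= 2 * hh -> 0 <= mn -> mn <= hh ^+ 2 ->
  110 * (m ^+ 2 * U * hh ^+ 2) / t ^+ 4 * (A1 * ((eps * t) ^+ 2 * q)) - A * (c0 * q)
  + U * (A2 * q * ((hn / (eps * t)) ^+ 2 + mn / (eps * t))) < - (c0 / 4 * A * q).
Proof.
move=> c00 A20 e0 e1 hA1 m1 hm U0 hh0 t0 t1 q0 hn0 hn2 mn0 mn2.
have A0 : 0 < A.
  by rewrite divr_gt0 ?exprn_gt0// !mulr_gt0 ?exprn_gt0//; lra.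
have Aq : 0 < A * q by exact: mulr_gt0.
have -> : 110 * (m ^+ 2 * U * hh ^+ 2) / t ^+ 4 * (A1 * ((eps * t) ^+ 2 * q)) =
    110 * A1 * eps ^+ 2 * (A * q).
  by rewrite /A; field; rewrite gt_eqF.
have b1 : 110 * A1 * eps ^+ 2 * (A * q) <= c0 / 4 * (A * q).
  by rewrite ler_wpM2r// ltW.
have et0 : 0 < eps * t by exact: mulr_gt0.
have et1 : eps * t <= 1 by rewrite mulr_ile1// ltW.
(* [5 = 2^2 + 1]: since [eps t <= 1], the first-difference term is no larger than
   [hh^2 / (eps t)^2]. *)
have b2 : (hn / (eps * t)) ^+ 2 + mn / (eps * t) <= 5 * hh ^+ 2 / (eps * t) ^+ 2.
  have -> : 5 * hh ^+ 2 / (eps * t) ^+ 2 =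
    (2 * hh / (eps * t)) ^+ 2 + hh ^+ 2 / (eps * t) ^+ 2.
    by field; rewrite !gt_eqF.
  apply: lerD.
    rewrite ler_pXn2r ?nnegrE ?divr_ge0 ?(ltW et0)//; last first.
      by rewrite mulr_ge0// ltW.
    by rewrite ler_wpM2r// invr_ge0 ltW.
  apply: ler_pM => //; first by rewrite invr_ge0 ltW.
  rewrite lef_pV2 ?posrE ?exprn_gt0//.
  by rewrite expr2 ler_piMl// ltW.
have b3 : U * (A2 * q * (5 * hh ^+ 2 / (eps * t) ^+ 2)) <= c0 / 4 * (A * q).
  have -> : U * (A2 * q * (5 * hh ^+ 2 / (eps * t) ^+ 2)) =
     20 * A2 * (U * hh ^+ 2 * q / (4 * eps ^+ 2 * t ^+ 2)).
    by field; rewrite !gt_eqF.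
  have -> : c0 / 4 * (A * q) = eps ^+ 2 * c0 * m ^+ 2 *
     (U * hh ^+ 2 * q / (4 * eps ^+ 2 * t ^+ 2)).
    by rewrite /A; field; rewrite !gt_eqF.
  rewrite ler_wpM2r//.
    rewrite divr_ge0//; first by rewrite !mulr_ge0// ?exprn_ge0// ltW.
    by rewrite !mulr_ge0// ?exprn_ge0// ltW.
  rewrite (le_trans hm)// expr2 ler_wpM2l ?ler_peMl//; last by lra.
  by rewrite mulr_ge0 ?sqr_ge0// ltW.
have b4 : U * (A2 * q * ((hn / (eps * t)) ^+ 2 + mn / (eps * t))) <= c0 / 4 * (A * q).
  rewrite (le_trans _ b3)// ler_wpM2l ?(ltW U0)// ler_wpM2l//.
  by rewrite mulr_ge0// ltW.
have cA : 0 < c0 * (A * q) by exact: mulr_gt0.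
have -> : A * (c0 * q) = c0 * (A * q) by ring.
have -> : c0 / 4 * A * q = c0 * (A * q) / 4 by ring.
have e4 : c0 / 4 * (A * q) = c0 * (A * q) / 4 by ring.
rewrite e4 in b1 b4.
move: b1 b4 cA; set X := 110 * _ * _ * _; set Y := U * (_ * _); set Z := c0 * _.
move: (X) (Y) (Z) => {}X {}Y {}Z; lra.
Qed.

(** * Lower bound for second differences *)

Section semiconvexity.
Context {R : realType} {n : nat}.
Implicit Types (x y z h v : 'rV[R]_n).

Lemma semiconvexity_at (s lam Lam A1 c0 A2 eps m : R) (Gamma : Type)
    (K : Gamma -> 'rV[R]_n -> \bar R) (u : 'rV[R]_n -> R) (U : R) (z0 h : 'rV[R]_n) :
  (0 < n)%N -> 0 < s -> s < 1 -> 0 < lam -> lam <= Lam ->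
  A1 = Lam * (@near_const R n s * 2 `^ (2 - 2 * s)) ->
  c0 = lam * (3 * n%:R) `^ (- n%:R - 2 * s) ->
  A2 = @diff_const R n s Lam * (@tail_const R n s * 2 `^ (2 * s)) ->
  0 < eps -> eps <= 1 / 32 -> 110 * A1 * eps ^+ 2 <= c0 / 4 ->
  1 <= m -> 32 <= eps * m -> 20 * A2 <= eps ^+ 2 * c0 * m ->
  0 < U -> (forall g, kernel_class s lam Lam (K g)) ->
  measurable_fun setT u -> (forall v, `|u v| <= U) ->
  (forall x, eball 1 x -> {for x, continuous u}) ->
  viscosity_solution (inf_op K) (eball 1) u ->
  enorm z0 < 1 / 2 -> 0 < enorm h -> enorm h <= 1 / 64 -> m * enorm h <= 1 ->
  - (11 * m ^+ 2 * U * enorm h ^+ 2) <= u (z0 + h) + u (z0 - h) - 2 * u z0.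
Proof.
move=> n0 s0 s1 lam0 lamLam A1E c0E A2E e0 e32 hA1 m1 me hm U0 hK mu_ uU uc visc.
move=> hz0 hh0 hh64 mhh.
have Lam0 : 0 < Lam by exact: lt_le_trans lamLam.
have m0 : 0 < m by lra.
have c00 : 0 < c0.
  by rewrite c0E mulr_gt0// powR_gt0// mulr_gt0// ltr0n.
have A20 : 0 <= A2.
  rewrite A2E; apply: mulr_ge0; first exact: diff_const_ge0 (ltW Lam0).
  by rewrite mulr_ge0 ?powR_ge0// ltW// tail_const_gt0.
rewrite leNgt; apply/negP => neg.
set hh := enorm h in hh0 hh64 mhh neg *.
pose w := m ^+ 2 * U * hh ^+ 2.
have w0 : 0 < w by rewrite !mulr_gt0 ?exprn_gt0.
(* [4 U] bounds the second difference of [u], so a negative minimum forces the sum of the two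
   penalty squares below [hh^4]. *)
pose kap := 4 * U / hh ^+ 4.
have kap0 : 0 < kap by rewrite divr_gt0 ?mulr_gt0 ?exprn_gt0.
(* Half of the lower bound [m hh / 2] proved below for [weight z]: the constraint is inactive and
   stays satisfied under shifts, which at most halve the weight. *)
pose t1 := m * hh / 4.
have t10 : 0 < t1 by rewrite divr_gt0 ?mulr_gt0.
have wz0 : 5 / 16 <= weight z0.
  rewrite /weight; have : enorm z0 ^+ 2 <= (1 / 2) ^+ 2.
    by rewrite ler_pXn2r ?nnegrE ?enorm_ge0// ltW.
  by lra.
have hx0 : enorm (z0 + h) <= 7 / 8.
  by rewrite (le_trans (enormD _ _))// -/hh; clear -hz0 hh64; lra.
have hy0 : enorm (z0 - h) <= 7 / 8.
  by rewrite (le_trans (enorm_sub _ _))// -/hh; clear -hz0 hh64; lra.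
have hz1 : t1 <= weight z0 by rewrite /t1; clear -wz0 mhh; lra.
have [x [y [z [xB yB zB min]]]] := penalized_minimum kap w h uc t10 hx0 hy0 hz1.
have minE : penalized_min u kap w t1 h x y z by exact: min.
have neg_min : penalized u kap w h x y z < 0.
  apply: le_lt_trans (min _ _ _ hx0 hy0 hz1) _; rewrite /penalized.
  have -> : z0 + h - z0 - h = 0 by rewrite (addrAC z0) subrr add0r subrr.
  have -> : z0 - h - z0 + h = 0 by rewrite (addrAC z0) subrr add0r addNr.
  (* [(16/5)^2 = 10.24]; this is the 11 of the conclusion. *)
  have wi : weight z0 ^- 2 <= 11.
    rewrite -[leRHS]invrK lef_pV2 ?posrE ?exprn_gt0//; last by clear -wz0; lra.
    by clear -wz0; nra.
  have := ler_wpM2l (ltW w0) wi; move: neg; rewrite enorm0 expr0n/= addr0 mulr0.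
  by rewrite /w; move: (_ * weight z0 ^- 2) => q; clear; lra.
have tz : 0 < weight z by exact: lt_le_trans zB.
have z34 := weight_enorm tz.
set D0 := u x + u y - 2 * u z.
have D0U : - (4 * U) <= D0.
  have := uU x; have := uU y; have := uU z; rewrite /D0 !ler_norml.
  by clear => /andP[? ?] /andP[? ?] /andP[? ?]; lra.
set t := weight z in tz zB *.
have t916 : t <= 9 / 16 by exact: weight_le1.
have pen0 : 0 <= kap * (enorm (x - z - h) ^+ 2 + enorm (y - z + h) ^+ 2).
  by rewrite mulr_ge0 ?(ltW kap0)// addr_ge0 ?sqr_ge0.
have wt0 : 0 < w * t ^- 2 by rewrite divr_gt0 ?exprn_gt0.
move: (neg_min); rewrite /penalized -/D0 -/t => sum_neg.
have wt4 : w * t ^- 2 < 4 * U by clear -sum_neg pen0 D0U; lra.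
have pen4 : kap * (enorm (x - z - h) ^+ 2 + enorm (y - z + h) ^+ 2) < 4 * U.
  by clear -sum_neg wt0 D0U; lra.
have D0A : D0 <= - (w * t ^- 2) by clear -sum_neg pen0; lra.
(* Read off from [w / t^2 < 4 U]: the minimum cannot approach the boundary faster than the step
   size. *)
have mt : m * hh < 2 * t.
  rewrite -(ltr_pXn2r (ltn0Sn 1)) ?nnegrE ?mulr_ge0 ?(ltW m0) ?(ltW hh0) ?(ltW tz)//.
  move: wt4; rewrite ltr_pdivrMr ?exprn_gt0// /w => h1.
  rewrite -(ltr_pM2l U0) !exprMn; clear -h1; lra.
have pen_hh : enorm (x - z - h) ^+ 2 + enorm (y - z + h) ^+ 2 < hh ^+ 4.
  rewrite -(ltr_pM2l kap0) (lt_le_trans pen4)//.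
  by rewrite /kap divfK// gt_eqF// exprn_gt0.
have al : enorm (x - z - h) <= hh ^+ 2.
  rewrite -(ler_pXn2r (ltn0Sn 1)) ?nnegrE ?enorm_ge0 ?sqr_ge0//.
  by rewrite -exprM (le_trans _ (ltW pen_hh))// lerDl sqr_ge0.
have be : enorm (y - z + h) <= hh ^+ 2.
  rewrite -(ler_pXn2r (ltn0Sn 1)) ?nnegrE ?enorm_ge0 ?sqr_ge0//.
  by rewrite -exprM (le_trans _ (ltW pen_hh))// lerDr sqr_ge0.
have hh2 : hh ^+ 2 <= hh by rewrite expr2 ler_piMl ?(ltW hh0)//; clear -hh64; lra.
have xz : enorm (x - z) <= 2 * hh.
  rewrite -[x - z](subrK h) (le_trans (enormD _ _))// -/hh; clear -al hh2; lra.
have yz : enorm (y - z) <= 2 * hh.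
  rewrite -[y - z](addrK h) (le_trans (enorm_sub _ _))// -/hh; clear -be hh2; lra.
pose r := eps * t.
have r0 : 0 < r by exact: mulr_gt0.
have rt : r <= t / 32 by rewrite /r; have := ler_wpM2r (ltW tz) e32; clear; lra.
have r16 : 16 * hh <= r.
  rewrite /r; have := ler_wpM2l (ltW e0) (ltW mt); have := ler_wpM2r (ltW hh0) me.
  by clear; lra.
have vt v : enorm v <= 2 * r -> enorm v <= t / 16 by clear -rt; lra.
have xv v : enorm v <= 2 * r -> enorm (x + v) <= 7 / 8.
  move=> vr; have := enormD x v; have := enormD (x - z) z; rewrite subrK.
  clear -vr z34 xz rt t916 hh64; lra.
have yv v : enorm v <= 2 * r -> enorm (y + v) <= 7 / 8.
  move=> vr; have := enormD y v; have := enormD (y - z) z; rewrite subrK.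
  clear -vr z34 yz rt t916 hh64; lra.
have zv v : enorm v <= 2 * r -> t1 <= weight (z - v).
  move=> /vt vr; rewrite (le_trans _ (weight_shift_ge tz vr))// -/t /t1; clear -mt; lra.
have rN v : enorm v <= 2 * r -> enorm (- v) <= 2 * r by rewrite enormN.
have sub1 (a : 'rV[R]_n) : (forall v, enorm v <= 2 * r -> enorm (a + v) < 1) ->
    ball_at a r `<=` eball 1.
  move=> H v; rewrite /ball_at /eball/= => vr.
  by rewrite -(subrK a v) addrC H//; clear -vr r0; lra.
have subx : ball_at x r `<=` eball 1.
  by apply: sub1 => v /xv xvr; clear -xvr; lra.
have suby : ball_at y r `<=` eball 1.
  by apply: sub1 => v /yv yvr; clear -yvr; lra.
have subz : ball_at z r `<=` eball 1.
  by apply: sub1 => v vr; have := enormD z v; clear -vr z34 rt t916; lra.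
have qr0 : 0 < r `^ (- 2 * s) by exact: powR_gt0.
pose A := m ^+ 2 * U * hh ^+ 2 / t ^+ 2.
have A0 : 0 < A by rewrite divr_gt0 ?exprn_gt0.
(* The slack allowed in the viscosity inequalities is a quarter of the main term. *)
have eta0 : 0 < c0 / 4 * A * r `^ (- 2 * s).
  by apply: mulr_gt0 => //; apply: mulr_gt0 => //; exact: divr_gt0.
have tx v : ball_at x r v ->
    quadratic (u x) ((- (2 * kap)) *: (x - z - h)) (- kap) x v <= u v.
  rewrite /ball_at/= => vr; have -> : v = x + (v - x) by rewrite addrC subrK.
  by apply: penalized_min_x minE _ yB zB; apply: xv; clear -vr r0; lra.
have ty v : ball_at y r v ->
    quadratic (u y) ((- (2 * kap)) *: (y - z + h)) (- kap) y v <= u v.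
  rewrite /ball_at/= => vr; have -> : v = y + (v - y) by rewrite addrC subrK.
  by apply: penalized_min_y minE _ xB zB; apply: yv; clear -vr r0; lra.
have tzv v : ball_at z r v -> u v <= quadratic (u z)
    ((- kap) *: (x - z - h + (y - z + h)) + (2 * w / weight z ^+ 3) *: z)
    (kap + 55 * w / weight z ^+ 4) z v.
  rewrite /ball_at/= => vr; have -> : v = z + (v - z) by rewrite addrC subrK.
  apply: penalized_min_z minE (ltW w0) tz _ xB yB _.
    by apply: vt; clear -vr r0; lra.
  by rewrite -[v - z]opprK; apply: zv; apply: rN; clear -vr r0; lra.
have [g [rho /andP[rho0 rhor] lower]] := three_point_touching s0 s1 lam0 lamLam hK mu_ uU
  visc r0 eta0 subx suby subz tx ty tzv.
(* The defects of [x] and [y] are split into a common drift [mm] of the centre, of size [hh^2], and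
   a correction of the step [h], so that the points are exactly [z + mm + h'] and [z + mm - h']. *)
pose mm := 2^-1 *: ((x - z - h) + (y - z + h)).
pose h' := h + 2^-1 *: ((x - z - h) - (y - z + h)).
have xzE : x - z = mm + h' by apply/rowP => i; rewrite !mxE; clear; field.
have yzE : y - z = mm - h' by apply/rowP => i; rewrite !mxE; clear; field.
have mmB : enorm mm <= hh ^+ 2.
  rewrite /mm enormZ ger0_norm// (le_trans (ler_wpM2l _ (enormD _ _)))//; clear -al be; lra.
have h'B : enorm h' <= 2 * hh.
  rewrite /h' (le_trans (enormD _ _))// enormZ ger0_norm// -/hh.
  have := enorm_sub (x - z - h) (y - z + h); clear -al be hh2; lra.
have h'r : enorm h' <= r / 8 by clear -h'B r16; lra.
have mmr : enorm mm <= r / 8 by clear -mmB hh2 r16 hh0; lra.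
pose p := (- (4 * w / weight z ^+ 3)) *: z.
have DQ v : enorm v <= 2 * r ->
    (u (x - 0) + u (y - 0) - 2 * u (z - 0)) - (u (x - v) + u (y - v) - 2 * u (z - v)) <=
    dot p v + 110 * w / t ^+ 4 * enorm v ^+ 2.
  move=> vr; rewrite !subr0; apply: penalized_min_shift minE (ltW w0) tz (vt _ vr) _ _ _.
  - exact: xv (rN _ vr).
  - exact: yv (rN _ vr).
  - exact: zv.
have Q0 : 0 <= 110 * w / t ^+ 4.
  by rewrite ltW// divr_gt0 ?exprn_gt0// mulr_gt0// ltr0n.
have DA : u (x - 0) + u (y - 0) - 2 * u (z - 0) <= - A by rewrite !subr0.
have := Rintegral_second_difference_le n0 s0 s1 lam0 lamLam (hK g) rho0 rhor (ltW U0) Q0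
  mu_ uU xzE yzE h'r mmr DQ (ltW A0) DA.
move=> /(le_trans lower); apply/negP; rewrite -ltNge.
have E1 : (2 * r) `^ (2 - 2 * s) = 2 `^ (2 - 2 * s) * (r ^+ 2 * r `^ (- 2 * s)).
  rewrite powRM ?(ltW r0)//; congr (_ * _).
  rewrite powRD ?(gt_eqF r0) ?implybT// powR_mulrn ?(ltW r0)//.
  by rewrite mulNr.
have E2 : (r / 2) `^ (- 2 * s) = 2 `^ (2 * s) * r `^ (- 2 * s).
  rewrite powRM ?(ltW r0) ?invr_ge0// mulrC; congr (_ * _).
  by rewrite -powR_inv1// -powRrM; congr (_ `^ _); ring.
have E3 : Lam * (@near_const R n s * (2 * r) `^ (2 - 2 * s)) =
    A1 * (r ^+ 2 * r `^ (- 2 * s)) by rewrite E1 A1E; ring.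
have E4 : @diff_const R n s Lam * (@tail_const R n s * (r / 2) `^ (- 2 * s)) =
    A2 * r `^ (- 2 * s) by rewrite E2 A2E !mulrA.
rewrite E3 E4 -c0E.
have e1 : eps <= 1 by clear -e32; lra.
have t1' : t <= 1 by clear -t916; lra.
exact: (final_arithmetic c00 A20 e0 e1 hA1 m1 hm U0 hh0 tz t1' qr0 (enorm_ge0 _) h'B
  (enorm_ge0 _) mmB).
Qed.

End semiconvexity.

(** * From second differences to convexity *)

Section local_convexity.
Context {R : realType} {n : nat}.
Implicit Types (x y z h : 'rV[R]_n).

Lemma eball_convex (r a : R) x y : 0 <= a -> a <= 1 -> eball r x -> eball r y ->
  eball r (a *: x + (1 - a) *: y).
Proof.
rewrite /eball/= => a0 a1 xr yr; rewrite (le_lt_trans (enormD _ _))//.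
rewrite !enormZ !ger0_norm ?subr_ge0//.
have [->|a0'] := eqVneq a 0; first by rewrite mul0r add0r subr0 mul1r.
have ap : 0 < a by rewrite lt_neqAle eq_sym a0'.
have h1 : a * enorm x < a * r by rewrite ltr_pM2l.
have h2 : (1 - a) * enorm y <= (1 - a) * r by rewrite ler_wpM2l ?subr_ge0// ltW.
lra.
Qed.

(* On a segment, f minus its affine interpolation is continuous, and it has no
   interior maximum since its second differences at short range are positive. *)
Lemma convex_function_second_difference (r : R) (f : 'rV[R]_n -> R) :
  (forall x, eball r x -> {for x, continuous f}) ->
  (forall z, eball r z -> exists2 d : R, 0 < d &
    forall h, 0 < enorm h -> enorm h < d -> 2 * f z < f (z + h) + f (z - h)) ->
  convex_function (eball r) f.
Proof.
move=> fc f2 t x y /set_mem xr /set_mem yr.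
have [xy|xy] := eqVneq x y.
  rewrite -xy !convmm; exact: lexx.
have t0 : 0 <= t%:num by [].
have t1 : t%:num <= 1 by [].
change (f (t%:num *: (x : 'rV[R]_n) + (1 - t%:num) *: (y : 'rV[R]_n)) <=
  t%:num * f x + (1 - t%:num) * f y).
pose p (a : R) : 'rV[R]_n := a *: (x : 'rV[R]_n) + (1 - a) *: (y : 'rV[R]_n).
pose g (a : R) := f (p a) - (a * f x + (1 - a) * f y).
have pr a : 0 <= a -> a <= 1 -> eball r (p a) by move=> a0 a1; exact: eball_convex.
have pE a b : p (a + b) = p a + b *: ((x : 'rV[R]_n) - y).
  by apply/rowP => i; rewrite !mxE; ring.
have pc : continuous p.
  move=> a; apply: (@continuousD _ _ _ (fun a : R => a *: (x : 'rV[R]_n))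
    (fun a : R => (1 - a) *: (y : 'rV[R]_n))).
    exact: scalel_continuous.
  apply: (@continuous_comp _ _ _ (fun a : R => 1 - a) (fun b : R => b *: (y : 'rV[R]_n))).
    by apply: cvgB; [exact: cvg_cst|exact: cvg_id].
  exact: scalel_continuous.
have gc : {within `[0, 1], continuous g}.
  apply: continuous_in_subspaceT => a /set_mem/=; rewrite in_itv/= => /andP[a0 a1].
  apply: (@continuousB _ _ _ (f \o p)).
    by apply: continuous_comp; [exact: pc|apply: fc; exact: pr].
  apply: (@continuousD _ _ _ (fun a : R => a * f x) (fun a : R => (1 - a) * f y)).
    by apply: cvgM; [exact: cvg_id|exact: cvg_cst].
  by apply: cvgM; [apply: cvgB; [exact: cvg_cst|exact: cvg_id]|exact: cvg_cst].
have [c c01 gmax] := EVT_max (@ler01 R) gc.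
suff g0 : g c <= 0.
  rewrite -subr_le0; apply: le_trans g0.
  by apply: (gmax t%:num); rewrite in_itv/= t0 t1.
move: c01; rewrite in_itv/= => /andP[c0 c1].
have [->|cn0] := eqVneq c 0.
  by rewrite /g /p scale0r add0r subr0 scale1r mul0r add0r mul1r subrr.
have [->|cn1] := eqVneq c 1.
  by rewrite /g /p subrr scale0r addr0 scale1r mul0r addr0 mul1r subrr.
have {}c0 : 0 < c by rewrite lt_neqAle eq_sym cn0.
have {}c1 : c < 1 by rewrite lt_neqAle cn1.
exfalso.
have [d d0 fd] := f2 _ (pr _ (ltW c0) (ltW c1)).
have xy0 : 0 < enorm ((x : 'rV[R]_n) - y) by rewrite enorm_gt0 subr_eq0.
(* Both [c - e] and [c + e] stay in [[0, 1]], and the factor 2 keeps the displacement strictly below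
   [d]. *)
pose e := Num.min (Num.min c (1 - c)) (d / (2 * enorm ((x : 'rV[R]_n) - y))).
have e0 : 0 < e.
  by rewrite !lt_min c0 subr_gt0 c1/= divr_gt0// mulr_gt0.
have ec : e <= c by rewrite !ge_min lexx.
have ec1 : e <= 1 - c by rewrite !ge_min lexx orbT.
have ed : e <= d / (2 * enorm ((x : 'rV[R]_n) - y)) by rewrite !ge_min lexx !orbT.
have := fd (e *: ((x : 'rV[R]_n) - y)).
rewrite enormZ gtr0_norm// mulr_gt0// => /(_ erefl).
have -> : e * enorm ((x : 'rV[R]_n) - y) < d.
  rewrite ler_pdivlMr ?mulr_gt0// in ed.
  by clear -ed d0; lra.
move=> /(_ erefl); rewrite -scaleNr -!pE => lt2.
have := gmax (c + e); have := gmax (c - e); rewrite !in_itv/= /g.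
have -> : 0 <= c - e by rewrite subr_ge0.
have -> : c - e <= 1 by clear -e0 c1; lra.
have -> : 0 <= c + e by clear -e0 c0; lra.
have -> : c + e <= 1 by clear -ec1; lra.
by move=> /(_ erefl) h1 /(_ erefl) h2; clear -lt2 h1 h2; lra.
Qed.

End local_convexity.

(** [eps] is fixed first, by the local error; [m] then absorbs the negative powers of [eps], its
    three summands securing one lower bound each. *)
Lemma semiconvexity_parameters (R : realFieldType) (A1 A2 c0 : R) : 0 < c0 -> 0 <= A2 ->
  exists eps m : R, [/\ 0 < eps, eps <= 1 / 32, 110 * A1 * eps ^+ 2 <= c0 / 4, 1 <= m &
    32 <= eps * m /\ 20 * A2 <= eps ^+ 2 * c0 * m].
Proof.
move=> c00 A20; pose q := c0 / (440 * (`|A1| + 1)).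
have q0 : 0 < q.
  apply: (divr_gt0 c00); apply: mulr_gt0; first by rewrite ltr0n.
  by rewrite ltr_wpDl.
pose eps := Num.min (1 / 32) q.
have e0 : 0 < eps by rewrite lt_min q0 andbT divr_gt0.
have e32 : eps <= 1 / 32 by rewrite ge_min lexx.
have eq_ : eps <= q by rewrite ge_min lexx orbT.
exists eps, (32 / eps + 20 * A2 / (eps ^+ 2 * c0) + 1).
have a1 : 0 < 32 / eps by rewrite divr_gt0.
have a2 : 0 <= 20 * A2 / (eps ^+ 2 * c0).
  by rewrite divr_ge0 ?mulr_ge0 ?ler0n// ltW// exprn_gt0.
split => //.
- have qE : 110 * (`|A1| + 1) * q = c0 / 4.
    by rewrite /q; field; rewrite gt_eqF// ltr_wpDl.
  rewrite -qE -!mulrA ler_pM2l ?ltr0n//.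
  apply: (@le_trans _ _ ((`|A1| + 1) * eps ^+ 2)).
    by rewrite ler_wpM2r ?sqr_ge0// (le_trans (ler_norm _))// lerDl.
  apply: ler_wpM2l; first by rewrite addr_ge0.
  by rewrite (le_trans _ eq_)// expr2 ler_piMl ?(ltW e0)//; clear -e32; lra.
- by clear -a1 a2; lra.
- split.
    rewrite -[leLHS](divfK (lt0r_neq0 e0)) mulrC.
    by rewrite ler_wpM2l ?(ltW e0)//; clear -a1 a2; lra.
  have ec : 0 < eps ^+ 2 * c0 by rewrite mulr_gt0// exprn_gt0.
  rewrite -[leLHS](divfK (lt0r_neq0 ec)) mulrC.
  by rewrite ler_wpM2l ?(ltW ec)//; clear -a1 a2; lra.
Qed.

Lemma second_difference_enorm_sqr (R : realType) (n : nat) (z h : 'rV[R]_n) :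
  enorm (z + h) ^+ 2 + enorm (z - h) ^+ 2 = 2 * enorm z ^+ 2 + 2 * enorm h ^+ 2.
Proof.
by rewrite !enorm_sqr !dotDl !dotDr !dotNl !dotNr (dotC h z); ring.
Qed.

Lemma continuous_eq_on (S T : topologicalType) (D : set S) (f g : S -> T) (x : S) :
  open D -> D x -> {in D, g =1 f} -> {for x, continuous f} -> {for x, continuous g}.
Proof.
move=> oD Dx gf fc P /=; rewrite gf ?inE// => /fc fP.
have xD : nbhs x D by exact: open_nbhs_nbhs.
have fP' : nbhs x (f @^-1` P) := fP.
change (nbhs x (g @^-1` P)).
apply: (@filterS2 _ (nbhs x) _ _ _ _ _ fP' xD) => y /= Py Dy.
by rewrite gf// inE.
Qed.

Theorem theorem1p1 (R : realType) (n : nat) (s lam Lam : R)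
    (hn : (0 < n)%N) (hs : 0 < s < 1) (hlam : 0 < lam) (hLam : lam <= Lam) :
  exists C : R, 0 < C /\
    forall (Gamma : Type) (K : Gamma -> 'rV[R]_n -> \bar R) (u : 'rV[R]_n -> R),
      (forall g, kernel_class s lam Lam (K g)) ->
      (forall x, eball 1 x -> {for x, continuous u}) ->
      Linfty u ->
      viscosity_solution (inf_op K) (eball 1) u ->
      forall e : 'rV[R]_n, enorm e = 1 ->
        dee_geN (eball (1 / 2)) e u (C * Linfty_norm u).
Proof.
case/andP: hs => s0 s1; have Lam0 : 0 < Lam by exact: lt_le_trans hLam.
pose A1 := Lam * (@near_const R n s * 2 `^ (2 - 2 * s)).
pose c0 := lam * (3 * n%:R) `^ (- n%:R - 2 * s).
pose A2 := @diff_const R n s Lam * (@tail_const R n s * 2 `^ (2 * s)).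
have c00 : 0 < c0 by rewrite mulr_gt0// powR_gt0// mulr_gt0// ltr0n.
have A20 : 0 <= A2.
  apply: mulr_ge0; first exact: diff_const_ge0 (ltW Lam0).
  by rewrite mulr_ge0 ?powR_ge0// ltW// tail_const_gt0.
have [eps [m [e0 e32 hA1 m1 [me hm]]]] := semiconvexity_parameters A1 c00 A20.
have n0 : 0 < n%:R :> R by rewrite ltr0n.
have m20 : 0 <= 11 * m ^+ 2 by rewrite mulr_ge0 ?sqr_ge0.
(* The factor [n] cancels the [2n] in the definition of the convexity sense up to 2, and the extra 1
   makes the second differences strictly positive. *)
exists (n%:R * (11 * m ^+ 2 + 1)); split; first by rewrite mulr_gt0// ltr_wpDl.
move=> Gamma K u hK uc uL visc e _.
have [v [mv vU vu [N [mN N0 uv]]]] := Linfty_representative uc uL.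
set U := Linfty_norm u in vU *.
have U0 : 0 <= U by exact: le_trans (vU 0).
have half1 (x : 'rV[R]_n) : eball (1 / 2) x -> eball 1 x.
  by rewrite /eball/= => /lt_trans; apply; lra.
have vc x : eball 1 x -> {for x, continuous v}.
  move=> x1; apply: (continuous_eq_on (@open_eball R n 1) x1 _ (uc _ x1)) => y.
  by move=> /set_mem; exact: vu.
have viscv := viscosity_solution_null mN N0 uv vu visc.
rewrite /dee_geN -/U.
(* For [U = 0] there is no strict inequality to exploit, but [u] vanishes on the ball. *)
have [U00|Un0] := eqVneq U 0.
  have u0 x : eball (1 / 2) x -> u x = 0.
    move=> /half1 /vu <-; apply/eqP; rewrite -normr_le0 -U00; exact: vU.
  move=> t x y /set_mem xr /set_mem yr.
  have ut : u (conv t x y) = 0 by apply: u0; exact: eball_convex.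
  by rewrite U00 !mulr0 !mul0r !addr0 ut (u0 _ xr) (u0 _ yr) convmm.
have Up : 0 < U by rewrite lt_neqAle eq_sym Un0.
have -> : n%:R * (11 * m ^+ 2 + 1) * U / (2 * n%:R) = (11 * m ^+ 2 + 1) * U / 2.
  by field; rewrite gt_eqF.
apply: convex_function_second_difference => [x /half1 x1|z zr].
  apply: (@continuousD _ _ _ u); first exact: uc.
  have ec : {for x, continuous (@enorm R 1 n)} by exact: enorm_continuous.
  apply: (@continuousM _ _ (cst _) (fun y => enorm y * enorm y)).
    exact: cst_continuous.
  by apply: continuousM; exact: ec.
have mp : 0 < m by exact: lt_le_trans m1.
exists (Num.min (1 / 64) m^-1) => [|h h0].
  by rewrite lt_min invr_gt0 mp andbT divr_gt0.
rewrite lt_min => /andP[/ltW h64 hm1].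
have mh : m * enorm h <= 1 by rewrite mulrC -ler_pdivlMr// mul1r ltW.
have := semiconvexity_at hn s0 s1 hlam hLam erefl erefl erefl e0 e32 hA1 m1 me hm Up hK
  mv vU vc viscv zr h0 h64 mh.
have zh1 : eball 1 (z + h).
  by rewrite /eball/= (le_lt_trans (enormD _ _))//; move: zr; rewrite /eball/=; lra.
have zh2 : eball 1 (z - h).
  by rewrite /eball/= (le_lt_trans (enorm_sub _ _))//; move: zr; rewrite /eball/=; lra.
rewrite !vu//; last exact: half1.
have Uh : 0 < U * enorm h ^+ 2 by rewrite mulr_gt0// exprn_gt0.
have := second_difference_enorm_sqr z h.
move: Uh; clear; move: (enorm (z + h) ^+ 2) (enorm (z - h) ^+ 2) => a b Uh ab low.
have -> : u (z + h) + (11 * m ^+ 2 + 1) * U / 2 * a + (u (z - h) + (11 * m ^+ 2 + 1) * U / 2 * b)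
  = u (z + h) + u (z - h) + (11 * m ^+ 2 + 1) * U / 2 * (a + b) by ring.
rewrite ab; move: low Uh; nra.
Qed.
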